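(* Let $f(\theta)$ be a smooth $2\pi$-periodic function. Then there exist two constants $\lambda_0>0$ and $\delta_0>0$, independent of each other, and a constant $C>0$ independent of $\lambda$, such that for any $\lambda\in[\lambda_0,+\infty)$ and any $0<\delta\leq\delta_0$ the stationary Navier-Stokes system outside the unit disc $$ \boldsymbol{u}\cdot\nabla\boldsymbol{u}+\nabla p-\Delta\boldsymbol{u}=0,\qquad \nabla\cdot\boldsymbol{u}=0\qquad\text{in }\mathbb{R}^2\setminus B, $$ with the boundary conditions $$ \boldsymbol{u}\cdot\boldsymbol{\tau}\big|_{\partial B}=\lambda+\lambda\delta f(\theta),\qquad \boldsymbol{u}\cdot\boldsymbol{n}\big|_{\partial B}=0,\qquad \boldsymbol{u}\to 0\ \text{ as } r\to\infty, $$ has a solution $\boldsymbol{u}$ satisfying, for some constant $\tilde\lambda\approx\lambda$, $$ \left|\boldsymbol{u}\cdot\boldsymbol{e}_\theta-\tilde{\lambda}r^{-1}\right|\leq C\lambda\delta r^{-2},\qquad \left|\boldsymbol{u}\cdot\boldsymbol{e}_r\right|\leq C\sqrt{\lambda}\,\delta r^{-2} $$ for all points of the exterior domain.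
   Context: $B$ is the unit disc centered at the origin of $\mathbb{R}^2$. Polar coordinates $x=r\cos\theta$, $y=r\sin\theta$ are used, with $\boldsymbol{e}_r=(\cos\theta,\sin\theta)$, $\boldsymbol{e}_\theta=(-\sin\theta,\cos\theta)$. On $\partial B$, $\boldsymbol{n}=\boldsymbol{e}_r$ is the unit outer normal of the disc and $\boldsymbol{\tau}=\boldsymbol{e}_\theta$ is the unit tangent, so that $(\boldsymbol{n},\boldsymbol{\tau})$ is positively oriented. $\tilde\lambda\approx\lambda$ means $c^{-1}\lambda\le\tilde\lambda\le c\lambda$ for some constant $c\geq 1$ independent of $\lambda$. Constants are understood, following the paper's convention, to depend only on parameters indicated by subscripts, so $C$ and $c$ do not depend on $\delta$ either (they may depend on $f$). *)

(* Defs.v *)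
From Stdlib Require Import Reals.
From Coquelicot Require Import Coquelicot.
Open Scope R_scope.

(* A planar vector field is given by its two Cartesian components
   u1 u2 : R -> R -> R, a scalar field by one function of (x, y).  These
   functions are total; only their values on r >= 1 matter. *)

Definition exterior (x y : R) : Prop := 1 < x ^ 2 + y ^ 2.
Definition exterior_closed (x y : R) : Prop := 1 <= x ^ 2 + y ^ 2.

(* Since [exterior] is open, [ex_diff_n g n] at all of its points says that g
   is of class C^n there. *)
Definition class_C (n : nat) (g : R -> R -> R) : Prop :=
  forall x y : R, exterior x y -> ex_diff_n g n x y.

Definition continuous_up_to_boundary (g : R -> R -> R) : Prop :=
  forall x y : R, exterior_closed x y ->
    filterlim (fun z : R * R => g (fst z) (snd z))
      (within (fun z : R * R => exterior_closed (fst z) (snd z))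
              (locally ((x, y) : R * R)))
      (locally (g x y)).

Definition dx (g : R -> R -> R) : R -> R -> R := partial_derive 1 0 g.
Definition dy (g : R -> R -> R) : R -> R -> R := partial_derive 0 1 g.
Definition laplacian (g : R -> R -> R) (x y : R) : R :=
  partial_derive 2 0 g x y + partial_derive 0 2 g x y.

Definition momentum_equation (u1 u2 p : R -> R -> R) : Prop :=
  forall x y : R, exterior x y ->
    u1 x y * dx u1 x y + u2 x y * dy u1 x y + dx p x y - laplacian u1 x y = 0 /\
    u1 x y * dx u2 x y + u2 x y * dy u2 x y + dy p x y - laplacian u2 x y = 0.

Definition divergence_free (u1 u2 : R -> R -> R) : Prop :=
  forall x y : R, exterior x y -> dx u1 x y + dy u2 x y = 0.

Definition navier_stokes_exterior (u1 u2 p : R -> R -> R) : Prop :=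
  class_C 2 u1 /\ class_C 2 u2 /\ class_C 1 p /\
  momentum_equation u1 u2 p /\ divergence_free u1 u2.

(* u . e_r and u . e_theta at the point of polar coordinates (r, theta); for
   r = 1 these are u . n and u . tau. *)
Definition radial (u1 u2 : R -> R -> R) (r theta : R) : R :=
  u1 (r * cos theta) (r * sin theta) * cos theta +
  u2 (r * cos theta) (r * sin theta) * sin theta.
Definition azimuthal (u1 u2 : R -> R -> R) (r theta : R) : R :=
  u1 (r * cos theta) (r * sin theta) * (- sin theta) +
  u2 (r * cos theta) (r * sin theta) * cos theta.

(* The boundary values are attained continuously. *)
Definition boundary_conditions (u1 u2 : R -> R -> R) (g : R -> R) : Prop :=
  continuous_up_to_boundary u1 /\ continuous_up_to_boundary u2 /\
  forall theta : R, azimuthal u1 u2 1 theta = g theta /\ radial u1 u2 1 theta = 0.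

Definition vanishes_at_infinity (u1 u2 : R -> R -> R) : Prop :=
  forall eps : R, 0 < eps -> exists rho : R,
    forall x y : R, rho < sqrt (x ^ 2 + y ^ 2) ->
      sqrt (u1 x y ^ 2 + u2 x y ^ 2) < eps.

Definition smooth_periodic (f : R -> R) : Prop :=
  (forall (n : nat) (t : R), ex_derive_n f n t) /\
  (forall t : R, f (t + 2 * PI) = f t).

(* Main.v *)
(** In the coordinates [s = ln r], [theta] the perturbation [psi] of the stream function of the
    rotating flow [lambda / r] and its vorticity [om] satisfy
      [psi_ss + psi_tt = - e^(2s) om],
      [om_ss + om_tt - lambda om_t = psi_t om_s - psi_s om_t],
    where [t] stands for [theta].  On each Fourier mode [n] the left-hand sides have constant
    coefficients and are inverted by the two first-order solution operators
    [y' = mu y - F] and [y' = - mu y + F], with [mu^2 = n^2 + i lambda n], so that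
    [Re mu >= sqrt (lambda |n| / 2)]: the vorticity lives in a boundary layer of width
    [lambda^(-1/2)].  Measuring [om] in [L^1 (e^(k s) ds)], [k = sqrt lambda / 4], the solution
    operator gains the factor [1 / lambda] that the quadratic term costs, uniformly in
    [lambda].  The solution is the sum over all binary trees, with leaves labelled by the Fourier
    modes of [f] and with nodes applying the bilinear solution operator; its majorant [X] obeys
    [X <= C lambda delta + (C / lambda) X^2], which is bounded for small [delta] whatever
    [lambda].  The mode [n = 0] of the azimuthal velocity has a limit at infinity, which
    corrects [lambda] into [lambda']. *)

Require Import Defs.
From Stdlib Require Import Reals Ranalysis5 Psatz ZArith.
From Coquelicot Require Import Coquelicot.
Open Scope R_scope.

(** * Calculus of complex-valued functions *)

(** The solution is written down rather than obtained from a fixed-point theorem: every tree carries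
    explicit profiles, so no function space has to be complete and existence reduces to one
    numerical majorant series. With [P] the weighted L^1 size of [om], and up to powers of [|n|],
    [psi] has size [P / k], [psi_s] size [P] and [om_s] size [k P]; both halves of the Jacobian thus
    cost [P^2], paid by [mu^(-2)]. The mode [n = 0] has no [mu]: there the Jacobian is the total
    derivative of [psi_t om], integrated once to [om_s = psi_t om], and [1 / lambda] is recovered
    from the [1 / k] of [psi] and one integration against the weight. Taking no constant in that
    step is also what makes the pressure single-valued. Once growing solutions are discarded, a
    nonzero mode keeps two free constants, spent on [psi = 0] and on [psi_s] at [s = 0]. In mode [0]
    only [psi_s] matters, and its one free constant produces the limit at infinity. To recover the
    momentum equation, and not only its curl, a Bernoulli pressure is carried along mode by mode. *)

Lemma is_derive_Rplus (f g : R -> R) s l m :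
  is_derive f s l -> is_derive g s m -> is_derive (fun t => f t + g t) s (l + m).
Proof. apply (is_derive_plus (V := R_NormedModule)). Qed.

Lemma is_derive_Ropp (f : R -> R) s l : is_derive f s l -> is_derive (fun t => - f t) s (- l).
Proof. apply (is_derive_opp (V := R_NormedModule)). Qed.

Lemma is_derive_Rminus (f g : R -> R) s l m :
  is_derive f s l -> is_derive g s m -> is_derive (fun t => f t - g t) s (l - m).
Proof. apply (is_derive_minus (V := R_NormedModule)). Qed.

Lemma is_derive_Rmult (f g : R -> R) s l m :
  is_derive f s l -> is_derive g s m -> is_derive (fun t => f t * g t) s (l * g s + f s * m).
Proof. intros; apply (is_derive_mult f g s l m); auto. intros; apply Rmult_comm. Qed.

Lemma is_derive_Rconst (c s : R) : is_derive (fun _ : R => c) s 0.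
Proof. apply (is_derive_const (V := R_NormedModule)). Qed.

Lemma is_derive_Rid (s : R) : is_derive (fun t : R => t) s 1.
Proof. apply (is_derive_id (K := R_AbsRing)). Qed.

Lemma continuous_Rplus {U : UniformSpace} (f g : U -> R) x :
  continuous f x -> continuous g x -> continuous (fun t => f t + g t) x.
Proof. apply (continuous_plus (V := R_NormedModule)). Qed.

Lemma continuous_Ropp {U : UniformSpace} (f : U -> R) x :
  continuous f x -> continuous (fun t => - f t) x.
Proof. apply (continuous_opp (V := R_NormedModule)). Qed.

Lemma continuous_Rminus {U : UniformSpace} (f g : U -> R) x :
  continuous f x -> continuous g x -> continuous (fun t => f t - g t) x.
Proof. apply (continuous_minus (V := R_NormedModule)). Qed.

Lemma continuous_Rmult {U : UniformSpace} (f g : U -> R) x :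
  continuous f x -> continuous g x -> continuous (fun t => f t * g t) x.
Proof. apply (continuous_mult (K := R_AbsRing)). Qed.

Lemma continuous_Rscal {U : UniformSpace} (c : R) (f : U -> R) x :
  continuous f x -> continuous (fun t => c * f t) x.
Proof. apply (continuous_scal_r (V := R_NormedModule)). Qed.

Lemma continuous_ex_derive (f : R -> R) x : ex_derive f x -> continuous f x.
Proof. apply (ex_derive_continuous (V := R_NormedModule)). Qed.

(** Componentwise, so that the real calculus of derivatives and of [RInt] applies to each part. *)
Definition Cderive (f : R -> C) (s : R) (l : C) : Prop :=
  is_derive (fun t => Re (f t)) s (Re l) /\ is_derive (fun t => Im (f t)) s (Im l).

Definition Ccontinuous (f : R -> C) : Prop :=
  forall s, continuous (fun t => Re (f t)) s /\ continuous (fun t => Im (f t)) s.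

Definition CInt (f : R -> C) (a b : R) : C :=
  (RInt (fun t => Re (f t)) a b, RInt (fun t => Im (f t)) a b).

Definition cexp (mu : C) (s : R) : C :=
  (exp (Re mu * s) * cos (Im mu * s), exp (Re mu * s) * sin (Im mu * s)).

Lemma C_ext (z w : C) : Re z = Re w -> Im z = Im w -> z = w.
Proof. destruct z, w; simpl; intros; now subst. Qed.

Ltac Cring := apply C_ext; unfold Re, Im; simpl; ring.

Lemma Cmod_le_abs (z : C) : Cmod z <= Rabs (Re z) + Rabs (Im z).
Proof.
  assert (E : z = (RtoC (Re z) + Ci * RtoC (Im z))%C) by Cring. rewrite E at 1; clear E.
  eapply Rle_trans; [apply Cmod_triangle|].
  rewrite Cmod_mult, Cmod_Ci, !Cmod_R, Rmult_1_l. apply Rle_refl.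
Qed.

Lemma Im_le_Cmod (z : C) : Rabs (Im z) <= Cmod z.
Proof. eapply Rle_trans; [apply Rmax_r|apply Rmax_Cmod]. Qed.

(** Duality: the multiplier [Cconj z / |z|] turns [z] into its modulus. Bounds on real parts pass
    easily through integrals and limits; this converts them back into bounds on moduli without
    losing a constant. *)
Lemma Cmod_le_of_Re (z : C) (m : R) :
  0 <= m -> (forall w : C, Cmod w <= 1 -> Re (w * z)%C <= m) -> Cmod z <= m.
Proof.
  intros Hm H. destruct (Req_dec (Cmod z) 0) as [E|E]; [lra|].
  assert (Hp : 0 < Cmod z) by (pose proof (Cmod_ge_0 z); lra).
  specialize (H (Cconj z * RtoC (/ Cmod z))%C).
  assert (Re (Cconj z * RtoC (/ Cmod z) * z)%C = Cmod z).
  { replace (Cconj z * RtoC (/ Cmod z) * z)%C with (RtoC (/ Cmod z) * (z * Cconj z))%C by ring.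
    rewrite <- Cmod2_conj. rewrite <- RtoC_mult. simpl. field. lra. }
  rewrite H0 in H. apply H. rewrite Cmod_mult, Cmod_conj, Cmod_R, Rabs_pos_eq.
  - right; field; lra.
  - left; now apply Rinv_0_lt_compat.
Qed.

Lemma Cderive_continuous (f f' : R -> C) :
  (forall s, Cderive f s (f' s)) -> Ccontinuous f.
Proof.
  intros H s; destruct (H s) as [H1 H2].
  split; apply continuous_ex_derive; eexists; eassumption.
Qed.

Lemma Cderive_eq (f : R -> C) s l l' : Cderive f s l -> l = l' -> Cderive f s l'.
Proof. now intros H <-. Qed.

Lemma Cderive_ext (f g : R -> C) s l :
  (forall t, f t = g t) -> Cderive f s l -> Cderive g s l.
Proof.
  intros E [H1 H2]; split; [apply is_derive_ext with (2 := H1)|apply is_derive_ext with (2 := H2)];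
  intros t; now rewrite E.
Qed.

Lemma Cderive_const (c : C) s : Cderive (fun _ => c) s 0.
Proof. split; apply is_derive_Rconst. Qed.

Lemma Cderive_plus (f g : R -> C) s l m :
  Cderive f s l -> Cderive g s m -> Cderive (fun t => f t + g t)%C s (l + m)%C.
Proof.
  intros [H1 H2] [H3 H4]; split; apply is_derive_Rplus; assumption.
Qed.

Lemma Cderive_opp (f : R -> C) s l :
  Cderive f s l -> Cderive (fun t => - f t)%C s (- l)%C.
Proof.
  intros [H1 H2]; split; apply is_derive_Ropp; assumption.
Qed.

Lemma Cderive_minus (f g : R -> C) s l m :
  Cderive f s l -> Cderive g s m -> Cderive (fun t => f t - g t)%C s (l - m)%C.
Proof. intros; now apply Cderive_plus, Cderive_opp. Qed.

Lemma Cderive_conj (f : R -> C) s l :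
  Cderive f s l -> Cderive (fun t => Cconj (f t)) s (Cconj l).
Proof.
  intros [H1 H2]; split; [assumption|].
  apply (is_derive_Ropp (fun t => Im (f t))); assumption.
Qed.

Lemma Cderive_mult (f g : R -> C) s l m :
  Cderive f s l -> Cderive g s m ->
  Cderive (fun t => f t * g t)%C s (l * g s + f s * m)%C.
Proof.
  intros [H1 H2] [H3 H4].
  assert (P : forall u v u' v', is_derive u s u' -> is_derive v s v' ->
     is_derive (fun t : R => u t * v t) s (u' * v s + u s * v')).
  { intros. apply (is_derive_mult u v s u' v'); auto. intros; apply Rmult_comm. }
  split.
  - replace (Re (l * g s + f s * m)%C) with
      ((Re l * Re (g s) + Re (f s) * Re m) - (Im l * Im (g s) + Im (f s) * Im m))
      by (unfold Re, Im; simpl; ring).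
    apply is_derive_Rminus; apply P; assumption.
  - replace (Im (l * g s + f s * m)%C) with
      ((Re l * Im (g s) + Re (f s) * Im m) + (Im l * Re (g s) + Im (f s) * Re m))
      by (unfold Re, Im; simpl; ring).
    apply is_derive_Rplus; apply P; assumption.
Qed.

Lemma Cderive_scal (c : C) (f : R -> C) s l :
  Cderive f s l -> Cderive (fun t => c * f t)%C s (c * l)%C.
Proof.
  intros H. eapply Cderive_eq; [apply Cderive_mult; [apply Cderive_const|exact H]|].
  apply C_ext; simpl; ring.
Qed.

Lemma Cderive_cexp (mu : C) s : Cderive (cexp mu) s (mu * cexp mu s)%C.
Proof.
  split; unfold cexp, Re, Im; simpl; auto_derive; trivial; ring.
Qed.

Lemma cexp_0 (mu : C) : cexp mu 0 = 1%C.
Proof. unfold cexp; rewrite !Rmult_0_r, exp_0, cos_0, sin_0. apply C_ext; simpl; ring. Qed.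

Lemma cexp_opp (mu : C) s : (cexp mu s * cexp (- mu) s)%C = 1%C.
Proof.
  unfold cexp.
  assert (E : exp (Re mu * s) * exp (Re (- mu)%C * s) = 1).
  { rewrite <- exp_plus. replace (Re mu * s + Re (- mu)%C * s) with 0 by (simpl; unfold Re; ring). apply exp_0. }
  replace (Im (- mu)%C * s) with (- (Im mu * s)) by (simpl; unfold Im; ring).
  rewrite cos_neg, sin_neg.
  pose proof (sin2_cos2 (Im mu * s)) as T; unfold Rsqr in T.
  apply C_ext; unfold Re, Im in *; simpl.
  - transitivity (exp (fst mu * s) * exp (- fst mu * s) *
      (sin (snd mu * s) * sin (snd mu * s) + cos (snd mu * s) * cos (snd mu * s))); [ring|].
    rewrite T. simpl in E. rewrite E; ring.
  - ring.
Qed.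

Lemma Cmod_cexp (mu : C) s : Cmod (cexp mu s) = exp (Re mu * s).
Proof.
  unfold cexp, Cmod; simpl fst; simpl snd.
  set (e := exp _). set (x := Im mu * s).
  replace ((e * cos x) ^ 2 + (e * sin x) ^ 2) with (e ^ 2 * (Rsqr (sin x) + Rsqr (cos x)))
    by (unfold Rsqr; ring).
  rewrite sin2_cos2, Rmult_1_r. apply sqrt_pow2. left; apply exp_pos.
Qed.

Lemma Ccontinuous_const (c : C) : Ccontinuous (fun _ => c).
Proof. intros s; split; apply continuous_const. Qed.

Lemma Ccontinuous_plus (f g : R -> C) :
  Ccontinuous f -> Ccontinuous g -> Ccontinuous (fun t => f t + g t)%C.
Proof.
  intros Hf Hg s; destruct (Hf s), (Hg s); split; apply continuous_Rplus; assumption.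
Qed.

Lemma Ccontinuous_opp (f : R -> C) :
  Ccontinuous f -> Ccontinuous (fun t => - f t)%C.
Proof.
  intros Hf s; destruct (Hf s); split; apply continuous_Ropp; assumption.
Qed.

Lemma Ccontinuous_minus (f g : R -> C) :
  Ccontinuous f -> Ccontinuous g -> Ccontinuous (fun t => f t - g t)%C.
Proof. intros; now apply Ccontinuous_plus, Ccontinuous_opp. Qed.

Lemma Ccontinuous_conj (f : R -> C) :
  Ccontinuous f -> Ccontinuous (fun t => Cconj (f t)).
Proof.
  intros Hf s; destruct (Hf s); split; [assumption|].
  now apply (continuous_Ropp (fun t => Im (f t))).
Qed.

Lemma Ccontinuous_mult (f g : R -> C) :
  Ccontinuous f -> Ccontinuous g -> Ccontinuous (fun t => f t * g t)%C.
Proof.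
  intros Hf Hg s; destruct (Hf s), (Hg s); split.
  - apply (continuous_Rminus (fun t => Re (f t) * Re (g t)));
    apply continuous_Rmult; assumption.
  - apply (continuous_Rplus (fun t => Re (f t) * Im (g t)));
    apply continuous_Rmult; assumption.
Qed.

Lemma Ccontinuous_cexp (mu : C) : Ccontinuous (cexp mu).
Proof. eapply Cderive_continuous; intros; apply Cderive_cexp. Qed.

Lemma continuous_Cmod (f : R -> C) :
  Ccontinuous f -> forall s, continuous (fun t => Cmod (f t)) s.
Proof.
  intros Hf s; destruct (Hf s). unfold Cmod.
  apply (continuous_comp (fun t => fst (f t) ^ 2 + snd (f t) ^ 2) sqrt); [|apply continuous_sqrt].
  apply (continuous_ext (fun t => Re (f t) * Re (f t) + Im (f t) * Im (f t)));
    [intros; unfold Re, Im; simpl; ring|].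
  apply continuous_Rplus; now apply continuous_Rmult.
Qed.

Lemma ex_RInt_cont (f : R -> R) a b :
  (forall s, continuous f s) -> ex_RInt f a b.
Proof. intros H; apply (ex_RInt_continuous (V := R_CompleteNormedModule)); auto. Qed.

Lemma RInt_Chasles_cont (f : R -> R) a b c :
  (forall s, continuous f s) -> RInt f a b + RInt f b c = RInt f a c.
Proof. intros Hf; apply (RInt_Chasles (V := R_CompleteNormedModule)); now apply ex_RInt_cont. Qed.

Lemma CInt_Chasles (f : R -> C) a b c :
  Ccontinuous f -> (CInt f a b + CInt f b c)%C = CInt f a c.
Proof.
  intros Hf; apply C_ext; apply (RInt_Chasles_cont (fun t => _)); intros s;
    [exact (proj1 (Hf s))|exact (proj2 (Hf s))].
Qed.

Lemma RInt_derive_cont (f : R -> R) a s :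
  (forall t, continuous f t) -> is_derive (RInt f a) s (f s).
Proof.
  intros H. apply (is_derive_RInt (V := R_NormedModule) f (RInt f a) a s); [|apply H].
  apply filter_forall; intros b.
  apply (RInt_correct (V := R_CompleteNormedModule)), ex_RInt_cont, H.
Qed.

Lemma Cderive_CInt (f : R -> C) a s :
  Ccontinuous f -> Cderive (CInt f a) s (f s).
Proof.
  intros Hf; split; apply (RInt_derive_cont (fun t => _)); intros t;
    [exact (proj1 (Hf t))|exact (proj2 (Hf t))].
Qed.

(** After pairing with a fixed [w] of modulus at most 1, [Re (w * f)] is a real integrand below [g],
    and monotonicity of the real integral applies. *)
Lemma Cmod_CInt_le (f : R -> C) (g : R -> R) a b :
  a <= b -> Ccontinuous f -> (forall s, continuous g s) ->
  (forall t, a < t < b -> Cmod (f t) <= g t) -> Cmod (CInt f a b) <= RInt g a b.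
Proof.
  intros Hab Hf Hg H.
  assert (E1 : ex_RInt (fun t => Re (f t)) a b) by (apply ex_RInt_cont; intros s; exact (proj1 (Hf s))).
  assert (E2 : ex_RInt (fun t => Im (f t)) a b) by (apply ex_RInt_cont; intros s; exact (proj2 (Hf s))).
  apply Cmod_le_of_Re.
  - apply RInt_ge_0; [assumption|now apply ex_RInt_cont|].
    intros t Ht; eapply Rle_trans; [apply Cmod_ge_0|now apply H].
  - intros w Hw.
    replace (Re (w * CInt f a b)%C) with (RInt (fun t => Re (w * f t)%C) a b).
    + apply RInt_le; [assumption| |now apply ex_RInt_cont|].
      * apply ex_RInt_cont; intros s.
        apply (fun H => proj1 (Ccontinuous_mult (fun _ => w) f H Hf s)), Ccontinuous_const.
      * intros t Ht. eapply Rle_trans; [apply Rle_abs|].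
        eapply Rle_trans; [apply re_le_Cmod|]. rewrite Cmod_mult.
        specialize (H t Ht). pose proof (Cmod_ge_0 (f t)). pose proof (Cmod_ge_0 w). nra.
    + transitivity (minus (scal (Re w) (RInt (fun t => Re (f t)) a b)) (scal (Im w) (RInt (fun t => Im (f t)) a b))).
      2: reflexivity.
      rewrite <- !(RInt_scal (V := R_CompleteNormedModule)) by assumption.
      rewrite <- (RInt_minus (V := R_CompleteNormedModule)).
      * apply RInt_ext; intros; reflexivity.
      * now apply (ex_RInt_scal (V := R_NormedModule)).
      * now apply (ex_RInt_scal (V := R_NormedModule)).
Qed.

(** * Weighted L^1 estimates for first-order equations *)

(** Weighted L^1 norm on the half-line, expressed through all finite intervals to avoid improper
    integrals. It is meant for nonnegative [h]. *)
Definition L1_le (k : R) (h : R -> R) (m : R) : Prop :=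
  forall S, 0 <= S -> RInt (fun s => exp (k * s) * h s) 0 S <= m.

Notation cont h := (forall s : R, continuous (h : R -> R) s).

Lemma cont_exp_mult (k : R) (h : R -> R) : cont h -> cont (fun s => exp (k * s) * h s).
Proof.
  intros H s. apply (continuous_Rmult (fun s => exp (k * s))); [|apply H].
  apply (continuous_comp (fun s => k * s) exp); [|apply continuous_exp].
  apply (continuous_Rscal k (fun x => x)), continuous_id.
Qed.

Lemma L1_le_nonneg k h m : L1_le k h m -> 0 <= m.
Proof. intros H; specialize (H 0 (Rle_refl 0)). now rewrite RInt_point in H. Qed.

Lemma L1_le_mono k h h' m :
  cont h -> cont h' -> (forall s, 0 <= s -> h s <= h' s) -> L1_le k h' m -> L1_le k h m.
Proof.
  intros C1 C2 H H' S HS. eapply Rle_trans; [|apply (H' S HS)].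
  apply RInt_le; try assumption; try now apply ex_RInt_cont, cont_exp_mult.
  intros x Hx; apply Rmult_le_compat_l; [left; apply exp_pos|apply H; lra].
Qed.

Lemma L1_le_weaken k h m m' : m <= m' -> L1_le k h m -> L1_le k h m'.
Proof. intros H H' S HS; specialize (H' S HS); lra. Qed.

Lemma L1_le_plus k h h' m m' :
  cont h -> cont h' -> L1_le k h m -> L1_le k h' m' -> L1_le k (fun s => h s + h' s) (m + m').
Proof.
  intros C1 C2 H H' S HS. specialize (H S HS); specialize (H' S HS).
  replace (RInt _ 0 S) with (RInt (fun s => exp (k * s) * h s) 0 S + RInt (fun s => exp (k * s) * h' s) 0 S); [lra|].
  rewrite <- (RInt_plus (V := R_CompleteNormedModule)) by now apply ex_RInt_cont, cont_exp_mult.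
  apply RInt_ext; intros; unfold plus; simpl; ring.
Qed.

Lemma L1_le_scal k h m c :
  0 <= c -> cont h -> L1_le k h m -> L1_le k (fun s => c * h s) (c * m).
Proof.
  intros Hc C1 H S HS. specialize (H S HS).
  replace (RInt _ 0 S) with (c * RInt (fun s => exp (k * s) * h s) 0 S); [nra|].
  rewrite <- (RInt_scal (V := R_CompleteNormedModule) _ _ _ c) by now apply ex_RInt_cont, cont_exp_mult.
  apply RInt_ext; intros; unfold scal; simpl; unfold mult; simpl; ring.
Qed.

Lemma L1_le_rate k k' h m :
  k' <= k -> cont h -> (forall s, 0 <= h s) -> L1_le k h m -> L1_le k' h m.
Proof.
  intros Hk C1 Hh H S HS. eapply Rle_trans; [|apply (H S HS)].
  apply RInt_le; try assumption; try now apply ex_RInt_cont, cont_exp_mult.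
  intros x Hx; apply Rmult_le_compat_r; [apply Hh|].
  assert (E : k' * x <= k * x) by nra. destruct E as [E|E]; [left; now apply exp_increasing|rewrite E; lra].
Qed.

Lemma L1_le_shift k j h m :
  L1_le k h m -> L1_le (k - j) (fun s => exp (j * s) * h s) m.
Proof.
  intros H S HS. rewrite (RInt_ext _ (fun s => exp (k * s) * h s)); [now apply H|].
  intros x _. rewrite <- Rmult_assoc, <- exp_plus. do 2 f_equal; ring.
Qed.

Lemma RInt_exp (k S : R) :
  k * RInt (fun s => exp (k * s)) 0 S = exp (k * S) - 1.
Proof.
  assert (H : is_RInt (fun s => k * exp (k * s)) 0 S (exp (k * S) - exp (k * 0))).
  { apply (is_RInt_derive (V := R_CompleteNormedModule) (fun s => exp (k * s))).
    - intros; auto_derive; trivial; ring.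
    - intros. apply continuous_ex_derive. auto_derive; trivial. }
  rewrite Rmult_0_r, exp_0 in H. rewrite <- (is_RInt_unique _ _ _ _ H).
  symmetry. apply (RInt_scal (V := R_CompleteNormedModule) (fun s => exp (k * s)) 0 S k).
  apply ex_RInt_cont. intros s. apply continuous_ex_derive; auto_derive; trivial.
Qed.

Lemma L1_le_exp k a c :
  0 <= c -> k < a -> L1_le k (fun s => c * exp (- a * s)) (c / (a - k)).
Proof.
  intros Hc Hk S HS.
  rewrite (RInt_ext _ (fun s => scal c (exp ((k - a) * s)))).
  2: { intros x _. unfold scal; simpl; unfold mult; simpl.
       replace ((k - a) * x) with (k * x + - a * x) by ring. rewrite exp_plus; ring. }
  rewrite (RInt_scal (V := R_CompleteNormedModule)).
  2: { apply ex_RInt_cont; intros s; apply continuous_ex_derive; auto_derive; trivial. }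
  pose proof (RInt_exp (k - a) S) as E.
  set (I := RInt _ 0 S) in *. unfold scal; simpl; unfold mult; simpl.
  pose proof (exp_pos ((k - a) * S)).
  assert (I <= / (a - k)).
  { apply (Rmult_le_reg_l (a - k)); [lra|]. rewrite Rinv_r by lra. lra. }
  unfold Rdiv; apply Rmult_le_compat_l; assumption.
Qed.

(* A differential inequality in integrated form: for [H' = e H + g] the weighted
   integral of [H] is controlled without exchanging integrals. *)
Lemma RInt_weighted_ode (k e S : R) (H g : R -> R) :
  cont g -> (forall s, is_derive H s (e * H s + g s)) ->
  (e + k) * RInt (fun s => exp (k * s) * H s) 0 S =
  exp (k * S) * H S - H 0 - RInt (fun s => exp (k * s) * g s) 0 S.
Proof.
  intros Cg Hd.
  assert (CH : cont H).
  { intros s; apply continuous_ex_derive; eexists; apply Hd. }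
  assert (X1 : ex_RInt (fun s => exp (k * s) * H s) 0 S) by now apply ex_RInt_cont, cont_exp_mult.
  assert (X2 : ex_RInt (fun s => exp (k * s) * g s) 0 S) by now apply ex_RInt_cont, cont_exp_mult.
  assert (D : is_RInt (fun s => plus (scal (e + k) (exp (k * s) * H s)) (exp (k * s) * g s)) 0 S
     (minus (exp (k * S) * H S) (exp (k * 0) * H 0))).
  { apply (is_RInt_derive (V := R_CompleteNormedModule) (fun s => exp (k * s) * H s)).
    - intros x _. replace (plus _ _) with (k * exp (k * x) * H x + exp (k * x) * (e * H x + g x))
        by (unfold plus, scal; simpl; unfold mult; simpl; ring).
      apply (is_derive_Rmult (fun s => exp (k * s))); [auto_derive; trivial; ring|apply Hd].
    - intros x _. apply continuous_Rplus; [|now apply cont_exp_mult].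
      apply continuous_Rscal; now apply cont_exp_mult. }
  apply (is_RInt_unique (V := R_CompleteNormedModule)) in D.
  rewrite (RInt_plus (V := R_CompleteNormedModule)) in D; [| |exact X2].
  2: now apply (ex_RInt_scal (V := R_NormedModule)).
  rewrite (RInt_scal (V := R_CompleteNormedModule)) in D by exact X1.
  unfold minus, plus, opp, scal in D; simpl in D; unfold mult in D; simpl in D.
  rewrite Rmult_0_r, exp_0 in D. lra.
Qed.

(** Duhamel integral from [0]: the solution of [y' = - mu y + F] that vanishes at [s = 0]. *)
Definition Dop (mu : C) (F : R -> C) (s : R) : C :=
  (cexp (- mu) s * CInt (fun t => cexp mu t * F t) 0 s)%C.

Lemma Cderive_Dop mu F s :
  Ccontinuous F -> Cderive (Dop mu F) s (- mu * Dop mu F s + F s)%C.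
Proof.
  intros HF. eapply Cderive_eq.
  - apply Cderive_mult; [apply Cderive_cexp|].
    apply Cderive_CInt, Ccontinuous_mult; [apply Ccontinuous_cexp|exact HF].
  - unfold Dop. rewrite <- (Cmult_1_l (F s)) at 2. rewrite <- (cexp_opp mu s). ring.
Qed.

Lemma Ccontinuous_Dop mu F : Ccontinuous F -> Ccontinuous (Dop mu F).
Proof. intros H; eapply Cderive_continuous; intros s; now apply Cderive_Dop. Qed.

Lemma Dop_0 mu F : Dop mu F 0 = 0%C.
Proof.
  unfold Dop, CInt. rewrite !RInt_point. apply C_ext; simpl; unfold zero; simpl; ring.
Qed.

(** Scalar majorant of [Dop]. Unlike the modulus of [Dop mu F], it is differentiable and solves an
    equation exactly, so the weighted identity applies to it. *)
Definition Dreal (a : R) (h : R -> R) (s : R) : R :=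
  exp (- a * s) * RInt (fun t => exp (a * t) * h t) 0 s.

Lemma is_derive_Dreal a h s :
  cont h -> is_derive (Dreal a h) s (- a * Dreal a h s + h s).
Proof.
  intros Hh. unfold Dreal.
  replace (_ + _) with (- a * exp (- a * s) * RInt (fun t => exp (a * t) * h t) 0 s +
     exp (- a * s) * (exp (a * s) * h s)).
  - apply (is_derive_Rmult (fun s => exp (- a * s))).
    + auto_derive; trivial; ring.
    + apply (RInt_derive_cont (fun t => exp (a * t) * h t)), cont_exp_mult, Hh.
  - rewrite <- !Rmult_assoc, <- exp_plus. replace (- a * s + a * s) with 0 by ring. rewrite exp_0; ring.
Qed.

Lemma Dop_le_Dreal mu F s :
  Ccontinuous F -> 0 <= s -> Cmod (Dop mu F s) <= Dreal (Re mu) (fun t => Cmod (F t)) s.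
Proof.
  intros HF Hs. unfold Dop, Dreal. rewrite Cmod_mult, Cmod_cexp.
  replace (Re (- mu)) with (- Re mu) by reflexivity.
  apply Rmult_le_compat_l; [left; apply exp_pos|].
  apply Cmod_CInt_le; [assumption| | |].
  - apply Ccontinuous_mult; [apply Ccontinuous_cexp|exact HF].
  - now apply cont_exp_mult, continuous_Cmod.
  - intros. rewrite Cmod_mult, Cmod_cexp; lra.
Qed.

Lemma L1_le_Dop k mu F m :
  Ccontinuous F -> k < Re mu -> L1_le k (fun s => Cmod (F s)) m ->
  L1_le k (fun s => Cmod (Dop mu F s)) (m / (Re mu - k)).
Proof.
  intros HF Hk H.
  assert (CF : cont (fun s => Cmod (F s))) by now apply continuous_Cmod.
  apply L1_le_mono with (h' := Dreal (Re mu) (fun t => Cmod (F t))).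
  - now apply continuous_Cmod, Ccontinuous_Dop.
  - intros s; apply continuous_ex_derive; eexists; now apply is_derive_Dreal.
  - intros; now apply Dop_le_Dreal.
  - intros S HS.
    pose proof (RInt_weighted_ode k (- Re mu) S _ _ CF (fun s => is_derive_Dreal (Re mu) _ s CF)) as E.
    specialize (H S HS).
    assert (0 <= exp (k * S) * Dreal (Re mu) (fun t => Cmod (F t)) S).
    { apply Rmult_le_pos; [left; apply exp_pos|]. eapply Rle_trans; [apply Cmod_ge_0|now apply Dop_le_Dreal]. }
    assert (Dreal (Re mu) (fun t => Cmod (F t)) 0 = 0).
    { unfold Dreal; rewrite RInt_point. unfold zero; simpl; ring. }
    apply (Rmult_le_reg_l (Re mu - k)); [lra|].
    replace ((Re mu - k) * (m / (Re mu - k))) with m by (field; lra). lra.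
Qed.

(** For [t <= s] the kernel [exp (- Re mu * (s - t))] is at most [exp (- b * (s - t))]: the decay
    obtained is the slower of the two rates. *)
Lemma Cmod_Dop_le b mu F m s :
  Ccontinuous F -> b <= Re mu -> 0 <= s -> L1_le b (fun s => Cmod (F s)) m ->
  Cmod (Dop mu F s) <= exp (- b * s) * m.
Proof.
  intros HF Hb Hs H. eapply Rle_trans; [now apply Dop_le_Dreal|].
  assert (CF : cont (fun s => Cmod (F s))) by now apply continuous_Cmod.
  unfold Dreal. specialize (H s Hs).
  replace (- Re mu * s) with (- b * s + - (Re mu - b) * s) by ring. rewrite exp_plus, Rmult_assoc.
  apply Rmult_le_compat_l; [left; apply exp_pos|].
  eapply Rle_trans; [|exact H].
  change (scal (exp (- (Re mu - b) * s)) (RInt (fun t => exp (Re mu * t) * Cmod (F t)) 0 s) <= RInt (fun t => exp (b * t) * Cmod (F t)) 0 s).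
  rewrite <- (RInt_scal (V := R_CompleteNormedModule)) by now apply ex_RInt_cont, cont_exp_mult.
  apply RInt_le; [assumption| |now apply ex_RInt_cont, cont_exp_mult|].
  - apply (ex_RInt_scal (V := R_NormedModule)); now apply ex_RInt_cont, cont_exp_mult.
  - intros t Ht. unfold scal; simpl; unfold mult; simpl. rewrite <- Rmult_assoc, <- exp_plus.
    apply Rmult_le_compat_r; [apply Cmod_ge_0|].
    assert (E : - (Re mu - b) * s + Re mu * t <= b * t) by nra.
    destruct E as [E|E]; [left; now apply exp_increasing|rewrite E; lra].
Qed.

(** The limit is taken along the integers only; the partial integrals below have increments
    controlled by a bounded monotone function, which makes this the limit at infinity. *)
Definition Rlim (G : R -> R) : R := real (Lim_seq (fun n => G (INR n))).
Definition Clim (G : R -> C) : C := (Rlim (fun s => Re (G s)), Rlim (fun s => Im (G s))).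

Lemma INR_eventually_ge (s : R) : eventually (fun n => s <= INR n).
Proof.
  destruct (nfloor_ex (Rmax 0 s)) as [n Hn]; [apply Rmax_l|].
  exists (S n); intros m Hm. apply le_INR in Hm. rewrite S_INR in Hm.
  pose proof (Rmax_r 0 s). lra.
Qed.

Lemma Rlim_correct (Phi : R -> R) (M : R) :
  (forall a b, 0 <= a <= b -> Phi a <= Phi b) -> (forall s, 0 <= s -> Phi s <= M) ->
  is_lim_seq (fun n => Phi (INR n)) (Rlim Phi).
Proof.
  intros H HM. apply Lim_seq_correct'.
  apply ex_finite_lim_seq_incr with M.
  - intros n; apply H; split; [apply pos_INR|rewrite S_INR; lra].
  - intros n; apply HM, pos_INR.
Qed.

Lemma Rlim_ge (Phi : R -> R) (M s : R) :
  (forall a b, 0 <= a <= b -> Phi a <= Phi b) -> (forall s, 0 <= s -> Phi s <= M) ->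
  0 <= s -> Phi s <= Rlim Phi.
Proof.
  intros H HM Hs.
  apply (is_lim_seq_le_loc (fun _ => Phi s) (fun n => Phi (INR n)) (Phi s) (Rlim Phi)).
  - apply (filter_imp _ _ (fun n => H s (INR n)) ). 
    apply (filter_imp _ _ (fun n Hn => conj Hs Hn)), INR_eventually_ge.
  - apply is_lim_seq_const.
  - now apply Rlim_correct with M.
Qed.

Lemma Rlim_le (Phi : R -> R) (M s c : R) :
  (forall a b, 0 <= a <= b -> Phi a <= Phi b) -> (forall s, 0 <= s -> Phi s <= M) ->
  (forall t, s <= t -> Phi t <= c) -> Rlim Phi <= c.
Proof.
  intros H HM Hc.
  apply (is_lim_seq_le_loc (fun n => Phi (INR n)) (fun _ => c) (Rlim Phi) c).
  - apply (filter_imp _ _ (fun n => Hc (INR n))), INR_eventually_ge.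
  - now apply Rlim_correct with M.
  - apply is_lim_seq_const.
Qed.

(** [Phi] is monotone and bounded, hence Cauchy along the integers, and transmits this to both parts
    of [G]; the increment bound passes to the limit after pairing with [w]. *)
Lemma Clim_le (G : R -> C) (Phi : R -> R) (M s : R) :
  (forall a b, 0 <= a <= b -> Cmod (G b - G a) <= Phi b - Phi a) ->
  (forall s, 0 <= s -> Phi s <= M) -> 0 <= s ->
  Cmod (Clim G - G s) <= Rlim Phi - Phi s.
Proof.
  intros H HM Hs.
  assert (Hinc : forall a b, 0 <= a <= b -> Phi a <= Phi b).
  { intros a b Hab; specialize (H a b Hab). pose proof (Cmod_ge_0 (G b - G a)). lra. }
  pose proof (Rlim_correct Phi M Hinc HM) as HL.
  assert (Cau : forall p : C -> R, (forall z, Rabs (p z) <= Cmod z) ->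
     (forall z w, p (z - w)%C = p z - p w) ->
     is_lim_seq (fun n => p (G (INR n))) (Rlim (fun s => p (G s)))).
  { intros p Hp Hpm. apply Lim_seq_correct', ex_lim_seq_cauchy_corr. intros eps.
    destruct (proj1 (ex_lim_seq_cauchy_corr (fun n => Phi (INR n))) (ex_intro (fun l : R => is_lim_seq _ l) _ HL) eps) as [N HN].
    exists N.
    assert (W : forall n m, (N <= n)%nat -> (n <= m)%nat -> Rabs (p (G (INR m)) - p (G (INR n))) < eps).
    { intros n m Hn Hm. rewrite <- Hpm. eapply Rle_lt_trans; [apply Hp|].
      eapply Rle_lt_trans; [apply H; split; [apply pos_INR|now apply le_INR]|].
      eapply Rle_lt_trans; [apply Rle_abs|]. apply HN; lia. }
    intros n m Hn Hm. destruct (Nat.le_ge_cases n m) as [E|E].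
    - rewrite Rabs_minus_sym. now apply W.
    - now apply W. }
  pose proof (Cau Re re_le_Cmod (fun z w => eq_refl)) as LR.
  pose proof (Cau Im Im_le_Cmod (fun z w => eq_refl)) as LI.
  apply Cmod_le_of_Re.
  { pose proof (Rlim_ge Phi M s Hinc HM Hs). lra. }
  intros w Hw.
  apply (is_lim_seq_le_loc (fun n => Re (w * (G (INR n) - G s))%C) (fun n => Phi (INR n) - Phi s)
    (Re (w * (Clim G - G s))%C) (Rlim Phi - Phi s)).
  - apply (filter_imp _ _) with (2 := INR_eventually_ge s). intros n Hn.
    eapply Rle_trans; [apply Rle_abs|]. eapply Rle_trans; [apply re_le_Cmod|].
    rewrite Cmod_mult. specialize (H s (INR n) (conj Hs Hn)).
    pose proof (Cmod_ge_0 (G (INR n) - G s)). pose proof (Cmod_ge_0 w). nra.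
  - replace (Re (w * (Clim G - G s))%C) with
      (Re w * (Rlim (fun s => Re (G s)) - Re (G s)) - Im w * (Rlim (fun s => Im (G s)) - Im (G s)))
      by (unfold Clim, Re, Im; simpl; ring).
    pose proof (is_lim_seq_minus' _ _ _ _ LR (is_lim_seq_const (Re (G s)))) as DR.
    pose proof (is_lim_seq_minus' _ _ _ _ LI (is_lim_seq_const (Im (G s)))) as DI.
    eapply is_lim_seq_ext;
      [|exact (is_lim_seq_minus' _ _ _ _ (is_lim_seq_scal_l _ (Re w) _ DR) (is_lim_seq_scal_l _ (Im w) _ DI))].
    intros n; unfold Re, Im; simpl; ring.
  - apply is_lim_seq_minus'; [exact HL|apply is_lim_seq_const].
Qed.

(* [Iop mu F s] is the integral of [exp (- mu * (t - s)) * F t] over [t >= s]. *)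
Definition Iop (mu : C) (F : R -> C) (s : R) : C :=
  (cexp mu s * (Clim (CInt (fun t => cexp (- mu) t * F t) 0) - CInt (fun t => cexp (- mu) t * F t) 0 s))%C.

Lemma Cderive_Iop mu F s :
  Ccontinuous F -> Cderive (Iop mu F) s (mu * Iop mu F s - F s)%C.
Proof.
  intros HF. eapply Cderive_eq.
  - apply Cderive_mult; [apply Cderive_cexp|].
    apply Cderive_minus; [apply Cderive_const|].
    apply Cderive_CInt, Ccontinuous_mult; [apply Ccontinuous_cexp|exact HF].
  - unfold Iop. rewrite <- (Cmult_1_l (F s)) at 2. rewrite <- (cexp_opp mu s).
    apply C_ext; unfold Re, Im; simpl; ring.
Qed.

Lemma Ccontinuous_Iop mu F : Ccontinuous F -> Ccontinuous (Iop mu F).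
Proof. intros H; eapply Cderive_continuous; intros s; now apply Cderive_Iop. Qed.

Definition Ireal (a : R) (h : R -> R) (s : R) : R :=
  exp (a * s) * (Rlim (RInt (fun t => exp (- a * t) * h t) 0) - RInt (fun t => exp (- a * t) * h t) 0 s).

Lemma is_derive_Ireal a h s :
  cont h -> is_derive (Ireal a h) s (a * Ireal a h s + - h s).
Proof.
  intros Hh. unfold Ireal. set (L := Rlim _).
  replace (_ + - h s) with (a * exp (a * s) * (L - RInt (fun t => exp (- a * t) * h t) 0 s) +
     exp (a * s) * (0 - exp (- a * s) * h s)).
  - apply (is_derive_Rmult (fun s => exp (a * s)) (fun s => L - RInt (fun t => exp (- a * t) * h t) 0 s)).
    + auto_derive; trivial; ring.
    + apply (is_derive_Rminus (fun _ => L) (RInt (fun t => exp (- a * t) * h t) 0)); [apply is_derive_Rconst|].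
      apply (RInt_derive_cont (fun t => exp (- a * t) * h t)), cont_exp_mult, Hh.
  - rewrite Rminus_0_l, <- Ropp_mult_distr_r, <- !Rmult_assoc, <- exp_plus.
    replace (a * s + - a * s) with 0 by ring. rewrite exp_0; ring.
Qed.

Lemma RInt_exp_rate_le (a k u v : R) (h : R -> R) :
  0 <= a + k -> u <= v -> cont h -> (forall s, 0 <= h s) ->
  RInt (fun t => exp (- a * t) * h t) u v <= exp (- (a + k) * u) * RInt (fun t => exp (k * t) * h t) u v.
Proof.
  intros Hak Huv Ch Hh.
  change (RInt (fun t => exp (- a * t) * h t) u v <= scal (exp (- (a + k) * u)) (RInt (fun t => exp (k * t) * h t) u v)).
  rewrite <- (RInt_scal (V := R_CompleteNormedModule)) by now apply ex_RInt_cont, cont_exp_mult.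
  apply RInt_le; [assumption|now apply ex_RInt_cont, cont_exp_mult| |].
  - apply (ex_RInt_scal (V := R_NormedModule)); now apply ex_RInt_cont, cont_exp_mult.
  - intros t Ht. unfold scal; simpl; unfold mult; simpl. rewrite <- Rmult_assoc, <- exp_plus.
    apply Rmult_le_compat_r; [apply Hh|].
    assert (E : - a * t <= - (a + k) * u + k * t) by nra.
    destruct E as [E|E]; [left; now apply exp_increasing|rewrite E; lra].
Qed.

Lemma RInt_weighted_mono (a u v : R) (h : R -> R) :
  cont h -> (forall s, 0 <= h s) -> 0 <= u <= v ->
  RInt (fun t => exp (a * t) * h t) 0 u <= RInt (fun t => exp (a * t) * h t) 0 v.
Proof.
  intros Ch Hh Huv.
  rewrite <- (RInt_Chasles_cont _ 0 u v) by now apply cont_exp_mult.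
  assert (0 <= RInt (fun t => exp (a * t) * h t) u v).
  { apply RInt_ge_0; [lra|now apply ex_RInt_cont, cont_exp_mult|].
    intros; apply Rmult_le_pos; [left; apply exp_pos|apply Hh]. }
  lra.
Qed.

Lemma RInt_weighted_le a k h m s :
  0 <= a + k -> cont h -> (forall s, 0 <= h s) -> L1_le k h m -> 0 <= s ->
  RInt (fun t => exp (- a * t) * h t) 0 s <= m.
Proof.
  intros Hak Ch Hh H Hs. eapply Rle_trans; [apply (RInt_exp_rate_le a k); assumption|].
  rewrite Rmult_0_r, exp_0, Rmult_1_l. now apply H.
Qed.

(** On [t >= s] the kernel [exp (- a * (t - s))] is at most [exp (k * (t - s))]. The mass of
    [[0, s]] is kept subtracted on the right because the weighted L^1 estimate of [Iop] uses this
    sharper form. *)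
Lemma Ireal_le a k h m s :
  0 <= a + k -> cont h -> (forall s, 0 <= h s) -> L1_le k h m -> 0 <= s ->
  exp (k * s) * Ireal a h s <= m - RInt (fun t => exp (k * t) * h t) 0 s.
Proof.
  intros Hak Ch Hh H Hs. unfold Ireal. rewrite <- Rmult_assoc, <- exp_plus.
  set (Phi := RInt (fun t => exp (- a * t) * h t) 0).
  set (Psi := RInt (fun t => exp (k * t) * h t) 0).
  assert (Hm : forall u v, 0 <= u <= v -> Phi u <= Phi v) by (intros; now apply RInt_weighted_mono).
  assert (HM : forall u, 0 <= u -> Phi u <= m) by (intros; now apply RInt_weighted_le with k).
  assert (K : Rlim Phi <= Phi s + exp (- (a + k) * s) * (m - Psi s)).
  { apply (Rlim_le Phi m s); [assumption..|]. intros t Ht.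
    pose proof (RInt_exp_rate_le a k s t h Hak Ht Ch Hh) as E.
    pose proof (RInt_Chasles_cont _ 0 s t (cont_exp_mult (- a) _ Ch)) as E1.
    pose proof (RInt_Chasles_cont _ 0 s t (cont_exp_mult k _ Ch)) as E2.
    pose proof (H t ltac:(lra)) as E3.
    fold Phi in E1; fold Psi in E2, E3.
    rewrite <- E1. pose proof (exp_pos (- (a + k) * s)). nra. }
  assert (E : exp (k * s + a * s) * exp (- (a + k) * s) = 1).
  { rewrite <- exp_plus. replace (_ + _) with 0 by ring. apply exp_0. }
  pose proof (exp_pos (k * s + a * s)).
  replace (m - Psi s) with (exp (k * s + a * s) * (exp (- (a + k) * s) * (m - Psi s))).
  - apply Rmult_le_compat_l; lra.
  - rewrite <- Rmult_assoc, E; ring.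
Qed.

Lemma Iop_le_Ireal mu k F m s :
  0 <= Re mu + k -> Ccontinuous F -> L1_le k (fun t => Cmod (F t)) m -> 0 <= s ->
  Cmod (Iop mu F s) <= Ireal (Re mu) (fun t => Cmod (F t)) s.
Proof.
  intros Hk HF H Hs. unfold Iop, Ireal. rewrite Cmod_mult, Cmod_cexp.
  assert (CF : cont (fun s => Cmod (F s))) by now apply continuous_Cmod.
  assert (CG : Ccontinuous (fun t => cexp (- mu) t * F t)%C)
    by (apply Ccontinuous_mult; [apply Ccontinuous_cexp|exact HF]).
  apply Rmult_le_compat_l; [left; apply exp_pos|].
  apply Clim_le with m; [| |assumption].
  - intros u v Huv.
    rewrite <- (CInt_Chasles _ 0 u v CG).
    rewrite <- (RInt_Chasles_cont _ 0 u v) by now apply cont_exp_mult.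
    match goal with |- Cmod ?z <= _ =>
      replace z with (CInt (fun t => cexp (- mu) t * F t)%C u v) by ring end.
    apply Rle_trans with (RInt (fun t => exp (- Re mu * t) * Cmod (F t)) u v);
      [|lra].
    apply Cmod_CInt_le; [lra|assumption|now apply cont_exp_mult|].
    intros t _. rewrite Cmod_mult, Cmod_cexp. apply Rle_refl.
  - intros u Hu. now apply RInt_weighted_le with k; [..|intros; apply Cmod_ge_0| |].
Qed.

Lemma Cmod_Iop_le mu k F m s :
  0 <= Re mu + k -> Ccontinuous F -> L1_le k (fun t => Cmod (F t)) m -> 0 <= s ->
  Cmod (Iop mu F s) <= exp (- k * s) * m.
Proof.
  intros Hk HF H Hs. eapply Rle_trans; [now apply Iop_le_Ireal with k m|].
  assert (CF : cont (fun s => Cmod (F s))) by now apply continuous_Cmod.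
  pose proof (Ireal_le _ _ _ _ _ Hk CF (fun s => Cmod_ge_0 _) H Hs) as E.
  pose proof (RInt_weighted_mono k 0 s _ CF (fun s => Cmod_ge_0 _) (conj (Rle_refl 0) Hs)) as E1.
  rewrite RInt_point in E1. unfold zero in E1; simpl in E1.
  apply (Rmult_le_reg_l (exp (k * s))); [apply exp_pos|].
  rewrite <- Rmult_assoc, <- exp_plus. replace (k * s + - k * s) with 0 by ring.
  rewrite exp_0, Rmult_1_l. lra.
Qed.

Lemma L1_le_Iop k mu F m :
  0 < Re mu + k -> Ccontinuous F -> L1_le k (fun s => Cmod (F s)) m ->
  L1_le k (fun s => Cmod (Iop mu F s)) (m / (Re mu + k)).
Proof.
  intros Hk HF H.
  assert (CF : cont (fun s => Cmod (F s))) by now apply continuous_Cmod.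
  apply L1_le_mono with (h' := Ireal (Re mu) (fun t => Cmod (F t))).
  - now apply continuous_Cmod, Ccontinuous_Iop.
  - intros s; apply continuous_ex_derive; eexists; now apply is_derive_Ireal.
  - intros; apply Iop_le_Ireal with k m; try assumption; lra.
  - intros S HS.
    assert (CF' : cont (fun s => - Cmod (F s))) by (intros s; now apply continuous_Ropp).
    (* Now the endpoint term at [S] has the bad sign; [Ireal_le] bounds it by exactly what the
       integral over [[0, S]] leaves of [m]. *)
    pose proof (RInt_weighted_ode k (Re mu) S _ _ CF' (fun s => is_derive_Ireal (Re mu) _ s CF)) as E.
    pose proof (Ireal_le _ _ _ _ _ (Rlt_le _ _ Hk) CF (fun s => Cmod_ge_0 _) H HS) as E1.
    assert (0 <= Ireal (Re mu) (fun t => Cmod (F t)) 0).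
    { eapply Rle_trans; [apply Cmod_ge_0|apply (Iop_le_Ireal mu k F m); try assumption; lra]. }
    assert (E2 : RInt (fun s => exp (k * s) * - Cmod (F s)) 0 S = - RInt (fun s => exp (k * s) * Cmod (F s)) 0 S).
    { rewrite (RInt_ext _ (fun s => opp (exp (k * s) * Cmod (F s)))).
      - apply (RInt_opp (V := R_CompleteNormedModule)). now apply ex_RInt_cont, cont_exp_mult.
      - intros; unfold opp; simpl; ring. }
    cbv beta in E; rewrite E2 in E.
    apply (Rmult_le_reg_l (Re mu + k)); [lra|].
    replace ((Re mu + k) * (m / (Re mu + k))) with m by (field; lra). lra.
Qed.

(** * A single Fourier mode *)

(* [k = sqrt lambda / 4] is the exponential rate, in [s = ln r], at which the vorticity decays. *)
Definition lam (k : R) : R := 16 * k ^ 2.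

(** Real part of the principal root of [z = n^2 + i lam n], from
    [(Re (sqrt z))^2 = (|z| + Re z) / 2]. *)
Definition mure (k n : R) : R := sqrt ((sqrt (n ^ 4 + lam k ^ 2 * n ^ 2) + n ^ 2) / 2).
(* The square root of [n^2 + i lam n] with positive real part. *)
Definition mu (k n : R) : C := (mure k n, lam k * n / (2 * mure k n)).
Definition jap (n : R) : R := 1 + Rabs n.

Lemma jap_ge_1 n : 1 <= jap n.
Proof. unfold jap; pose proof (Rabs_pos n); lra. Qed.

Lemma mure_facts k n : 4 <= k -> 1 <= Rabs n ->
  (Rabs n <= mure k n /\ 2 * k <= mure k n) /\
  lam k * Rabs n / 2 <= mure k n ^ 2 /\ mure k n <= 4 * k * jap n /\
  Cmod (mu k n) <= 3 / 2 * mure k n /\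
  (mu k n * mu k n)%C = (n ^ 2, lam k * n).
Proof.
  intros Hk Hn.
  assert (Hl : 256 <= lam k) by (unfold lam; nra).
  set (l := lam k) in *.
  assert (Hn2 : n ^ 2 = Rabs n ^ 2) by (now rewrite pow2_abs).
  assert (Hx : 0 <= n ^ 4 + l ^ 2 * n ^ 2) by nra.
  set (rho := sqrt (n ^ 4 + l ^ 2 * n ^ 2)).
  assert (Hr0 : 0 <= rho) by apply sqrt_pos.
  assert (Hr2 : rho ^ 2 = n ^ 4 + l ^ 2 * n ^ 2) by (now apply pow2_sqrt).
  assert (Hrn : n ^ 2 <= rho).
  { apply Rsqr_incr_0_var; [unfold Rsqr; nra|assumption]. }
  assert (Hrl : l * Rabs n <= rho).
  { apply Rsqr_incr_0_var; [unfold Rsqr|assumption].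
    replace (l * Rabs n * (l * Rabs n)) with (l ^ 2 * n ^ 2) by (rewrite Hn2; ring). nra. }
  assert (Hru : rho <= n ^ 2 + l * Rabs n).
  { apply Rsqr_incr_0_var; [unfold Rsqr|nra].
    replace ((n ^ 2 + l * Rabs n) * (n ^ 2 + l * Rabs n)) with
      ((n ^ 2) ^ 2 + l ^ 2 * n ^ 2 + 2 * n ^ 2 * (l * Rabs n)) by (rewrite Hn2; ring). nra. }
  assert (Ha2 : mure k n ^ 2 = (rho + n ^ 2) / 2).
  { unfold mure. fold l. fold rho. apply pow2_sqrt. nra. }
  assert (Ha0 : 0 <= mure k n) by apply sqrt_pos.
  assert (Han : Rabs n <= mure k n).
  { apply Rsqr_incr_0_var; [unfold Rsqr; nra|assumption]. }
  set (a := mure k n) in *.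
  assert (Hak : 2 * k <= a).
  { apply Rsqr_incr_0_var; [unfold Rsqr|assumption]. unfold l, lam in *. nra. }
  split; [now split|]. split; [lra|].
  assert (Hap : a <> 0) by lra.
  set (b := l * n / (2 * a)).
  assert (Hab : 2 * a * b = l * n) by (unfold b; field; lra).
  assert (Hb2 : b ^ 2 = (rho - n ^ 2) / 2).
  { assert (4 * a ^ 2 * b ^ 2 = l ^ 2 * n ^ 2).
    { replace (4 * a ^ 2 * b ^ 2) with ((2 * a * b) ^ 2) by ring. rewrite Hab; ring. }
    apply (Rmult_eq_reg_l (4 * a ^ 2)); [|nra]. rewrite H, Ha2. nra. }
  split; [|split].
  - apply Rsqr_incr_0_var; [unfold Rsqr|unfold jap; nra].
    replace (4 * k * jap n * (4 * k * jap n)) with (l * jap n ^ 2) by (unfold l, lam; ring).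
    unfold jap. nra.
  - unfold Cmod, mu; simpl fst; simpl snd. fold l a b.
    rewrite <- (sqrt_pow2 (3 / 2 * a)) by lra. apply sqrt_le_1_alt. nra.
  - unfold mu; fold l a b. apply C_ext; simpl; nra.
Qed.

(* Radial profiles, as functions of [s = ln r], of a Fourier mode: vorticity [om], stream
   function [ps], their derivatives [ch] and [ph], the limit [phinf] of [ph] at infinity, and
   the Bernoulli pressure [qq]. *)
Record mode := Mode { om : R -> C; ch : R -> C; ps : R -> C; ph : R -> C; phinf : C; qq : R -> C }.

Definition e2 (g : R -> C) (s : R) : C := (RtoC (exp (2 * s)) * g s)%C.

Lemma Ccontinuous_e2 g : Ccontinuous g -> Ccontinuous (e2 g).
Proof.
  intros H. apply Ccontinuous_mult; [|exact H]. intros s; split; simpl.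
  - apply continuous_ex_derive; auto_derive; trivial.
  - apply continuous_const.
Qed.

Lemma Cmod_e2 g s : Cmod (e2 g s) = exp (2 * s) * Cmod (g s).
Proof. unfold e2; rewrite Cmod_mult, Cmod_R, Rabs_pos_eq; [reflexivity|left; apply exp_pos]. Qed.

(** The source of the Poisson equation costs two units of exponential rate; [k >= 4] leaves at least
    2. *)
Lemma L1_le_e2 k g m :
  L1_le k (fun s => Cmod (g s)) m -> L1_le (k - 2) (fun s => Cmod (e2 g s)) m.
Proof.
  intros H S HS. rewrite (RInt_ext _ (fun s => exp ((k - 2) * s) * (exp (2 * s) * Cmod (g s)))).
  - now apply L1_le_shift.
  - intros; now rewrite Cmod_e2.
Qed.

Lemma exp_le_compat x y : x <= y -> exp x <= exp y.
Proof. intros [H|H]; [left; now apply exp_increasing|rewrite H; lra]. Qed.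

(** Two solutions of [y' = nu y - g] differ by a multiple of [exp (nu s)]; both decay like
    [exp (- k s)] and [Re nu + k > 0], so the multiple is zero. This evaluates [Iop] from a
    candidate solution, without exchanging integrals. *)
Lemma Iop_unique (nu : C) (k K m : R) (Y g : R -> C) :
  0 < Re nu + k -> Ccontinuous g -> L1_le k (fun s => Cmod (g s)) m ->
  (forall s, Cderive Y s (nu * Y s - g s)%C) ->
  (forall s, 0 <= s -> Cmod (Y s) <= exp (- k * s) * K) ->
  Iop nu g 0 = Y 0.
Proof.
  intros Hk Cg Hg HY HK.
  set (D := fun s => (cexp (- nu) s * (Iop nu g s - Y s))%C).
  assert (HD : forall s, Cderive D s 0%C).
  { intros s. eapply Cderive_eq.
    - apply Cderive_mult; [apply Cderive_cexp|]. apply Cderive_minus; [now apply Cderive_Iop|apply HY].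
    - simpl. apply C_ext; unfold Re, Im; simpl; ring. }
  assert (Dc : forall s, 0 <= s -> D s = D 0).
  { intros s [Hs| <-]; [|reflexivity]. symmetry.
    apply C_ext; [apply (eq_is_derive (V := R_NormedModule) (fun t => Re (D t)))|
                  apply (eq_is_derive (V := R_NormedModule) (fun t => Im (D t)))];
    try assumption; intros t _; apply HD. }
  assert (D0 : D 0 = (Iop nu g 0 - Y 0)%C) by (unfold D; rewrite cexp_0; ring).
  assert (Hb : forall s, 0 <= s -> Cmod (D 0) <= exp (- (Re nu + k) * s) * (m + K)).
  { intros s Hs. rewrite <- (Dc s Hs). unfold D. rewrite Cmod_mult, Cmod_cexp.
    replace (Re (- nu)) with (- Re nu) by reflexivity.
    replace (- (Re nu + k) * s) with (- Re nu * s + - k * s) by ring.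
    rewrite exp_plus, Rmult_assoc. apply Rmult_le_compat_l; [left; apply exp_pos|].
    eapply Rle_trans; [apply Cmod_triangle|]. rewrite Cmod_opp, Rmult_plus_distr_l.
    apply Rplus_le_compat; [apply Cmod_Iop_le; try assumption; lra|now apply HK]. }
  assert (E : Cmod (D 0) = 0).
  { apply Rle_antisym; [|apply Cmod_ge_0]. apply Rnot_lt_le; intros Hp.
    set (c := Re nu + k) in *. set (d := Cmod (D 0)) in *.
    assert (0 < m + K).
    { specialize (Hb 0 (Rle_refl 0)). rewrite Rmult_0_r, exp_0 in Hb. lra. }
    (* Large enough for [exp x >= 1 + x] to contradict the bound. *)
    set (s := (m + K) / d / c).
    assert (Hs : 0 < s) by (unfold s; apply Rdiv_lt_0_compat; [now apply Rdiv_lt_0_compat|assumption]).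
    specialize (Hb s (Rlt_le _ _ Hs)).
    assert (Hcs : (1 + c * s) * d > m + K) by (unfold s; replace (c * ((m + K) / d / c)) with ((m + K) / d) by (field; lra); replace ((1 + (m + K) / d) * d) with (d + (m + K)) by (field; lra); lra).
    pose proof (exp_ineq1_le (c * s)) as Ei.
    assert (Ee : exp (- c * s) * exp (c * s) = 1).
    { rewrite <- exp_plus. replace (- c * s + c * s) with 0 by ring. apply exp_0. }
    pose proof (exp_pos (- c * s)). pose proof (exp_pos (c * s)).
    assert (d * exp (c * s) <= m + K).
    { replace (m + K) with (exp (- c * s) * (m + K) * exp (c * s)).
      - apply Rmult_le_compat_r; lra.
      - replace (exp (- c * s) * (m + K) * exp (c * s)) with ((exp (- c * s) * exp (c * s)) * (m + K)) by ring. rewrite Ee; ring. }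
    nra. }
  apply Cmod_eq_0 in E. rewrite D0 in E.
  replace (Iop nu g 0) with ((Iop nu g 0 - Y 0) + Y 0)%C by ring. rewrite E; ring.
Qed.

(** [nz_y] is [om' + mu om]. The vorticity operator factors as [(d/ds - mu) (d/ds + mu)]: the first
    factor is solved from infinity, the second from [0], and a multiple of [exp (- mu s)] remains
    free. *)
Definition nz_y (k n : R) (F : R -> C) (s : R) : C := (- Iop (mu k n) F s)%C.
Definition nz_w (k n : R) (F : R -> C) : R -> C := Dop (mu k n) (nz_y k n F).
Definition nz_coef (k n : R) (F : R -> C) (b : C) : C :=
  ((mu k n + RtoC (Rabs n - 2)) * (b - Iop (RtoC (Rabs n - 2)) (nz_w k n F) 0%R))%C.
Definition nz_om (k n : R) (F : R -> C) (b : C) (s : R) : C :=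
  (nz_w k n F s + nz_coef k n F b * cexp (- mu k n) s)%C.
Definition nz_ch (k n : R) (F : R -> C) (b : C) (s : R) : C :=
  (- mu k n * nz_om k n F b s + nz_y k n F s)%C.
(** The same factorisation for the Poisson equation: this is [ps' + |n| ps], solved from
    infinity. *)
Definition zop (n : R) (w : R -> C) : R -> C := Iop (RtoC (Rabs n)) (e2 w).
Definition nz_ps (k n : R) (F : R -> C) (b : C) : R -> C :=
  Dop (RtoC (Rabs n)) (zop n (nz_om k n F b)).
Definition nz_ph (k n : R) (F : R -> C) (b : C) (s : R) : C :=
  (- RtoC (Rabs n) * nz_ps k n F b s + zop n (nz_om k n F b) s)%C.

(** * Estimates for a mode of nonzero frequency *)

Section NonzeroMode.

Context (k n : R) (F : R -> C) (b : C) (Fh P : R).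
Context (Hk : 4 <= k) (Hn : 1 <= Rabs n) (CF : Ccontinuous F)
  (HF : L1_le k (fun s => Cmod (F s)) Fh)
  (HP : 12 * Fh / mure k n ^ 2 + 5 * Cmod b <= P).

Let a := mure k n.

Lemma nz_y_continuous : Ccontinuous (nz_y k n F).
Proof. now apply Ccontinuous_opp, Ccontinuous_Iop. Qed.

Lemma nz_w_continuous : Ccontinuous (nz_w k n F).
Proof. apply Ccontinuous_Dop, nz_y_continuous. Qed.

Lemma nz_om_continuous : Ccontinuous (nz_om k n F b).
Proof.
  apply Ccontinuous_plus; [apply nz_w_continuous|].
  apply Ccontinuous_mult; [apply Ccontinuous_const|apply Ccontinuous_cexp].
Qed.

Lemma nz_ch_continuous : Ccontinuous (nz_ch k n F b).
Proof.
  apply Ccontinuous_plus; [|apply nz_y_continuous].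
  apply Ccontinuous_mult; [apply Ccontinuous_const|apply nz_om_continuous].
Qed.

Lemma Cderive_nz_om s : Cderive (nz_om k n F b) s (nz_ch k n F b s).
Proof.
  eapply Cderive_eq.
  - apply Cderive_plus; [apply Cderive_Dop, nz_y_continuous|apply Cderive_scal, Cderive_cexp].
  - unfold nz_ch, nz_om, nz_w. ring.
Qed.

Lemma Cderive_nz_ch s :
  Cderive (nz_ch k n F b) s (((n ^ 2)%R, (lam k * n)%R) * nz_om k n F b s + F s)%C.
Proof.
  destruct (mure_facts k n Hk Hn) as (_ & _ & _ & _ & <-).
  eapply Cderive_eq.
  - apply Cderive_plus; [apply Cderive_scal, Cderive_nz_om|].
    apply Cderive_opp, Cderive_Iop, CF.
  - unfold nz_ch, nz_y. ring.
Qed.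

Lemma nz_zop_continuous : Ccontinuous (zop n (nz_om k n F b)).
Proof. apply Ccontinuous_Iop, Ccontinuous_e2, nz_om_continuous. Qed.

Lemma Cderive_nz_ps s : Cderive (nz_ps k n F b) s (nz_ph k n F b s).
Proof. apply Cderive_Dop, nz_zop_continuous. Qed.

Lemma Cderive_nz_ph s :
  Cderive (nz_ph k n F b) s (RtoC (n ^ 2) * nz_ps k n F b s - e2 (nz_om k n F b) s)%C.
Proof.
  eapply Cderive_eq.
  - apply Cderive_plus; [apply Cderive_scal, Cderive_nz_ps|].
    apply Cderive_Iop, Ccontinuous_e2, nz_om_continuous.
  - unfold nz_ph. fold (zop n (nz_om k n F b)).
    replace (RtoC (n ^ 2)) with (RtoC (Rabs n) * RtoC (Rabs n))%C; [ring|].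
    rewrite <- RtoC_mult, <- pow2_abs. f_equal; ring.
Qed.

Lemma nz_ps_0 : nz_ps k n F b 0 = 0%C.
Proof. apply Dop_0. Qed.

Lemma nz_Fh_nonneg : 0 <= Fh.
Proof. now apply L1_le_nonneg in HF. Qed.

Lemma L1_nz_y : L1_le k (fun s => Cmod (nz_y k n F s)) (Fh / a).
Proof.
  destruct (mure_facts k n Hk Hn) as ((_ & Ha) & _). fold a in Ha. pose proof nz_Fh_nonneg.
  assert (H' : L1_le k (fun s => Cmod (Iop (mu k n) F s)) (Fh / (a + k))).
  { apply (L1_le_Iop k (mu k n) F Fh); try assumption. simpl; fold a; lra. }
  apply L1_le_weaken with (Fh / (a + k)).
  - apply Rmult_le_compat_l; [assumption|]. apply Rinv_le_contravar; lra.
  - intros S HS. rewrite (RInt_ext _ (fun s => exp (k * s) * Cmod (Iop (mu k n) F s))); [now apply H'|].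
    intros; unfold nz_y; now rewrite Cmod_opp.
Qed.

Lemma nz_y_le s : 0 <= s -> Cmod (nz_y k n F s) <= exp (- k * s) * Fh.
Proof.
  intros Hs. destruct (mure_facts k n Hk Hn) as ((_ & Ha) & _).
  unfold nz_y; rewrite Cmod_opp. apply Cmod_Iop_le; try assumption. simpl; lra.
Qed.

(** The second inversion gains another [1 / a], up to the factor 2 of [a - k >= a / 2]; as
    [a^2 >= lam |n| / 2], this is the gain of [1 / lambda]. *)
Lemma L1_nz_w : L1_le k (fun s => Cmod (nz_w k n F s)) (2 * Fh / a ^ 2).
Proof.
  destruct (mure_facts k n Hk Hn) as ((_ & Ha) & _). fold a in Ha. pose proof nz_Fh_nonneg.
  apply L1_le_weaken with (Fh / a / (a - k)).
  - assert (/ (a - k) <= 2 / a).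
    { apply (Rmult_le_reg_l (a - k)); [lra|]. rewrite Rinv_r by lra.
      apply (Rmult_le_reg_r a); [lra|]. replace ((a - k) * (2 / a) * a) with (2 * (a - k)) by (field; lra). lra. }
    replace (2 * Fh / a ^ 2) with (Fh / a * (2 / a)) by (field; lra).
    apply Rmult_le_compat_l; [|assumption]. apply Rmult_le_pos; [assumption|left; apply Rinv_0_lt_compat; lra].
  - apply (L1_le_Dop k (mu k n)); [apply nz_y_continuous|simpl; fold a; lra|apply L1_nz_y].
Qed.

(** [5 / 2 = 3 / 2 + 1], from [|mu| <= 3 a / 2] and from [a] bounding the modulus of [|n| - 2]. For
    [|n| = 1] the rate [|n| - 2] is negative, but [nz_w] is integrable at rate [k], which is enough
    for [Iop]. *)
Lemma nz_coef_le : Cmod (nz_coef k n F b) <= 5 / 2 * a * (Cmod b + 2 * Fh / a ^ 2).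
Proof.
  destruct (mure_facts k n Hk Hn) as ((Ha' & Ha) & _ & _ & Hmu & _). fold a in Ha, Hmu, Ha'.
  unfold nz_coef. rewrite Cmod_mult. apply Rmult_le_compat; try apply Cmod_ge_0.
  - eapply Rle_trans; [apply Cmod_triangle|]. rewrite Cmod_R.
    assert (Rabs (Rabs n - 2) <= a) by (apply Rabs_le; lra). lra.
  - eapply Rle_trans; [apply Cmod_triangle|]. rewrite Cmod_opp. apply Rplus_le_compat_l.
    replace (2 * Fh / a ^ 2) with (exp (- k * 0) * (2 * Fh / a ^ 2)) by (rewrite Rmult_0_r, exp_0; ring).
    apply Cmod_Iop_le; [simpl; lra|apply nz_w_continuous|apply L1_nz_w|lra].
Qed.

Lemma nz_P_ge : 12 * (Fh / a ^ 2) + 5 * Cmod b <= P.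
Proof. replace (12 * (Fh / a ^ 2)) with (12 * Fh / a ^ 2) by (unfold Rdiv; ring). exact HP. Qed.

Lemma nz_Fh_div_nonneg : 0 <= Fh / a ^ 2.
Proof.
  destruct (mure_facts k n Hk Hn) as ((_ & Ha) & _). fold a in Ha. pose proof nz_Fh_nonneg.
  apply Rmult_le_pos; [assumption|left; apply Rinv_0_lt_compat; nra].
Qed.

(** Origin of the constants 12 and 5: as [a - k >= a / 2], the homogeneous part has norm at most
    [5 |b| + 10 Fh / a^2], to which the particular part adds [2 Fh / a^2]. *)
Lemma L1_nz_om : L1_le k (fun s => Cmod (nz_om k n F b s)) P.
Proof.
  destruct (mure_facts k n Hk Hn) as ((_ & Ha) & _). fold a in Ha.
  pose proof nz_P_ge as HP'. pose proof nz_Fh_div_nonneg as Fa. pose proof nz_coef_le as Hc.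
  set (c := Cmod (nz_coef k n F b)) in *.
  assert (Hc0 : 0 <= c) by apply Cmod_ge_0.
  apply L1_le_weaken with (2 * Fh / a ^ 2 + c / (a - k)).
  - assert (c / (a - k) <= 5 * (Cmod b + 2 * (Fh / a ^ 2))).
    { apply (Rmult_le_reg_r (a - k)); [lra|]. replace (c / (a - k) * (a - k)) with c by (field; lra).
      eapply Rle_trans; [apply Hc|].
      replace (2 * Fh / a ^ 2) with (2 * (Fh / a ^ 2)) by (field; lra).
      pose proof (Cmod_ge_0 b). nra. }
    replace (2 * Fh / a ^ 2) with (2 * (Fh / a ^ 2)) by (field; lra). lra.
  - apply L1_le_mono with (fun s => Cmod (nz_w k n F s) + c * exp (- a * s)).
    + apply continuous_Cmod, nz_om_continuous.
    + intros s. apply continuous_Rplus; [apply continuous_Cmod, nz_w_continuous|].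
      apply continuous_ex_derive; auto_derive; trivial.
    + intros s _. eapply Rle_trans; [apply Cmod_triangle|]. rewrite Cmod_mult, Cmod_cexp. apply Rle_refl.
    + apply L1_le_plus.
      * apply continuous_Cmod, nz_w_continuous.
      * intros s; apply continuous_ex_derive; auto_derive; trivial.
      * apply L1_nz_w.
      * apply L1_le_exp; lra.
Qed.

(** A pointwise bound costs one factor [a] over the integral bound, as befits a layer of width
    [1 / a]. *)
Lemma nz_om_le s : 0 <= s -> Cmod (nz_om k n F b s) <= exp (- k * s) * (a * P).
Proof.
  intros Hs. destruct (mure_facts k n Hk Hn) as ((_ & Ha) & _). fold a in Ha.
  pose proof nz_P_ge as HP'. pose proof nz_Fh_div_nonneg as Fa. pose proof nz_coef_le as Hc.
  set (c := Cmod (nz_coef k n F b)) in *.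
  assert (Hc0 : 0 <= c) by apply Cmod_ge_0.
  eapply Rle_trans; [apply Cmod_triangle|]. rewrite Cmod_mult, Cmod_cexp. fold c.
  assert (H1 : Cmod (nz_w k n F s) <= exp (- k * s) * (Fh / a)).
  { apply Cmod_Dop_le; [apply nz_y_continuous|simpl; fold a; lra|assumption|apply L1_nz_y]. }
  assert (H2 : exp (Re (- mu k n) * s) <= exp (- k * s)).
  { apply exp_le_compat. change (Re (- mu k n)) with (- a). nra. }
  replace (Fh / a) with (a * (Fh / a ^ 2)) in H1 by (field; lra).
  replace (2 * Fh / a ^ 2) with (2 * (Fh / a ^ 2)) in Hc by (field; lra).
  pose proof (exp_pos (- k * s)). pose proof (Cmod_ge_0 b).
  set (e := exp (- k * s)) in *. set (e' := exp (Re (- mu k n) * s)) in *.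
  apply Rle_trans with (e * (a * (Fh / a ^ 2)) + c * e).
  - apply Rplus_le_compat; [assumption|now apply Rmult_le_compat_l].
  - rewrite (Rmult_comm c), <- Rmult_plus_distr_l. apply Rmult_le_compat_l; [lra|]. nra.
Qed.

Lemma nz_ch_aux s : Cmod (nz_ch k n F b s) <= 3 / 2 * a * Cmod (nz_om k n F b s) + Cmod (nz_y k n F s).
Proof.
  destruct (mure_facts k n Hk Hn) as (_ & _ & _ & Hmu & _). fold a in Hmu.
  eapply Rle_trans; [apply Cmod_triangle|]. rewrite Cmod_mult, Cmod_opp.
  apply Rplus_le_compat_r, Rmult_le_compat_r; [apply Cmod_ge_0|assumption].
Qed.

Lemma L1_nz_ch : L1_le k (fun s => Cmod (nz_ch k n F b s)) (2 * a * P).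
Proof.
  destruct (mure_facts k n Hk Hn) as ((_ & Ha) & _). fold a in Ha.
  pose proof nz_P_ge as HP'. pose proof nz_Fh_div_nonneg as Fa. pose proof (Cmod_ge_0 b).
  assert (C1 : cont (fun s => Cmod (nz_om k n F b s))) by (apply continuous_Cmod, nz_om_continuous).
  assert (C2 : cont (fun s => Cmod (nz_y k n F s))) by (apply continuous_Cmod, nz_y_continuous).
  assert (C3 : cont (fun s => 3 / 2 * a * Cmod (nz_om k n F b s))).
  { intros s. apply continuous_Rscal, C1. }
  apply L1_le_weaken with (3 / 2 * a * P + Fh / a).
  - replace (Fh / a) with (a * (Fh / a ^ 2)) by (field; lra). nra.
  - apply L1_le_mono with (fun s => 3 / 2 * a * Cmod (nz_om k n F b s) + Cmod (nz_y k n F s)).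
    + apply continuous_Cmod, nz_ch_continuous.
    + intros s. now apply continuous_Rplus.
    + intros s _; apply nz_ch_aux.
    + apply L1_le_plus; [exact C3|exact C2| |apply L1_nz_y].
      apply L1_le_scal; [lra|exact C1|apply L1_nz_om].
Qed.

Lemma nz_ch_le s : 0 <= s -> Cmod (nz_ch k n F b s) <= exp (- k * s) * (2 * a ^ 2 * P).
Proof.
  intros Hs. destruct (mure_facts k n Hk Hn) as ((_ & Ha) & _). fold a in Ha.
  pose proof nz_P_ge as HP'. pose proof nz_Fh_div_nonneg as Fa. pose proof (Cmod_ge_0 b).
  eapply Rle_trans; [apply nz_ch_aux|].
  pose proof (nz_om_le s Hs) as H1. pose proof (nz_y_le s Hs) as H2.
  replace Fh with (a ^ 2 * (Fh / a ^ 2)) in H2 by (field; lra).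
  set (o := Cmod (nz_om k n F b s)) in *. set (y := Cmod (nz_y k n F s)) in *.
  set (e := exp (- k * s)) in *. assert (0 < e) by apply exp_pos.
  set (f := Fh / a ^ 2) in *.
  apply Rle_trans with (3 / 2 * a * (e * (a * P)) + e * (a ^ 2 * f)); [nra|].
  replace (3 / 2 * a * (e * (a * P)) + e * (a ^ 2 * f)) with (e * (a ^ 2 * (3 / 2 * P + f))) by ring.
  apply Rmult_le_compat_l; [lra|]. replace (2 * a ^ 2 * P) with (a ^ 2 * (2 * P)) by ring.
  apply Rmult_le_compat_l; nra.
Qed.

Lemma nz_P_nonneg : 0 <= P.
Proof. pose proof nz_P_ge; pose proof nz_Fh_div_nonneg; pose proof (Cmod_ge_0 b); lra. Qed.

Lemma nz_zop_le s : 0 <= s -> Cmod (zop n (nz_om k n F b) s) <= exp (- s) * P.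
Proof.
  intros Hs. pose proof nz_P_nonneg.
  eapply Rle_trans.
  - apply (Cmod_Iop_le (RtoC (Rabs n)) (k - 2) (e2 (nz_om k n F b)) P s); [simpl; lra| | |assumption].
    + apply Ccontinuous_e2, nz_om_continuous.
    + apply L1_le_e2, L1_nz_om.
  - apply Rmult_le_compat_r; [assumption|]. apply exp_le_compat. nra.
Qed.

(** The decay [exp (- s)] is that of the slowest harmonic mode, [|n| = 1]. The factor [1 / k] arises
    because [zop] is integrable at rate [k - 2]; it is responsible for [sqrt lambda] instead of
    [lambda] in the radial bound. *)
Lemma nz_ps_le s : 0 <= s -> Cmod (nz_ps k n F b s) <= exp (- s) * (2 * P / k).
Proof.
  intros Hs. pose proof nz_P_nonneg as HP0.
  replace (- s) with (- (1) * s) by ring.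
  apply Cmod_Dop_le; [apply nz_zop_continuous|simpl; lra|assumption|].
  assert (C1 : cont (fun s => Cmod (zop n (nz_om k n F b) s))) by (apply continuous_Cmod, nz_zop_continuous).
  apply (L1_le_rate (k - 2)); [lra|exact C1|intros; apply Cmod_ge_0|].
  apply L1_le_weaken with (P / (Rabs n + (k - 2))).
  - apply (Rmult_le_reg_r k); [lra|]. replace (2 * P / k * k) with (2 * P) by (field; lra).
    apply (Rmult_le_reg_r (Rabs n + (k - 2))); [lra|].
    replace (P / (Rabs n + (k - 2)) * k * (Rabs n + (k - 2))) with (P * k) by (field; lra). nra.
  - apply (L1_le_Iop (k - 2) (RtoC (Rabs n))); [simpl; lra|apply Ccontinuous_e2, nz_om_continuous|].
    apply L1_le_e2, L1_nz_om.
Qed.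

Lemma nz_ph_le s : 0 <= s -> Cmod (nz_ph k n F b s) <= exp (- s) * (2 * jap n * P).
Proof.
  intros Hs. pose proof nz_P_nonneg as HP0.
  eapply Rle_trans; [apply Cmod_triangle|]. rewrite Cmod_mult, Cmod_opp, Cmod_R, (Rabs_pos_eq (Rabs n)) by lra.
  pose proof (nz_ps_le s Hs) as H1. pose proof (nz_zop_le s Hs) as H2.
  set (e := exp (- s)) in *. assert (0 < e) by apply exp_pos.
  assert (Hq : 2 * P / k <= P).
  { apply (Rmult_le_reg_r k); [lra|]. replace (2 * P / k * k) with (2 * P) by (field; lra). nra. }
  assert (Cmod (nz_ps k n F b s) <= e * P) by (eapply Rle_trans; [exact H1|apply Rmult_le_compat_l; lra]).
  unfold jap. assert (0 <= e * P) by (apply Rmult_le_pos; lra). nra.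
Qed.

(* [nz_coef] is the multiple of the homogeneous solution for which this holds. *)
Lemma nz_ph_0 : nz_ph k n F b 0 = b.
Proof.
  destruct (mure_facts k n Hk Hn) as ((_ & Ha) & _). fold a in Ha.
  unfold nz_ph. rewrite nz_ps_0.
  set (nu := (mu k n + RtoC (Rabs n - 2))%C).
  assert (Hnu : nu <> 0%C).
  { intros E. apply (f_equal Re) in E. simpl in E. fold a in E. lra. }
  set (w := nz_w k n F).
  (* Candidate for [zop] applied to the vorticity: taking out [e^(2 s)] shifts the rate from [|n|]
     to [|n| - 2], and the homogeneous part integrates to [exp (- mu s) / nu]. At [s = 0] the choice
     of [nz_coef] gives [b]. *)
  set (Y := fun s => (RtoC (exp (2 * s)) * (Iop (RtoC (Rabs n - 2)) w s + nz_coef k n F b / nu * cexp (- mu k n) s))%C).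
  unfold zop.
  rewrite (Iop_unique (RtoC (Rabs n)) (k - 2) (2 * Fh / a ^ 2 + Cmod (nz_coef k n F b / nu)) P Y).
  - unfold Y. rewrite Rmult_0_r, exp_0, cexp_0. unfold nz_coef. fold nu w.
    field. exact Hnu.
  - simpl; lra.
  - apply Ccontinuous_e2, nz_om_continuous.
  - apply L1_le_e2, L1_nz_om.
  - intros s. eapply Cderive_eq.
    + apply Cderive_mult.
      * instantiate (1 := RtoC (2 * exp (2 * s))). split; simpl; [auto_derive; trivial; ring|apply is_derive_Rconst].
      * apply Cderive_plus; [apply Cderive_Iop, nz_w_continuous|apply Cderive_scal, Cderive_cexp].
    + unfold Y, e2, nz_om. fold w. rewrite RtoC_mult.
      replace (mu k n) with (nu - RtoC (Rabs n - 2))%C at 2 by (unfold nu; ring).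
      rewrite RtoC_minus. field. exact Hnu.
  - intros s Hs. unfold Y. rewrite Cmod_mult, Cmod_R, Rabs_pos_eq by (left; apply exp_pos).
    replace (- (k - 2) * s) with (2 * s + - k * s) by ring. rewrite exp_plus, Rmult_assoc.
    apply Rmult_le_compat_l; [left; apply exp_pos|].
    eapply Rle_trans; [apply Cmod_triangle|]. rewrite Rmult_plus_distr_l.
    apply Rplus_le_compat.
    + apply Cmod_Iop_le; [simpl; lra|apply nz_w_continuous|apply L1_nz_w|assumption].
    + rewrite Cmod_mult, Cmod_cexp, Rmult_comm. apply Rmult_le_compat_r; [apply Cmod_ge_0|].
      apply exp_le_compat. change (Re (- mu k n)) with (- a). nra.
Qed.

End NonzeroMode.

(** For [n = 0] the equation [om'' = A'] is integrated once with constant zero, then from infinity.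
    Another constant would give a multivalued pressure and a vorticity that does not decay. *)
Definition z_om (A : R -> C) (s : R) : C := (- Iop 0 A s)%C.

(** In mode [0] only [psi_s] enters the velocity, so [ps] is set to zero and [ph] is not its
    derivative; the additive constant of [ph] serves the datum [b]. The pressure comes from its
    angular equation when [n <> 0], and from integration in [s] when [n = 0]. *)
Definition build (k : R) (m : Z) (A F G : R -> C) (b : C) : mode :=
  let n := IZR m in
  if Z.eq_dec m 0 then
    Mode (z_om A) A (fun _ => 0%C)
      (fun s => b - zop 0 (z_om A) 0%R + zop 0 (z_om A) s)%C
      (b - zop 0 (z_om A) 0%R)%C
      (Dop 0 (fun s => RtoC (lam k) * z_om A s - G s)%C)
  else
    Mode (nz_om k n F b) (nz_ch k n F b) (nz_ps k n F b) (nz_ph k n F b) 0%C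
      (fun s => (nz_ch k n F b s - A s) / (Ci * RtoC n))%C.

(* [n] is the frequency, [b] the value of [psi'] prescribed at [s = 0], and the source of the
   vorticity equation is [A' - i n G].  [P] measures the mode: all bounds are uniform in
   [k] and [n] once expressed through it. *)
Record good (k n : R) (b : C) (A G : R -> C) (P : R) (M : mode) : Prop := {
  g_om : forall s, Cderive (om M) s (ch M s);
  g_ch : Ccontinuous (ch M);
  g_ph : forall s, Cderive (ph M) s (RtoC (n ^ 2) * ps M s - e2 (om M) s)%C;
  g_ps : forall s, Cderive (ps M) s (if Req_EM_T n 0 then 0%C else ph M s);
  g_ps0 : ps M 0 = 0%C;
  g_ph0 : ph M 0 = b;
  g_L1om : L1_le k (fun s => Cmod (om M s)) P;
  g_L1ch : L1_le k (fun s => Cmod (ch M s)) (8 * k * jap n * P);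
  g_omle : forall s, 0 <= s -> Cmod (om M s) <= exp (- k * s) * (4 * k * jap n * P);
  (* In mode [0] the profile [ch] is the source [A] itself, which is bounded pointwise later,
     through the two subtrees. *)
  g_chle : forall s, 0 <= s -> Cmod (ch M s) <= exp (- k * s) * (2 * lam k * jap n ^ 2 * P) \/ ch M = A;
  g_psle : forall s, 0 <= s -> Cmod (ps M s) <= exp (- s) * (2 * P / k);
  g_phle : forall s, 0 <= s -> Cmod (ph M s) <= 2 * jap n * P;
  g_phdec : forall s, 0 <= s -> Cmod (ph M s - phinf M) <= exp (- s) * (2 * jap n * P);
  g_phinf : Cmod (phinf M) <= P;
  g_q : forall s, Cderive (qq M) s (RtoC (lam k) * om M s - Ci * RtoC n * om M s - G s)%C;
  g_qth : forall s, (Ci * RtoC n * qq M s)%C = (ch M s - A s)%C;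
  g_q0 : forall g, n = 0 -> L1_le 0 (fun s => Cmod (G s)) g ->
         forall s, 0 <= s -> Cmod (qq M s) <= lam k * P + g;
  g_phinf0 : n <> 0 -> phinf M = 0%C }.

Arguments g_om {k n b A G P M}.
Arguments g_ch {k n b A G P M}.
Arguments g_ph {k n b A G P M}.
Arguments g_ps {k n b A G P M}.
Arguments g_ps0 {k n b A G P M}.
Arguments g_ph0 {k n b A G P M}.
Arguments g_L1om {k n b A G P M}.
Arguments g_L1ch {k n b A G P M}.
Arguments g_omle {k n b A G P M}.
Arguments g_chle {k n b A G P M}.
Arguments g_psle {k n b A G P M}.
Arguments g_phle {k n b A G P M}.
Arguments g_phdec {k n b A G P M}.
Arguments g_phinf {k n b A G P M}.
Arguments g_q {k n b A G P M}.
Arguments g_qth {k n b A G P M}.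
Arguments g_q0 {k n b A G P M}.
Arguments g_phinf0 {k n b A G P M}.

Lemma L1_le_Cscal k j c g m :
  Ccontinuous g -> L1_le k (fun s => Cmod (g s)) m ->
  j = Cmod c * m -> L1_le k (fun s => Cmod (c * g s)) j.
Proof.
  intros Cg H ->.
  apply L1_le_mono with (fun s => Cmod c * Cmod (g s)).
  - apply continuous_Cmod, Ccontinuous_mult; [apply Ccontinuous_const|exact Cg].
  - intros s; apply continuous_Rscal, continuous_Cmod, Cg.
  - intros; rewrite Cmod_mult; apply Rle_refl.
  - apply L1_le_scal; [apply Cmod_ge_0|now apply continuous_Cmod|assumption].
Qed.

(** Without damping, the gain is the [1 / k] of one integration against the weight; at the nodes,
    [Ah] brings the other [1 / k]. The factor 2 is due to [ph], where [zop] occurs both at [s] and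
    at [0]. *)
Lemma build_good_zero k A F G b Ah P :
  4 <= k -> Ccontinuous A -> Ccontinuous G ->
  (forall s, Cderive A s (F s)) ->
  L1_le k (fun s => Cmod (A s)) Ah -> 2 * Ah / k + Cmod b <= P ->
  good k 0 b A G P (build k 0 A F G b).
Proof.
  intros Hk CA CG HA LA HP.
  unfold build. destruct (Z.eq_dec 0 0) as [_|E]; [|congruence].
  pose proof (L1_le_nonneg _ _ _ LA) as Ah0.
  assert (Hq0 : 0 <= Ah / k) by (apply Rmult_le_pos; [assumption|left; apply Rinv_0_lt_compat; lra]).
  assert (HP' : 2 * (Ah / k) + Cmod b <= P) by (replace (2 * (Ah / k)) with (2 * Ah / k) by (unfold Rdiv; ring); exact HP).
  pose proof (Cmod_ge_0 b) as Hb.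
  assert (Com : Ccontinuous (z_om A)) by (now apply Ccontinuous_opp, Ccontinuous_Iop).
  assert (Hom : forall s, 0 <= s -> Cmod (z_om A s) <= exp (- k * s) * Ah).
  { intros s Hs; unfold z_om; rewrite Cmod_opp. apply Cmod_Iop_le; try assumption. simpl; lra. }
  assert (Lom : L1_le k (fun s => Cmod (z_om A s)) (Ah / k)).
  { pose proof (L1_le_Iop k 0 A Ah) as H. simpl in H. rewrite Rplus_0_l in H.
    intros S HS. rewrite (RInt_ext _ (fun s => exp (k * s) * Cmod (Iop 0 A s))).
    - apply H; try assumption; lra.
    - intros; unfold z_om; now rewrite Cmod_opp. }
  assert (Hz : forall s, 0 <= s -> Cmod (zop 0 (z_om A) s) <= exp (- s) * (Ah / k)).
  { intros s Hs. eapply Rle_trans.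
    - apply (Cmod_Iop_le (RtoC (Rabs 0)) (k - 2) (e2 (z_om A)) (Ah / k) s); [simpl; rewrite Rabs_R0; lra|now apply Ccontinuous_e2|now apply L1_le_e2|assumption].
    - apply Rmult_le_compat_r; [assumption|]. apply exp_le_compat. nra. }
  assert (Hz0 : Cmod (zop 0 (z_om A) 0) <= Ah / k).
  { pose proof (Hz 0 (Rle_refl 0)) as H. rewrite Ropp_0, exp_0 in H. lra. }
  assert (Hj : jap 0 = 1) by (unfold jap; rewrite Rabs_R0; ring).
  split; simpl om; simpl ch; simpl ps; simpl ph; simpl phinf; simpl qq; rewrite ?Hj.
  - intros s. eapply Cderive_eq; [apply Cderive_opp, Cderive_Iop, CA|]. ring.
  - exact CA.
  - intros s. eapply Cderive_eq.
    + apply Cderive_plus; [apply Cderive_const|apply Cderive_Iop; now apply Ccontinuous_e2].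
    + rewrite Rabs_R0. ring.
  - intros s. destruct (Req_EM_T 0 0); [apply Cderive_const|lra].
  - reflexivity.
  - ring.
  - apply L1_le_weaken with (Ah / k); [lra|assumption].
  - apply L1_le_weaken with Ah; [|assumption].
    replace Ah with (k * (Ah / k)) by (field; lra). nra.
  - intros s Hs. eapply Rle_trans; [now apply Hom|]. apply Rmult_le_compat_l; [left; apply exp_pos|].
    replace Ah with (k * (Ah / k)) by (field; lra). nra.
  - intros; now right.
  - intros s Hs. rewrite Cmod_0. apply Rmult_le_pos; [left; apply exp_pos|].
    apply Rmult_le_pos; [lra|left; apply Rinv_0_lt_compat; lra].
  - intros s Hs. eapply Rle_trans; [apply Cmod_triangle|].
    assert (Cmod (b - zop 0 (z_om A) 0%R) <= Cmod b + Ah / k).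
    { eapply Rle_trans; [apply Cmod_triangle|]. rewrite Cmod_opp. lra. }
    pose proof (Hz s Hs). pose proof (exp_le_compat (- s) 0 ltac:(lra)) as He. rewrite exp_0 in He.
    nra.
  - intros s Hs. replace (_ - _)%C with (zop 0 (z_om A) s) by ring.
    eapply Rle_trans; [now apply Hz|]. apply Rmult_le_compat_l; [left; apply exp_pos|lra].
  - eapply Rle_trans; [apply Cmod_triangle|]. rewrite Cmod_opp. lra.
  - intros s. eapply Cderive_eq; [apply Cderive_Dop|].
    + apply Ccontinuous_minus; [|assumption]. apply Ccontinuous_mult; [apply Ccontinuous_const|assumption].
    + cbv beta; ring.
  - intros; ring.
  - intros g _ Lg s Hs.
    replace (lam k * P + g) with (exp (- 0 * s) * (lam k * P + g)) by (rewrite Ropp_0, Rmult_0_l, exp_0; ring).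
    assert (Cl : Ccontinuous (fun s => RtoC (lam k) * z_om A s)%C) by (apply Ccontinuous_mult; [apply Ccontinuous_const|assumption]).
    assert (Hl : 0 <= lam k) by (unfold lam; nra).
    apply Cmod_Dop_le; [now apply Ccontinuous_minus|simpl; lra|assumption|].
    apply L1_le_mono with (fun s => Cmod (RtoC (lam k) * z_om A s) + Cmod (G s)).
    + apply continuous_Cmod; now apply Ccontinuous_minus.
    + intros t; apply continuous_Rplus; now apply continuous_Cmod.
    + intros t _. eapply Rle_trans; [apply Cmod_triangle|]. rewrite Cmod_opp; lra.
    + apply L1_le_plus; try now apply continuous_Cmod. 2: assumption.
      apply (L1_le_rate k); [lra|now apply continuous_Cmod|intros; apply Cmod_ge_0|].
      apply L1_le_Cscal with P; [assumption| |rewrite Cmod_R, Rabs_pos_eq by assumption; reflexivity].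
      apply L1_le_weaken with (Ah / k); [lra|assumption].
  - intros E; contradiction.
Qed.

Lemma build_good_nonzero k m A F G b Fh P :
  4 <= k -> m <> 0%Z -> Ccontinuous A -> Ccontinuous F -> Ccontinuous G ->
  (forall s, Cderive A s (F s + Ci * RtoC (IZR m) * G s)%C) ->
  L1_le k (fun s => Cmod (F s)) Fh -> 48 * Fh / (lam k * jap (IZR m)) + 5 * Cmod b <= P ->
  good k (IZR m) b A G P (build k m A F G b).
Proof.
  intros Hk Hm CA CF CG HA LF HP0.
  unfold build. destruct (Z.eq_dec m 0) as [E|_]; [contradiction|].
  set (n := IZR m) in *.
  assert (Hn : 1 <= Rabs n).
  { unfold n. rewrite <- abs_IZR. apply IZR_le. lia. }
  assert (n0 : n <> 0) by (intros E; rewrite E, Rabs_R0 in Hn; lra).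
  destruct (mure_facts k n Hk Hn) as ((_ & Ha) & Ha2 & Hau & _).
  pose proof (L1_le_nonneg _ _ _ LF) as F0.
  pose proof (Cmod_ge_0 b) as Hb.
  assert (Hl : 256 <= lam k) by (unfold lam; nra).
  assert (HP : 12 * Fh / mure k n ^ 2 + 5 * Cmod b <= P).
  { eapply Rle_trans; [|exact HP0]. apply Rplus_le_compat_r.
    (* [48 = 4 * 12]: from [mure^2 >= lam |n| / 2] and [jap n <= 2 |n|] one gets
       [mure^2 >= lam * jap n / 4]. *)
    assert (J : 1 <= jap n) by apply jap_ge_1.
    assert (J2 : jap n <= 2 * Rabs n) by (unfold jap; lra).
    apply (Rmult_le_reg_r (mure k n ^ 2)); [nra|].
    replace (12 * Fh / mure k n ^ 2 * mure k n ^ 2) with (12 * Fh) by (field; lra).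
    apply (Rmult_le_reg_r (lam k * jap n)); [nra|].
    replace (48 * Fh / (lam k * jap n) * mure k n ^ 2 * (lam k * jap n)) with (Fh * (48 * mure k n ^ 2)) by (field; lra).
    rewrite Rmult_assoc, (Rmult_comm 12), Rmult_assoc. apply Rmult_le_compat_l; [assumption|]. nra. }
  assert (P0 : 0 <= P) by (eapply nz_P_nonneg; eassumption).
  assert (Hau2 : mure k n ^ 2 <= lam k * jap n ^ 2).
  { unfold lam. replace (16 * k ^ 2 * jap n ^ 2) with ((4 * k * jap n) ^ 2) by ring. apply pow_incr; lra. }
  split; simpl om; simpl ch; simpl ps; simpl ph; simpl phinf; simpl qq.
  - intros; now apply Cderive_nz_om.
  - now apply nz_ch_continuous.
  - intros; now apply Cderive_nz_ph.
  - intros. destruct (Req_EM_T n 0); [contradiction|now apply Cderive_nz_ps].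
  - apply nz_ps_0.
  - now apply nz_ph_0 with Fh P.
  - now apply L1_nz_om with Fh.
  - apply L1_le_weaken with (2 * mure k n * P); [nra|]. now apply L1_nz_ch with Fh.
  - intros s Hs. eapply Rle_trans; [now apply nz_om_le with (Fh := Fh) (P := P)|].
    apply Rmult_le_compat_l; [left; apply exp_pos|]. now apply Rmult_le_compat_r.
  - intros s Hs; left. eapply Rle_trans; [now apply nz_ch_le with (Fh := Fh) (P := P)|].
    apply Rmult_le_compat_l; [left; apply exp_pos|]. apply Rmult_le_compat_r; lra.
  - intros s Hs. now apply nz_ps_le with Fh.
  - intros s Hs. eapply Rle_trans; [now apply nz_ph_le with (Fh := Fh) (P := P)|].
    pose proof (exp_le_compat (- s) 0 ltac:(lra)) as He. rewrite exp_0 in He.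
    pose proof (jap_ge_1 n). assert (0 <= 2 * jap n * P) by (apply Rmult_le_pos; lra). nra.
  - intros s Hs. replace (_ - 0)%C with (nz_ph k n F b s) by ring. now apply nz_ph_le with Fh.
  - now rewrite Cmod_0.
  - intros s.
    assert (Hin : (Ci * RtoC n)%C <> 0%C).
    { intros E. apply (f_equal Im) in E. simpl in E. lra. }
    eapply Cderive_eq.
    + unfold Cdiv. eapply Cderive_ext with (f := fun s => (/ (Ci * RtoC n) * (nz_ch k n F b s - A s))%C).
      { intros; ring. }
      apply Cderive_scal, Cderive_minus; [now apply Cderive_nz_ch|apply HA].
    (* [n^2 + i lam n = (i n) (lam - i n)]; after division by [i n], the derivative [A' = F + i n G]
       cancels [F] and leaves [- G]. *)
    + replace (((n ^ 2)%R, (lam k * n)%R) : C) with (- (Ci * RtoC n) * (Ci * RtoC n) + (Ci * RtoC n) * RtoC (lam k))%C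
        by (apply C_ext; simpl; ring).
      field. split; intros E; apply Hin; rewrite E; ring.
  - intros s. field. split; [|intros E; apply (f_equal Im) in E; simpl in E; lra].
    intros E; apply (f_equal Re) in E; simpl in E; lra.
  - intros g E; contradiction.
  - reflexivity.
Qed.

(** * The tree expansion *)

(* A tree stands for a product of boundary modes; the boolean chooses between the two terms
   of [Re a * Re b = (Re (a * b) + Re (a * conj b)) / 2]. *)
Inductive tree : Set := Leaf (n : nat) | Node (e : bool) (t1 t2 : tree).

Definition cj (e : bool) (z : C) : C := if e then z else Cconj z.

Fixpoint idx (t : tree) : Z :=
  match t with
  | Leaf n => Z.of_nat n
  | Node e t1 t2 => if e then (idx t1 + idx t2)%Z else (idx t1 - idx t2)%Z
  end.

Definition fr (t : tree) : R := IZR (idx t).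

(** Contributions of one boolean to the products [psi_t om], [psi_t om_s - psi_s om_t] and
    [psi_s om], in this order; the [/ 2] is that of the product formula for real parts. *)
Definition nodeA (e : bool) (n1 : R) (M1 M2 : mode) (s : R) : C :=
  (/ 2 * (Ci * RtoC n1 * ps M1 s) * cj e (om M2 s))%C.
Definition nodeF (e : bool) (n1 n2 : R) (M1 M2 : mode) (s : R) : C :=
  (/ 2 * (Ci * RtoC n1 * ps M1 s * cj e (ch M2 s) - ph M1 s * cj e (Ci * RtoC n2 * om M2 s)))%C.
Definition nodeG (e : bool) (M1 M2 : mode) (s : R) : C :=
  (/ 2 * ph M1 s * cj e (om M2 s))%C.

(** Boundary data sit on the leaves only. Nodes are solved with zero data, so the sum over all trees
    takes the prescribed value at [s = 0]. *)
Fixpoint sol (k : R) (bd : nat -> C) (t : tree) : mode :=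
  match t with
  | Leaf n => build k (Z.of_nat n) (fun _ => 0%C) (fun _ => 0%C) (fun _ => 0%C) (bd n)
  | Node e t1 t2 =>
      build k (idx t) (nodeA e (fr t1) (sol k bd t1) (sol k bd t2))
        (nodeF e (fr t1) (fr t2) (sol k bd t1) (sol k bd t2))
        (nodeG e (sol k bd t1) (sol k bd t2)) 0%C
  end.

Definition srcA k bd (t : tree) : R -> C :=
  match t with
  | Leaf n => fun _ => 0%C
  | Node e t1 t2 => nodeA e (fr t1) (sol k bd t1) (sol k bd t2)
  end.
Definition srcG k bd (t : tree) : R -> C :=
  match t with
  | Leaf n => fun _ => 0%C
  | Node e t1 t2 => nodeG e (sol k bd t1) (sol k bd t2)
  end.
Definition bdry (bd : nat -> C) (t : tree) : C :=
  match t with Leaf n => bd n | Node _ _ _ => 0%C end.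

(* [size t] is [(1 + |n|)^3] times the bound [wt t] on the mode of frequency [n]; the constant
   432 collects the losses of one application of the solution operator. *)
Fixpoint size (k : R) (bd : nat -> C) (t : tree) : R :=
  match t with
  | Leaf n => 5 * Cmod (bd n) * jap (INR n) ^ 3
  | Node e t1 t2 => 432 / lam k * size k bd t1 * size k bd t2
  end.
Definition wt k bd (t : tree) : R := size k bd t / jap (fr t) ^ 3.

Lemma Cmod_cj e z : Cmod (cj e z) = Cmod z.
Proof. destruct e; [reflexivity|apply Cmod_conj]. Qed.

Lemma Cderive_cj e f s l : Cderive f s l -> Cderive (fun t => cj e (f t)) s (cj e l).
Proof. destruct e; [auto|apply Cderive_conj]. Qed.

Lemma Ccontinuous_cj e f : Ccontinuous f -> Ccontinuous (fun t => cj e (f t)).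
Proof. destruct e; [auto|apply Ccontinuous_conj]. Qed.

Lemma fr_Node e t1 t2 : fr (Node e t1 t2) = if e then fr t1 + fr t2 else fr t1 - fr t2.
Proof. unfold fr; simpl; destruct e; [apply plus_IZR|apply minus_IZR]. Qed.

Lemma jap_fr_Node e t1 t2 : jap (fr (Node e t1 t2)) <= jap (fr t1) * jap (fr t2).
Proof.
  rewrite fr_Node; unfold jap.
  assert (Rabs (if e then fr t1 + fr t2 else fr t1 - fr t2) <= Rabs (fr t1) + Rabs (fr t2)).
  { destruct e; [apply Rabs_triang|]. unfold Rminus. eapply Rle_trans; [apply Rabs_triang|].
    rewrite Rabs_Ropp; lra. }
  pose proof (Rabs_pos (fr t1)); pose proof (Rabs_pos (fr t2)). nra.
Qed.

Lemma size_nonneg k bd t : 4 <= k -> 0 <= size k bd t.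
Proof.
  intros Hk; induction t as [n|e t1 IH1 t2 IH2]; cbn [size].
  - apply Rmult_le_pos; [|apply pow_le; pose proof (jap_ge_1 (INR n)); lra].
    pose proof (Cmod_ge_0 (bd n)); lra.
  - apply Rmult_le_pos; [apply Rmult_le_pos|]; try assumption.
    apply Rmult_le_pos; [lra|left; apply Rinv_0_lt_compat; unfold lam; nra].
Qed.

Lemma size_wt k bd t : size k bd t = wt k bd t * jap (fr t) ^ 3.
Proof.
  unfold wt; field. pose proof (jap_ge_1 (fr t)); lra.
Qed.

Lemma wt_nonneg k bd t : 4 <= k -> 0 <= wt k bd t.
Proof.
  intros Hk; apply Rmult_le_pos; [now apply size_nonneg|].
  left; apply Rinv_0_lt_compat, pow_lt; pose proof (jap_ge_1 (fr t)); lra.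
Qed.

Lemma Cderive_inps k n b A G P M s :
  good k n b A G P M -> Cderive (fun s => Ci * RtoC n * ps M s)%C s (Ci * RtoC n * ph M s)%C.
Proof.
  intros H. pose proof (g_ps H s) as D.
  eapply Cderive_eq; [apply Cderive_scal, D|].
  destruct (Req_EM_T n 0) as [->|]; [ring|reflexivity].
Qed.

Lemma Cmod_Cin n : Cmod (Ci * RtoC n) = Rabs n.
Proof. rewrite Cmod_mult, Cmod_Ci, Cmod_R; ring. Qed.

Lemma Cmod_half : Cmod (/ 2) = / 2.
Proof.
  rewrite Cmod_inv, Cmod_R, Rabs_pos_eq; [reflexivity|lra|].
  intros E; apply (f_equal Re) in E; simpl in E; lra.
Qed.

Ltac ccontinuous :=
  match goal with
  | |- Ccontinuous (fun t => (_ * _)%C) => apply Ccontinuous_mult; ccontinuous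
  | |- Ccontinuous (fun t => (_ - _)%C) => apply Ccontinuous_minus; ccontinuous
  | |- Ccontinuous (fun t => cj _ _) => apply Ccontinuous_cj; ccontinuous
  | |- Ccontinuous (fun t => ?c) => apply (Ccontinuous_const c)
  | |- _ => assumption
  end.

(** * Bilinear estimates for the sources at a node *)

Section NodeEstimates.

Context (k n1 n2 : R) (b1 b2 : C) (A1 A2 G1 G2 : R -> C) (w1 w2 : R) (M1 M2 : mode) (e : bool).
Context (Hk : 4 <= k) (H1 : good k n1 b1 A1 G1 w1 M1) (H2 : good k n2 b2 A2 G2 w2 M2).

Lemma good_nonneg n b A G w M : good k n b A G w M -> 0 <= w.
Proof. intros H; eapply L1_le_nonneg, (g_L1om H). Qed.

Lemma good_continuous n b A G w M : good k n b A G w M ->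
  Ccontinuous (om M) /\ Ccontinuous (ch M) /\ Ccontinuous (ps M) /\ Ccontinuous (ph M).
Proof.
  intros H. split; [|split; [|split]].
  - exact (Cderive_continuous _ _ (g_om H)).
  - exact (g_ch H).
  - exact (Cderive_continuous _ _ (g_ps H)).
  - exact (Cderive_continuous _ _ (g_ph H)).
Qed.

Lemma nodeA_continuous : Ccontinuous (nodeA e n1 M1 M2).
Proof.
  destruct (good_continuous _ _ _ _ _ _ H1) as (? & ? & ? & ?), (good_continuous _ _ _ _ _ _ H2) as (? & ? & ? & ?).
  unfold nodeA; ccontinuous.
Qed.

Lemma nodeF_continuous : Ccontinuous (nodeF e n1 n2 M1 M2).
Proof.
  destruct (good_continuous _ _ _ _ _ _ H1) as (? & ? & ? & ?), (good_continuous _ _ _ _ _ _ H2) as (? & ? & ? & ?).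
  unfold nodeF; ccontinuous.
Qed.

Lemma nodeG_continuous : Ccontinuous (nodeG e M1 M2).
Proof.
  destruct (good_continuous _ _ _ _ _ _ H1) as (? & ? & ? & ?), (good_continuous _ _ _ _ _ _ H2) as (? & ? & ? & ?).
  unfold nodeG; ccontinuous.
Qed.

(* The two forms of the Jacobian: [psi_th om_s - psi_s om_th = (psi_th om)_s - (psi_s om)_th]. *)
Lemma Cderive_nodeA s :
  Cderive (nodeA e n1 M1 M2) s
    (nodeF e n1 n2 M1 M2 s + Ci * RtoC (if e then n1 + n2 else n1 - n2) * nodeG e M1 M2 s)%C.
Proof.
  eapply Cderive_eq.
  - apply Cderive_mult; [apply Cderive_scal, (Cderive_inps _ _ _ _ _ _ _ _ H1)|].
    apply Cderive_cj, (g_om H2).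
  - unfold nodeF, nodeG. destruct e; simpl cj.
    + rewrite RtoC_plus; ring.
    + rewrite RtoC_minus, !Cmult_conj.
      replace (Cconj Ci) with (- Ci)%C by (apply C_ext; simpl; ring).
      replace (Cconj (RtoC n2)) with (RtoC n2) by (apply C_ext; simpl; ring). ring.
Qed.

Lemma jap_Rabs n : Rabs n <= jap n.
Proof. unfold jap; lra. Qed.

Lemma nodeF_le s : 0 <= s ->
  Cmod (nodeF e n1 n2 M1 M2 s) <= jap n1 * w1 / k * Cmod (ch M2 s) + jap n1 * jap n2 * w1 * Cmod (om M2 s).
Proof.
  intros Hs. unfold nodeF. rewrite Cmod_mult, Cmod_half.
  pose proof (Cmod_triangle (Ci * RtoC n1 * ps M1 s * cj e (ch M2 s)) (- (ph M1 s * cj e (Ci * RtoC n2 * om M2 s)))) as T.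
  unfold Cminus. rewrite Cmod_opp in T.
  rewrite (Cmod_mult (_ * _ * _)), !Cmod_mult, !Cmod_cj, !Cmod_mult, Cmod_Ci, !Cmod_R, !Rmult_1_l in T.
  pose proof (g_psle H1 s Hs) as E1.
  pose proof (g_phle H1 s Hs) as E2.
  pose proof (good_nonneg _ _ _ _ _ _ H1) as W1.
  pose proof (exp_le_compat (- s) 0 ltac:(lra)) as He. rewrite exp_0 in He.
  assert (Hq : 0 <= 2 * w1 / k) by (apply Rmult_le_pos; [lra|left; apply Rinv_0_lt_compat; lra]).
  assert (E1' : Cmod (ps M1 s) <= 2 * w1 / k) by nra.
  pose proof (jap_Rabs n1) as J1. pose proof (jap_Rabs n2) as J2.
  pose proof (Cmod_ge_0 (ch M2 s)) as Pc. pose proof (Cmod_ge_0 (om M2 s)) as Po.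
  pose proof (Rabs_pos n1); pose proof (Rabs_pos n2).
  pose proof (Cmod_ge_0 (ps M1 s)). pose proof (Cmod_ge_0 (ph M1 s)).
  assert (X1 : Rabs n1 * Cmod (ps M1 s) * Cmod (ch M2 s) <= 2 * (jap n1 * w1 / k * Cmod (ch M2 s))).
  { replace (2 * (jap n1 * w1 / k * Cmod (ch M2 s))) with (jap n1 * (2 * w1 / k) * Cmod (ch M2 s)) by (unfold Rdiv; ring).
    apply Rmult_le_compat_r; [assumption|]. apply Rmult_le_compat; assumption. }
  assert (X2 : Cmod (ph M1 s) * (Rabs n2 * Cmod (om M2 s)) <= 2 * (jap n1 * jap n2 * w1 * Cmod (om M2 s))).
  { replace (2 * (jap n1 * jap n2 * w1 * Cmod (om M2 s))) with ((2 * jap n1 * w1) * (jap n2 * Cmod (om M2 s))) by ring.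
    apply Rmult_le_compat; try assumption; [now apply Rmult_le_pos|]. now apply Rmult_le_compat_r. }
  lra.
Qed.

(** [9 = 8 + 1]: the [1 / k] of [psi] absorbs the [8 k] of [om_s], and [psi_s om_t] is bounded as it
    stands. *)
Lemma L1_nodeF : L1_le k (fun s => Cmod (nodeF e n1 n2 M1 M2 s)) (9 * (jap n1 * jap n2 * w1 * w2)).
Proof.
  destruct (good_continuous _ _ _ _ _ _ H2) as (C1 & C2 & _ & _).
  pose proof (good_nonneg _ _ _ _ _ _ H1) as W1.
  pose proof (jap_ge_1 n1) as J1. pose proof (jap_ge_1 n2) as J2.
  assert (Q0 : 0 <= jap n1 * w1 / k) by (apply Rmult_le_pos; [nra|left; apply Rinv_0_lt_compat; lra]).
  assert (Q1 : 0 <= jap n1 * jap n2 * w1) by (apply Rmult_le_pos; [nra|lra]).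
  apply L1_le_mono with (fun s => jap n1 * w1 / k * Cmod (ch M2 s) + jap n1 * jap n2 * w1 * Cmod (om M2 s)).
  - apply continuous_Cmod, nodeF_continuous.
  - intros s. apply continuous_Rplus;
    apply continuous_Rscal; now apply continuous_Cmod.
  - intros s Hs; now apply nodeF_le.
  - apply L1_le_weaken with (jap n1 * w1 / k * (8 * k * jap n2 * w2) + jap n1 * jap n2 * w1 * w2).
    + right. field. lra.
    + apply L1_le_plus.
      * intros s; apply continuous_Rscal; now apply continuous_Cmod.
      * intros s; apply continuous_Rscal; now apply continuous_Cmod.
      * apply L1_le_scal; [assumption|now apply continuous_Cmod|apply (g_L1ch H2)].
      * apply L1_le_scal; [assumption|now apply continuous_Cmod|apply (g_L1om H2)].
Qed.

Lemma nodeA_le s : 0 <= s -> Cmod (nodeA e n1 M1 M2 s) <= jap n1 * w1 / k * Cmod (om M2 s).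
Proof.
  intros Hs. unfold nodeA. rewrite !Cmod_mult, Cmod_half, Cmod_cj, Cmod_Ci, Cmod_R, Rmult_1_l.
  pose proof (g_psle H1 s Hs) as E1.
  pose proof (good_nonneg _ _ _ _ _ _ H1) as W1.
  pose proof (exp_le_compat (- s) 0 ltac:(lra)) as He. rewrite exp_0 in He.
  assert (Hq : 0 <= 2 * w1 / k) by (apply Rmult_le_pos; [lra|left; apply Rinv_0_lt_compat; lra]).
  assert (E1' : Cmod (ps M1 s) <= 2 * w1 / k) by nra.
  apply Rmult_le_compat_r; [apply Cmod_ge_0|].
  replace (jap n1 * w1 / k) with (/ 2 * (jap n1 * (2 * w1 / k))) by (field; lra).
  apply Rmult_le_compat_l; [lra|]. apply Rmult_le_compat; try assumption; [apply Rabs_pos|apply Cmod_ge_0|apply jap_Rabs].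
Qed.

(** The [1 / k] of [psi] is kept here, since mode [0] relies on it to complete its gain to
    [1 / lambda]. *)
Lemma L1_nodeA : L1_le k (fun s => Cmod (nodeA e n1 M1 M2 s)) (jap n1 * w1 / k * w2).
Proof.
  destruct (good_continuous _ _ _ _ _ _ H2) as (C1 & C2 & _ & _).
  pose proof (good_nonneg _ _ _ _ _ _ H1) as W1. pose proof (jap_ge_1 n1) as J1.
  apply L1_le_mono with (fun s => jap n1 * w1 / k * Cmod (om M2 s)).
  - apply continuous_Cmod, nodeA_continuous.
  - intros s; apply continuous_Rscal; now apply continuous_Cmod.
  - intros s Hs; now apply nodeA_le.
  - apply L1_le_scal; [|now apply continuous_Cmod|apply (g_L1om H2)].
    apply Rmult_le_pos; [nra|left; apply Rinv_0_lt_compat; lra].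
Qed.

Lemma nodeG_le s : 0 <= s -> Cmod (nodeG e M1 M2 s) <= jap n1 * w1 * Cmod (om M2 s).
Proof.
  intros Hs. unfold nodeG. rewrite !Cmod_mult, Cmod_half, Cmod_cj.
  pose proof (g_phle H1 s Hs) as E2.
  apply Rmult_le_compat_r; [apply Cmod_ge_0|]. lra.
Qed.

Lemma L1_nodeG : L1_le 0 (fun s => Cmod (nodeG e M1 M2 s)) (jap n1 * w1 * w2).
Proof.
  destruct (good_continuous _ _ _ _ _ _ H2) as (C1 & C2 & _ & _).
  pose proof (good_nonneg _ _ _ _ _ _ H1) as W1. pose proof (jap_ge_1 n1) as J1.
  apply (L1_le_rate k); [lra|apply continuous_Cmod, nodeG_continuous|intros; apply Cmod_ge_0|].
  apply L1_le_mono with (fun s => jap n1 * w1 * Cmod (om M2 s)).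
  - apply continuous_Cmod, nodeG_continuous.
  - intros s; apply continuous_Rscal; now apply continuous_Cmod.
  - intros s Hs; now apply nodeG_le.
  - apply L1_le_scal; [nra|now apply continuous_Cmod|apply (g_L1om H2)].
Qed.

End NodeEstimates.

Lemma L1_le_0 k : L1_le k (fun _ => Cmod 0) 0.
Proof.
  intros S HS. rewrite (RInt_ext _ (fun _ => 0)).
  - rewrite RInt_const. unfold scal; simpl; unfold mult; simpl; lra.
  - intros; rewrite Cmod_0; apply Rmult_0_r.
Qed.

Lemma sol_good k bd t : 4 <= k ->
  good k (fr t) (bdry bd t) (srcA k bd t) (srcG k bd t) (wt k bd t) (sol k bd t).
Proof.
  intros Hk. induction t as [n|e t1 IH1 t2 IH2].
  - assert (Ew : wt k bd (Leaf n) = 5 * Cmod (bd n)).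
    { unfold wt; simpl. unfold fr; simpl. rewrite <- INR_IZR_INZ. pose proof (jap_ge_1 (INR n)).
      field; lra. }
    assert (Hz : (0 * 1 : R) = 0) by ring.
    pose proof (Cmod_ge_0 (bd n)).
    rewrite Ew. simpl.
    destruct (Z.eq_dec (Z.of_nat n) 0) as [E|E].
    + unfold fr; simpl idx. rewrite E. apply build_good_zero with 0; try assumption; try apply Ccontinuous_const.
      * intros; apply Cderive_const.
      * apply L1_le_0.
      * unfold Rdiv; lra.
    + apply build_good_nonzero with 0; try assumption; try apply Ccontinuous_const.
      * intros; eapply Cderive_eq; [apply Cderive_const|]. ring.
      * apply L1_le_0.
      * unfold Rdiv; rewrite Rmult_0_r, Rmult_0_l; lra.
  - pose proof (wt_nonneg k bd t1 Hk) as W1. pose proof (wt_nonneg k bd t2 Hk) as W2.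
    pose proof (jap_ge_1 (fr t1)) as J1. pose proof (jap_ge_1 (fr t2)) as J2.
    pose proof (jap_ge_1 (fr (Node e t1 t2))) as J. pose proof (jap_fr_Node e t1 t2) as JJ.
    assert (Hl : 256 <= lam k) by (unfold lam; nra).
    set (w1 := wt k bd t1) in *. set (w2 := wt k bd t2) in *.
    set (j1 := jap (fr t1)) in *. set (j2 := jap (fr t2)) in *. set (j := jap (fr (Node e t1 t2))) in *.
    assert (Hw12 : 0 <= w1 * w2) by now apply Rmult_le_pos.
    (* [432 = 48 * 9]. Of the three powers of [jap] in [size], one matches the estimate exactly, and
       [j <= j1 * j2] disposes of the other two. *)
    assert (Hw : 432 * (j1 * j2 * w1 * w2) / (lam k * j) <= wt k bd (Node e t1 t2)).
    { unfold wt; fold j. cbn [size]. rewrite !size_wt. fold w1 w2 j1 j2.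
      apply (Rmult_le_reg_r (lam k * j ^ 3)); [apply Rmult_lt_0_compat; [lra|apply pow_lt; lra]|].
      replace (432 * (j1 * j2 * w1 * w2) / (lam k * j) * (lam k * j ^ 3)) with (432 * (w1 * w2) * (j1 * j2) * j ^ 2) by (field; lra).
      replace (432 / lam k * (w1 * j1 ^ 3) * (w2 * j2 ^ 3) / j ^ 3 * (lam k * j ^ 3)) with (432 * (w1 * w2) * (j1 * j2) * (j1 * j2) ^ 2) by (field; lra).
      apply Rmult_le_compat_l; [|apply pow_incr; lra].
      apply Rmult_le_pos; nra. }
    change (good k (fr (Node e t1 t2)) 0 (nodeA e (fr t1) (sol k bd t1) (sol k bd t2)) (nodeG e (sol k bd t1) (sol k bd t2))
       (wt k bd (Node e t1 t2)) (build k (idx (Node e t1 t2)) (nodeA e (fr t1) (sol k bd t1) (sol k bd t2))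
        (nodeF e (fr t1) (fr t2) (sol k bd t1) (sol k bd t2)) (nodeG e (sol k bd t1) (sol k bd t2)) 0%C)).
    assert (HA := fun s => Cderive_nodeA _ _ (fr t2) _ _ _ _ _ _ _ _ _ _ e IH1 IH2 s).
    rewrite <- fr_Node in HA.
    destruct (Z.eq_dec (idx (Node e t1 t2)) 0) as [E|E].
    + assert (Ef : fr (Node e t1 t2) = 0) by (unfold fr; now rewrite E).
      rewrite Ef, E. apply build_good_zero with (j1 * w1 / k * w2); try assumption.
      * eapply nodeA_continuous; eassumption.
      * eapply nodeG_continuous; eassumption.
      * intros s. specialize (HA s). rewrite Ef in HA. eapply Cderive_eq; [exact HA|]. ring.
      * eapply L1_nodeA; eassumption.
      * rewrite Cmod_0, Rplus_0_r. eapply Rle_trans; [|exact Hw].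
        assert (Ej : j = 1) by (unfold j; rewrite Ef; unfold jap; rewrite Rabs_R0; ring).
        (* [2 / k^2 = 32 / lam], well below [432 / lam]: mode [0] fits under the same constant. *)
        rewrite Ej. replace (2 * (j1 * w1 / k * w2) / k) with (32 * (j1 * (w1 * w2)) / lam k) by (unfold lam; field; lra).
        replace (432 * (j1 * j2 * w1 * w2) / (lam k * 1)) with (432 * (j1 * (w1 * w2)) * j2 / lam k) by (field; lra).
        apply Rmult_le_compat_r; [left; apply Rinv_0_lt_compat; lra|].
        assert (0 <= j1 * (w1 * w2)) by nra. nra.
    + apply build_good_nonzero with (9 * (j1 * j2 * w1 * w2)); try assumption.
      * eapply nodeA_continuous; eassumption.
      * eapply nodeF_continuous; eassumption.
      * eapply nodeG_continuous; eassumption.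
      * eapply L1_nodeF; eassumption.
      * rewrite Cmod_0, Rmult_0_r, Rplus_0_r. eapply Rle_trans; [|exact Hw].
        right. unfold j, fr. field. fold (fr (Node e t1 t2)); fold j; lra.
Qed.

(** * Series over trees *)

(* Sum over the trees of depth at most [j] whose leaves are labelled by [n < j]. *)
Fixpoint Tsum (j : nat) (g : tree -> R) : R :=
  match j with
  | O => 0
  | S i => sum_f_R0 (fun n => g (Leaf n)) i +
           Tsum i (fun t1 => Tsum i (fun t2 => g (Node true t1 t2) + g (Node false t1 t2)))
  end.

Lemma Tsum_ext j : forall g h, (forall t, g t = h t) -> Tsum j g = Tsum j h.
Proof.
  induction j as [|j IH]; intros g h H; simpl; [reflexivity|]. f_equal.
  - apply sum_eq; intros; apply H.
  - apply IH; intros; apply IH; intros; now rewrite !H.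
Qed.

Lemma Tsum_plus j : forall g h, Tsum j (fun t => g t + h t) = Tsum j g + Tsum j h.
Proof.
  induction j as [|j IH]; intros g h; simpl; [ring|].
  rewrite plus_sum.
  rewrite (Tsum_ext j _ (fun t1 => Tsum j (fun t2 => g (Node true t1 t2) + g (Node false t1 t2)) +
                                   Tsum j (fun t2 => h (Node true t1 t2) + h (Node false t1 t2)))).
  - rewrite IH. ring.
  - intros t1. rewrite <- IH. apply Tsum_ext; intros; ring.
Qed.

Lemma Tsum_scal j : forall c g, Tsum j (fun t => c * g t) = c * Tsum j g.
Proof.
  induction j as [|j IH]; intros c g; simpl; [ring|].
  rewrite Rmult_plus_distr_l. f_equal.
  - rewrite scal_sum. apply sum_eq; intros; ring.
  - rewrite <- IH. apply Tsum_ext; intros t1. rewrite <- IH. apply Tsum_ext; intros; ring.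
Qed.

Lemma Tsum_le j : forall g h, (forall t, g t <= h t) -> Tsum j g <= Tsum j h.
Proof.
  induction j as [|j IH]; intros g h H; simpl; [lra|]. apply Rplus_le_compat.
  - apply sum_Rle; intros; apply H.
  - apply IH; intros; apply IH; intros; apply Rplus_le_compat; apply H.
Qed.

Lemma Tsum_zero j : Tsum j (fun _ => 0) = 0.
Proof.
  rewrite (Tsum_ext j _ (fun t => 0 * 0)) by (intros; ring). rewrite Tsum_scal; ring.
Qed.

Lemma Tsum_nonneg j g : (forall t, 0 <= g t) -> 0 <= Tsum j g.
Proof. intros H. rewrite <- (Tsum_zero j). now apply Tsum_le. Qed.

Lemma Tsum_abs j g h : (forall t, Rabs (g t) <= h t) -> Rabs (Tsum j g) <= Tsum j h.
Proof.
  intros H. apply Rabs_le. split.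
  - replace (- Tsum j h) with (-1 * Tsum j h) by ring. rewrite <- Tsum_scal. apply Tsum_le.
    intros t. specialize (H t). apply Rabs_le_between in H. lra.
  - apply Tsum_le. intros t. specialize (H t). apply Rabs_le_between in H. lra.
Qed.

Lemma Tsum_S_le j : forall g, (forall t, 0 <= g t) -> Tsum j g <= Tsum (S j) g.
Proof.
  induction j as [|j IH]; intros g H.
  - simpl. pose proof (H (Leaf 0)). lra.
  - change (Tsum (S (S j)) g) with (sum_f_R0 (fun n => g (Leaf n)) (S j) +
       Tsum (S j) (fun t1 => Tsum (S j) (fun t2 => g (Node true t1 t2) + g (Node false t1 t2)))).
    change (Tsum (S j) g) with (sum_f_R0 (fun n => g (Leaf n)) j +
       Tsum j (fun t1 => Tsum j (fun t2 => g (Node true t1 t2) + g (Node false t1 t2)))).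
    assert (Hp : forall t1 t2, 0 <= g (Node true t1 t2) + g (Node false t1 t2)).
    { intros; pose proof (H (Node true t1 t2)); pose proof (H (Node false t1 t2)); lra. }
    apply Rplus_le_compat.
    + simpl. pose proof (H (Leaf (S j))). lra.
    + eapply Rle_trans; [apply IH|].
      * intros; now apply Tsum_nonneg.
      * apply Tsum_le; intros; now apply IH.
Qed.

Lemma Tsum_mono i j g : (forall t, 0 <= g t) -> (i <= j)%nat -> Tsum i g <= Tsum j g.
Proof.
  intros H Hij; induction Hij; [lra|]. eapply Rle_trans; [exact IHHij|now apply Tsum_S_le].
Qed.

(** Monotonicity in the depth, applied to the nonnegative families [h + g] and [h - g]. *)
Lemma Tsum_diff_le i j g h :
  (forall t, Rabs (g t) <= h t) -> (i <= j)%nat ->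
  Rabs (Tsum j g - Tsum i g) <= Tsum j h - Tsum i h.
Proof.
  intros H Hij.
  assert (E1 : Tsum i (fun t => h t + g t) <= Tsum j (fun t => h t + g t)).
  { apply Tsum_mono; [|assumption]. intros t; specialize (H t); apply Rabs_le_between in H; lra. }
  assert (E2 : Tsum i (fun t => h t + -1 * g t) <= Tsum j (fun t => h t + -1 * g t)).
  { apply Tsum_mono; [|assumption]. intros t; specialize (H t); apply Rabs_le_between in H; lra. }
  rewrite !Tsum_plus in E1, E2. rewrite !Tsum_scal in E2. apply Rabs_le; lra.
Qed.

Lemma Tsum_prod j i g h : Tsum j (fun t1 => Tsum i (fun t2 => g t1 * h t2)) = Tsum j g * Tsum i h.
Proof.
  rewrite (Tsum_ext j _ (fun t1 => Tsum i h * g t1)).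
  - rewrite Tsum_scal; ring.
  - intros; rewrite Tsum_scal; ring.
Qed.

Lemma is_derive_sum_f_R0 (g : nat -> R -> R) (g' : nat -> R) x j :
  (forall n, is_derive (g n) x (g' n)) ->
  is_derive (fun y => sum_f_R0 (fun n => g n y) j) x (sum_f_R0 g' j).
Proof.
  intros H; induction j as [|j IH]; simpl; [apply H|].
  now apply is_derive_Rplus.
Qed.

Lemma is_derive_Tsum j : forall (g : tree -> R -> R) (g' : tree -> R) x,
  (forall t, is_derive (g t) x (g' t)) ->
  is_derive (fun y => Tsum j (fun t => g t y)) x (Tsum j g').
Proof.
  induction j as [|j IH]; intros g g' x H; simpl; [apply is_derive_Rconst|].
  apply is_derive_Rplus.
  - apply (is_derive_sum_f_R0 (fun n => g (Leaf n))). intros; apply H.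
  - apply (IH (fun t1 y => Tsum j (fun t2 => g (Node true t1 t2) y + g (Node false t1 t2) y))).
    intros t1. apply (IH (fun t2 y => g (Node true t1 t2) y + g (Node false t1 t2) y)).
    intros t2. apply is_derive_Rplus; apply H.
Qed.

Lemma continuous_Tsum {U : UniformSpace} j : forall (g : tree -> U -> R) x,
  (forall t, continuous (g t) x) -> continuous (fun y => Tsum j (fun t => g t y)) x.
Proof.
  induction j as [|j IH]; intros g x H; simpl; [apply continuous_const|].
  apply continuous_Rplus.
  - clear IH. induction j as [|j IH]; simpl; [apply H|].
    apply continuous_Rplus; [exact IH|apply H].
  - apply (IH (fun t1 y => Tsum j (fun t2 => g (Node true t1 t2) y + g (Node false t1 t2) y))).
    intros t1. apply (IH (fun t2 y => g (Node true t1 t2) y + g (Node false t1 t2) y)).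
    intros t2. apply continuous_Rplus; apply H.
Qed.

(** Truncation by depth gives an ordinary sequence of partial sums, in place of an unordered sum
    over trees. [real] supplies a default when there is no finite limit; domination by [N] excludes
    that case. *)
Definition Tseries (g : tree -> R) : R := real (Lim_seq (fun j => Tsum j g)).

Section Dominated.

Context (N : tree -> R) (XM : R).
Context (N0 : forall t, 0 <= N t) (HX : forall j, Tsum j N <= XM).

Definition tail (j : nat) : R := Tseries N - Tsum j N.

Lemma Tseries_N_lim : is_lim_seq (fun j => Tsum j N) (Tseries N).
Proof.
  apply Lim_seq_correct'. apply ex_finite_lim_seq_incr with XM; [|exact HX].
  intros; now apply Tsum_S_le.
Qed.

Lemma tail_lim : is_lim_seq tail 0.
Proof.
  unfold tail. replace (Finite 0) with (Finite (Tseries N - Tseries N)) by (f_equal; ring).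
  apply is_lim_seq_minus'; [apply is_lim_seq_const|apply Tseries_N_lim].
Qed.

Lemma Tseries_lim g B : (forall t, Rabs (g t) <= B * N t) ->
  is_lim_seq (fun j => Tsum j g) (Tseries g).
Proof.
  intros H. apply Lim_seq_correct', ex_lim_seq_cauchy_corr. intros eps.
  assert (HBN : forall t, Rabs (g t) <= Rabs B * N t).
  { intros t; eapply Rle_trans; [apply H|]. apply Rmult_le_compat_r; [apply N0|apply Rle_abs]. }
  assert (E : 0 < eps / (Rabs B + 1)).
  { apply Rdiv_lt_0_compat; [apply cond_pos|pose proof (Rabs_pos B); lra]. }
  destruct (proj1 (ex_lim_seq_cauchy_corr _) (ex_intro (fun l : R => is_lim_seq _ l) _ Tseries_N_lim)
     (mkposreal _ E)) as [J HJ].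
  exists J.
  assert (W : forall n m, (J <= n)%nat -> (n <= m)%nat -> Rabs (Tsum m g - Tsum n g) < eps).
  { intros n m Hn Hm. eapply Rle_lt_trans; [now apply Tsum_diff_le with (h := fun t => Rabs B * N t)|].
    rewrite !Tsum_scal. specialize (HJ m n ltac:(lia) Hn). simpl in HJ.
    pose proof (Rabs_pos B) as B0. pose proof (Rle_abs (Tsum m N - Tsum n N)).
    replace (pos eps) with ((Rabs B + 1) * (eps / (Rabs B + 1))) by (field; lra).
    assert (0 <= Tsum m N - Tsum n N) by (pose proof (Tsum_mono n m N N0 Hm); lra). nra. }
  intros n m Hn Hm. destruct (Nat.le_ge_cases n m) as [E'|E'].
  - rewrite Rabs_minus_sym. now apply W.
  - now apply W.
Qed.

Lemma Tseries_tail g B j : (forall t, Rabs (g t) <= B * N t) ->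
  Rabs (Tseries g - Tsum j g) <= B * tail j.
Proof.
  intros H.
  apply (is_lim_seq_le_loc (fun i => Rabs (Tsum i g - Tsum j g)) (fun i => B * (Tsum i N - Tsum j N))
     (Rabs (Tseries g - Tsum j g)) (B * tail j)).
  - exists j; intros i Hi. rewrite Rmult_minus_distr_l, <- !Tsum_scal. now apply Tsum_diff_le.
  - apply (is_lim_seq_abs _ (Tseries g - Tsum j g)).
    apply is_lim_seq_minus'; [now apply Tseries_lim with B|apply is_lim_seq_const].
  - apply (is_lim_seq_scal_l _ B (tail j)).
    apply is_lim_seq_minus'; [apply Tseries_N_lim|apply is_lim_seq_const].
Qed.

Lemma Tseries_abs_le g B c : (forall t, Rabs (g t) <= B * N t) -> (forall t, Rabs (g t) <= c * N t) ->
  0 <= c -> Rabs (Tseries g) <= c * XM.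
Proof.
  intros HB H Hc.
  apply (is_lim_seq_le (fun j => Rabs (Tsum j g)) (fun _ => c * XM) (Rabs (Tseries g)) (c * XM)).
  - intros j. eapply Rle_trans; [apply Tsum_abs, H|]. rewrite Tsum_scal. now apply Rmult_le_compat_l.
  - apply (is_lim_seq_abs _ (Tseries g)). now apply Tseries_lim with B.
  - apply is_lim_seq_const.
Qed.

Lemma Tseries_unique g (l : R) : is_lim_seq (fun j => Tsum j g) l -> Tseries g = l.
Proof. intros H; unfold Tseries; now rewrite (is_lim_seq_unique _ _ H). Qed.

Lemma Tseries_ext g h : (forall t, g t = h t) -> Tseries g = Tseries h.
Proof. intros H; unfold Tseries; f_equal. apply Lim_seq_ext; intros; now apply Tsum_ext. Qed.

Lemma Tseries_comb g h B B' a c :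
  (forall t, Rabs (g t) <= B * N t) -> (forall t, Rabs (h t) <= B' * N t) ->
  Tseries (fun t => a * g t + c * h t) = a * Tseries g + c * Tseries h.
Proof.
  intros Hg Hh. apply Tseries_unique.
  apply is_lim_seq_ext with (fun j => a * Tsum j g + c * Tsum j h);
    [intros j; now rewrite Tsum_plus, !Tsum_scal|].
  apply is_lim_seq_plus'.
  - apply (is_lim_seq_scal_l _ a (Tseries g)). now apply Tseries_lim with B.
  - apply (is_lim_seq_scal_l _ c (Tseries h)). now apply Tseries_lim with B'.
Qed.

(** Truncation by depth makes the product exact at every stage: at depth [j + 1] the nodes
    contribute precisely the product of the two sums of depth [j]. Nothing is rearranged, and the
    shift of index disappears in the limit. *)
Lemma Tseries_Node g h q B B' :
  (forall t, Rabs (g t) <= B * N t) -> (forall t, Rabs (h t) <= B' * N t) ->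
  (forall n, q (Leaf n) = 0) ->
  (forall t1 t2, q (Node true t1 t2) + q (Node false t1 t2) = g t1 * h t2) ->
  Tseries q = Tseries g * Tseries h.
Proof.
  intros Hg Hh Hl Hn. apply Tseries_unique, is_lim_seq_incr_1.
  apply (is_lim_seq_ext (fun j => Tsum j g * Tsum j h)).
  - intros j. simpl. rewrite (sum_eq _ (fun _ => 0)) by (intros; apply Hl).
    rewrite sum_cte, Rmult_0_l, Rplus_0_l, <- Tsum_prod.
    apply Tsum_ext; intros; apply Tsum_ext; intros; now rewrite Hn.
  - apply is_lim_seq_mult'; [now apply Tseries_lim with B|now apply Tseries_lim with B'].
Qed.

(** Weierstrass test in terms of [tail]. Continuity is relative to [D]: the closed exterior domain,
    taken for [D], yields the boundary values. *)
Lemma uniform_limit_continuous {U : UniformSpace} (g : tree -> U -> R) (D : U -> Prop) (B : R) (x : U) :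
  (forall t, continuous (g t) x) -> D x -> (forall t y, D y -> Rabs (g t y) <= B * N t) ->
  filterlim (fun y => Tseries (fun t => g t y)) (within D (locally x)) (locally (Tseries (fun t => g t x))).
Proof.
  intros Hc Dx Hb P [eps HP].
  assert (He : 0 < eps / 4 / (Rabs B + 1)).
  { apply Rdiv_lt_0_compat; [pose proof (cond_pos eps); lra|pose proof (Rabs_pos B); lra]. }
  destruct (proj2 (is_lim_seq_spec tail 0) tail_lim (mkposreal _ He)) as [j Hj].
  specialize (Hj j (Nat.le_refl j)). simpl in Hj. rewrite Rminus_0_r in Hj.
  assert (Ht : Rabs (B * tail j) <= eps / 4).
  { rewrite Rabs_mult. replace (eps / 4) with ((Rabs B + 1) * (eps / 4 / (Rabs B + 1))).
    - apply Rmult_le_compat; try apply Rabs_pos; [lra|left; exact Hj].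
    - field. pose proof (Rabs_pos B); lra. }
  pose proof (Rle_abs (B * tail j)) as Ht'.
  assert (H4 : 0 < eps / 4) by (pose proof (cond_pos eps); lra).
  pose proof (continuous_Tsum j g x Hc) as Hcj.
  specialize (Hcj _ (locally_ball (Tsum j (fun t => g t x)) (mkposreal _ H4))).
  unfold filtermap in *. unfold within.
  revert Hcj; apply filter_imp. intros y Hy Dy. apply HP.
  change (Rabs (Tsum j (fun t => g t y) - Tsum j (fun t => g t x)) < eps / 4) in Hy.
  change (Rabs (Tseries (fun t => g t y) - Tseries (fun t => g t x)) < eps).
  pose proof (Tseries_tail (fun t => g t x) B j (fun t => Hb t x Dx)) as E1.
  pose proof (Tseries_tail (fun t => g t y) B j (fun t => Hb t y Dy)) as E2.
  apply Rabs_le_between in E1, E2. apply Rabs_lt_between in Hy. apply Rabs_lt_between. lra.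
Qed.

(** Termwise differentiation: the majorant makes the differentiated sums converge uniformly on the
    ball of radius [r]. *)
Lemma is_derive_Tseries (g : tree -> R -> R) (g' : tree -> R -> R) (B x r : R) :
  0 < r ->
  (forall t y, Rabs (y - x) < r -> is_derive (g t) y (g' t y)) ->
  (forall t y, Rabs (y - x) < r -> Rabs (g t y) <= B * N t /\ Rabs (g' t y) <= B * N t) ->
  (forall t y, Rabs (y - x) < r -> continuous (g' t) y) ->
  is_derive (fun y => Tseries (fun t => g t y)) x (Tseries (fun t => g' t x)).
Proof.
  intros Hr Hd Hb Hc'. apply is_derive_Reals.
  apply (derivable_pt_lim_CVU (fun j y => Tsum j (fun t => g t y)) (fun j y => Tsum j (fun t => g' t y))
    _ (fun y => Tseries (fun t => g' t y)) x x (mkposreal r Hr)).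
  - unfold Boule; simpl. rewrite Rminus_diag, Rabs_R0. exact Hr.
  - intros y n Hy. apply is_derive_Reals, is_derive_Tsum. intros t; now apply Hd.
  - intros y Hy. apply is_lim_seq_Reals, Tseries_lim with B. intros t; now apply Hb.
  - intros eps Heps.
    assert (He : 0 < eps / (Rabs B + 1)) by (apply Rdiv_lt_0_compat; [exact Heps|pose proof (Rabs_pos B); lra]).
    destruct (proj2 (is_lim_seq_spec tail 0) tail_lim (mkposreal _ He)) as [j Hj].
    exists j. intros i y Hi Hy. specialize (Hj i Hi). simpl in Hj. rewrite Rminus_0_r in Hj.
    eapply Rle_lt_trans; [apply Tseries_tail with (B := B); intros t; now apply Hb|].
    pose proof (Rle_abs (B * tail i)) as H. rewrite Rabs_mult in H.
    replace eps with ((Rabs B + 1) * (eps / (Rabs B + 1))) by (field; pose proof (Rabs_pos B); lra).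
    pose proof (Rabs_pos B). pose proof (Rabs_pos (tail i)). nra.
  - intros y Hy. apply continuity_pt_filterlim.
    pose proof (uniform_limit_continuous g' (fun z => Rabs (z - x) < r) B y (fun t => Hc' t y Hy) Hy (fun t z Hz => proj2 (Hb t z Hz))) as F.
    intros P HP. specialize (F P HP). unfold filtermap, within in *.
    assert (L : locally y (fun z => Rabs (z - x) < r)).
    { unfold Boule in Hy; simpl in Hy. assert (Hp : 0 < r - Rabs (y - x)) by lra.
      exists (mkposreal _ Hp). intros z Hz. change (Rabs (z - y) < r - Rabs (y - x)) in Hz.
      replace (z - x) with ((z - y) + (y - x)) by ring. eapply Rle_lt_trans; [apply Rabs_triang|]. lra. }
    generalize (filter_and _ _ F L). apply filter_imp. intros z [Hz1 Hz2]; now apply Hz1.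
Qed.

End Dominated.

(** * Fields on the exterior domain *)

Definition lnr (x y : R) : R := / 2 * ln (x ^ 2 + y ^ 2).
Definition unit_at (x y : R) : C := (x / sqrt (x ^ 2 + y ^ 2), y / sqrt (x ^ 2 + y ^ 2)).

(* [ang t] is [exp (i * fr t * theta)] in Cartesian coordinates, free of any choice of the angle. *)
Fixpoint ang (t : tree) (x y : R) : C :=
  match t with
  | Leaf n => (unit_at x y ^ n)%C
  | Node e t1 t2 => (ang t1 x y * cj e (ang t2 x y))%C
  end.

Lemma lnr_nonneg x y : exterior_closed x y -> 0 <= lnr x y.
Proof.
  unfold exterior_closed, lnr. intros H. apply Rmult_le_pos; [lra|].
  rewrite <- ln_1. apply ln_le; lra.
Qed.

Lemma Cmod_unit_at x y : 0 < x ^ 2 + y ^ 2 -> Cmod (unit_at x y) = 1.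
Proof.
  intros H. unfold Cmod, unit_at; cbn [fst snd].
  set (r := sqrt (x ^ 2 + y ^ 2)).
  assert (Hr : 0 < r) by now apply sqrt_lt_R0.
  assert (E : r ^ 2 = x ^ 2 + y ^ 2) by (apply pow2_sqrt; lra).
  replace ((x / r) ^ 2 + (y / r) ^ 2) with 1; [apply sqrt_1|].
  replace ((x / r) ^ 2 + (y / r) ^ 2) with ((x ^ 2 + y ^ 2) / r ^ 2) by (field; lra).
  rewrite <- E; field; lra.
Qed.

Lemma Cmod_ang t x y : 0 < x ^ 2 + y ^ 2 -> Cmod (ang t x y) = 1.
Proof.
  intros H; induction t as [n|e t1 IH1 t2 IH2]; cbn [ang].
  - rewrite Cmod_pow, Cmod_unit_at by assumption. apply pow1.
  - rewrite Cmod_mult, Cmod_cj, IH1, IH2; ring.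
Qed.

Lemma is_derive_radius x c : 0 < x ^ 2 + c ->
  is_derive (fun z => sqrt (z ^ 2 + c)) x (x / sqrt (x ^ 2 + c)).
Proof.
  intros H. assert (0 < sqrt (x ^ 2 + c)) by now apply sqrt_lt_R0.
  auto_derive; [simpl in H |- *; lra|]. replace (x * (x * 1)) with (x ^ 2) by ring. field; lra.
Qed.

Lemma is_derive_coord_div x c : 0 < x ^ 2 + c ->
  is_derive (fun z => z / sqrt (z ^ 2 + c)) x (c / (sqrt (x ^ 2 + c) * (x ^ 2 + c))).
Proof.
  intros H. assert (Hr : 0 < sqrt (x ^ 2 + c)) by now apply sqrt_lt_R0.
  assert (E : sqrt (x ^ 2 + c) ^ 2 = x ^ 2 + c) by (apply pow2_sqrt; lra).
  pose proof (is_derive_div (fun z => z) (fun z => sqrt (z ^ 2 + c)) x 1 _ (is_derive_id x) (is_derive_radius x c H) ltac:(lra)) as D.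
  replace (c / (sqrt (x ^ 2 + c) * (x ^ 2 + c))) with
    ((1 * sqrt (x ^ 2 + c) - x * (x / sqrt (x ^ 2 + c))) / sqrt (x ^ 2 + c) ^ 2); [exact D|].
  set (r := sqrt (x ^ 2 + c)) in *. rewrite <- E.
  replace c with (r ^ 2 - x ^ 2) by lra. field; lra.
Qed.

Lemma is_derive_const_div a x c : 0 < x ^ 2 + c ->
  is_derive (fun z => a / sqrt (z ^ 2 + c)) x (- a * x / (sqrt (x ^ 2 + c) * (x ^ 2 + c))).
Proof.
  intros H. assert (Hr : 0 < sqrt (x ^ 2 + c)) by now apply sqrt_lt_R0.
  assert (E : sqrt (x ^ 2 + c) ^ 2 = x ^ 2 + c) by (apply pow2_sqrt; lra).
  pose proof (is_derive_div (fun z => a) (fun z => sqrt (z ^ 2 + c)) x 0 _ (is_derive_Rconst a x) (is_derive_radius x c H) ltac:(lra)) as D.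
  replace (- a * x / (sqrt (x ^ 2 + c) * (x ^ 2 + c))) with
    ((0 * sqrt (x ^ 2 + c) - a * (x / sqrt (x ^ 2 + c))) / sqrt (x ^ 2 + c) ^ 2); [exact D|].
  set (r := sqrt (x ^ 2 + c)) in *. rewrite <- E. field; lra.
Qed.

Lemma Cderive_unit_at_x x y : 0 < x ^ 2 + y ^ 2 ->
  Cderive (fun z => unit_at z y) x (- (Ci * RtoC (y / (x ^ 2 + y ^ 2))) * unit_at x y)%C.
Proof.
  intros H. assert (Hr : 0 < sqrt (x ^ 2 + y ^ 2)) by now apply sqrt_lt_R0.
  split; unfold unit_at.
  - eapply is_derive_ext; [reflexivity|].
    match goal with |- is_derive _ _ ?l => replace l with (y ^ 2 / (sqrt (x ^ 2 + y ^ 2) * (x ^ 2 + y ^ 2))) end.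
    + now apply is_derive_coord_div.
    + unfold Re; cbn -[sqrt pow]. field; lra.
  - eapply is_derive_ext; [reflexivity|].
    match goal with |- is_derive _ _ ?l => replace l with (- y * x / (sqrt (x ^ 2 + y ^ 2) * (x ^ 2 + y ^ 2))) end.
    + now apply is_derive_const_div.
    + unfold Im; cbn -[sqrt pow]. field; lra.
Qed.

Lemma Cderive_unit_at_y x y : 0 < x ^ 2 + y ^ 2 ->
  Cderive (fun z => unit_at x z) y (Ci * RtoC (x / (x ^ 2 + y ^ 2)) * unit_at x y)%C.
Proof.
  intros H. assert (Hr : 0 < sqrt (x ^ 2 + y ^ 2)) by now apply sqrt_lt_R0.
  assert (E : x ^ 2 + y ^ 2 = y ^ 2 + x ^ 2) by ring.
  split; unfold unit_at.
  - apply is_derive_ext with (fun z => x / sqrt (z ^ 2 + x ^ 2)); [intros; unfold Re; cbn [fst]; now rewrite Rplus_comm|].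
    match goal with |- is_derive _ _ ?l => replace l with (- x * y / (sqrt (y ^ 2 + x ^ 2) * (y ^ 2 + x ^ 2))) end.
    + apply is_derive_const_div; lra.
    + unfold Re; cbn -[sqrt pow]. rewrite E in *. field; lra.
  - apply is_derive_ext with (fun z => z / sqrt (z ^ 2 + x ^ 2)); [intros; unfold Im; cbn [snd]; now rewrite Rplus_comm|].
    match goal with |- is_derive _ _ ?l => replace l with (x ^ 2 / (sqrt (y ^ 2 + x ^ 2) * (y ^ 2 + x ^ 2))) end.
    + apply is_derive_coord_div; lra.
    + unfold Im; cbn -[sqrt pow]. rewrite E in *. field; lra.
Qed.

Lemma Cderive_pow (f : R -> C) s (c : C) n :
  Cderive f s (c * f s)%C -> Cderive (fun t => f t ^ n)%C s (RtoC (INR n) * c * f s ^ n)%C.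
Proof.
  intros H; induction n as [|n IH].
  - simpl Cpow. eapply Cderive_eq; [apply Cderive_const|]. simpl INR. ring.
  - simpl Cpow. eapply Cderive_eq; [apply Cderive_mult; [exact H|exact IH]|].
    rewrite S_INR, RtoC_plus. ring.
Qed.

(** Stated for any family obeying the recursion of [ang], so that one induction serves both partial
    derivatives. *)
Lemma Cderive_ang (f : tree -> R -> C) s (c : R) t :
  (forall n, f (Leaf n) = fun z => (f (Leaf 1) z ^ n)%C) ->
  (forall e t1 t2, f (Node e t1 t2) = fun z => (f t1 z * cj e (f t2 z))%C) ->
  Cderive (f (Leaf 1)) s (Ci * RtoC c * f (Leaf 1) s)%C ->
  Cderive (f t) s (RtoC (fr t) * (Ci * RtoC c) * f t s)%C.
Proof.
  intros Hl Hn H; induction t as [n|e t1 IH1 t2 IH2].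
  - rewrite Hl. unfold fr; simpl idx. rewrite <- INR_IZR_INZ. now apply Cderive_pow.
  - rewrite Hn. eapply Cderive_eq; [apply Cderive_mult; [exact IH1|apply Cderive_cj, IH2]|].
    rewrite fr_Node. destruct e; simpl cj.
    + rewrite RtoC_plus; ring.
    + rewrite RtoC_minus, !Cmult_conj.
      replace (Cconj Ci) with (- Ci)%C by (apply C_ext; simpl; ring).
      replace (Cconj (RtoC (fr t2))) with (RtoC (fr t2)) by (apply C_ext; simpl; ring).
      replace (Cconj (RtoC c)) with (RtoC c) by (apply C_ext; simpl; ring). ring.
Qed.

Lemma ang_Leaf n x y : ang (Leaf n) x y = (ang (Leaf 1) x y ^ n)%C.
Proof. cbn [ang]. now rewrite Cpow_1_r. Qed.

Lemma Cderive_ang_x t x y : 0 < x ^ 2 + y ^ 2 ->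
  Cderive (fun z => ang t z y) x (RtoC (fr t) * (Ci * RtoC (- y / (x ^ 2 + y ^ 2))) * ang t x y)%C.
Proof.
  intros H. apply (Cderive_ang (fun t z => ang t z y)).
  - intros n. apply FunctionalExtensionality.functional_extensionality; intros z; apply ang_Leaf.
  - reflexivity.
  - cbn [ang]. rewrite Cpow_1_r. apply Cderive_ext with (fun z => unit_at z y).
    { intros z; now rewrite Cpow_1_r. }
    eapply Cderive_eq; [now apply Cderive_unit_at_x|].
    unfold Rdiv. rewrite <- Ropp_mult_distr_l, RtoC_opp. ring.
Qed.

Lemma Cderive_ang_y t x y : 0 < x ^ 2 + y ^ 2 ->
  Cderive (fun z => ang t x z) y (RtoC (fr t) * (Ci * RtoC (x / (x ^ 2 + y ^ 2))) * ang t x y)%C.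
Proof.
  intros H. apply (Cderive_ang (fun t z => ang t x z)).
  - intros n. apply FunctionalExtensionality.functional_extensionality; intros z; apply ang_Leaf.
  - reflexivity.
  - cbn [ang]. rewrite Cpow_1_r. apply Cderive_ext with (fun z => unit_at x z).
    { intros z; now rewrite Cpow_1_r. }
    now apply Cderive_unit_at_y.
Qed.

Lemma is_derive_lnr_x x y : 0 < x ^ 2 + y ^ 2 ->
  is_derive (fun z => lnr z y) x (x / (x ^ 2 + y ^ 2)).
Proof.
  intros H. unfold lnr. auto_derive; [simpl in H |- *; lra|].
  replace (x * (x * 1) + y * (y * 1)) with (x ^ 2 + y ^ 2) by ring. field; lra.
Qed.

Lemma is_derive_lnr_y x y : 0 < x ^ 2 + y ^ 2 ->
  is_derive (fun z => lnr x z) y (y / (x ^ 2 + y ^ 2)).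
Proof.
  intros H. unfold lnr. auto_derive; [simpl in H |- *; lra|].
  replace (x * (x * 1) + y * (y * 1)) with (x ^ 2 + y ^ 2) by ring. field; lra.
Qed.

Lemma Cderive_comp (g g' : R -> C) (h : R -> R) s l :
  Cderive g (h s) (g' (h s)) -> is_derive h s l -> Cderive (fun t => g (h t)) s (RtoC l * g' (h s))%C.
Proof.
  intros [H1 H2] Hh; split.
  - replace (Re (RtoC l * g' (h s))%C) with (scal l (Re (g' (h s)))).
    + now apply (is_derive_comp (V := R_NormedModule) (fun t => Re (g t)) h).
    + unfold scal, Re; simpl; unfold mult; simpl; ring.
  - replace (Im (RtoC l * g' (h s))%C) with (scal l (Im (g' (h s)))).
    + now apply (is_derive_comp (V := R_NormedModule) (fun t => Im (g t)) h).
    + unfold scal, Im; simpl; unfold mult; simpl; ring.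
Qed.

(** The real field [Re (g (ln r) * e^(i n theta))] of a tree of frequency [n]; [inth], defined next,
    is its angular derivative at the level of profiles. *)
Definition fld (g : R -> C) (t : tree) (x y : R) : R := Re (g (lnr x y) * ang t x y)%C.
Definition inth (g : tree -> R -> C) (t : tree) (s : R) : C := (Ci * RtoC (fr t) * g t s)%C.

Lemma is_derive_fld_x (g g' : tree -> R -> C) t x y : 0 < x ^ 2 + y ^ 2 ->
  (forall s, Cderive (g t) s (g' t s)) ->
  is_derive (fun z => fld (g t) t z y) x
    (x / (x ^ 2 + y ^ 2) * fld (g' t) t x y + - y / (x ^ 2 + y ^ 2) * fld (inth g t) t x y).
Proof.
  intros H Hg.
  pose proof (Cderive_mult _ _ _ _ _ (Cderive_comp (g t) (g' t) (fun z => lnr z y) x _ (Hg _) (is_derive_lnr_x x y H)) (Cderive_ang_x t x y H)) as [D _].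
  match goal with |- is_derive _ _ ?l => match type of D with is_derive _ _ ?l' => replace l with l' end end; [exact D|].
  unfold fld, inth, Re. cbn -[pow Rdiv ang lnr fr]. ring.
Qed.

Lemma is_derive_fld_y (g g' : tree -> R -> C) t x y : 0 < x ^ 2 + y ^ 2 ->
  (forall s, Cderive (g t) s (g' t s)) ->
  is_derive (fun z => fld (g t) t x z) y
    (y / (x ^ 2 + y ^ 2) * fld (g' t) t x y + x / (x ^ 2 + y ^ 2) * fld (inth g t) t x y).
Proof.
  intros H Hg.
  pose proof (Cderive_mult _ _ _ _ _ (Cderive_comp (g t) (g' t) (fun z => lnr x z) y _ (Hg _) (is_derive_lnr_y x y H)) (Cderive_ang_y t x y H)) as [D _].
  match goal with |- is_derive _ _ ?l => match type of D with is_derive _ _ ?l' => replace l with l' end end; [exact D|].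
  unfold fld, inth, Re. cbn -[pow Rdiv ang lnr fr]. ring.
Qed.

Lemma fld_le g t x y B : exterior_closed x y -> (forall s, 0 <= s -> Cmod (g s) <= B) ->
  Rabs (fld g t x y) <= B.
Proof.
  intros H Hg. unfold fld. eapply Rle_trans; [apply re_le_Cmod|].
  rewrite Cmod_mult, Cmod_ang by (unfold exterior_closed in H; lra). rewrite Rmult_1_r.
  now apply Hg, lnr_nonneg.
Qed.

Definition cont2 (g : R -> R -> R) (x y : R) : Prop :=
  continuous (fun z : R * R => g (fst z) (snd z)) (x, y).

Lemma cont2_x x y : cont2 (fun x _ => x) x y.
Proof. apply (continuous_fst (U := R_UniformSpace) (V := R_UniformSpace)). Qed.
Lemma cont2_y x y : cont2 (fun _ y => y) x y.
Proof. apply (continuous_snd (U := R_UniformSpace) (V := R_UniformSpace)). Qed.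
Lemma cont2_const c x y : cont2 (fun _ _ => c) x y.
Proof. apply continuous_const. Qed.
Lemma cont2_plus f g x y : cont2 f x y -> cont2 g x y -> cont2 (fun x y => f x y + g x y) x y.
Proof. intros; now apply continuous_Rplus. Qed.
Lemma cont2_opp f x y : cont2 f x y -> cont2 (fun x y => - f x y) x y.
Proof. intros; now apply continuous_Ropp. Qed.
Lemma cont2_mult f g x y : cont2 f x y -> cont2 g x y -> cont2 (fun x y => f x y * g x y) x y.
Proof. intros; now apply continuous_Rmult. Qed.
Lemma cont2_comp (h : R -> R) f x y : cont2 f x y -> continuous h (f x y) -> cont2 (fun x y => h (f x y)) x y.
Proof. intros; now apply (continuous_comp (fun z : R * R => f (fst z) (snd z)) h). Qed.
Lemma cont2_ext f g x y : (forall x y, f x y = g x y) -> cont2 f x y -> cont2 g x y.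
Proof. intros H; apply continuous_ext; intros; apply H. Qed.

Lemma cont2_r2 x y : cont2 (fun x y => x ^ 2 + y ^ 2) x y.
Proof.
  apply (cont2_plus (fun x _ => x ^ 2) (fun _ y => y ^ 2)); simpl.
  - apply (cont2_mult (fun x _ => x) (fun x _ => x * 1)); [apply cont2_x|].
    apply (cont2_mult (fun x _ => x) (fun _ _ => 1)); [apply cont2_x|apply cont2_const].
  - apply (cont2_mult (fun _ y => y) (fun _ y => y * 1)); [apply cont2_y|].
    apply (cont2_mult (fun _ y => y) (fun _ _ => 1)); [apply cont2_y|apply cont2_const].
Qed.

Lemma cont2_lnr x y : 0 < x ^ 2 + y ^ 2 -> cont2 lnr x y.
Proof.
  intros H. apply (cont2_mult (fun _ _ => / 2) (fun x y => ln (x ^ 2 + y ^ 2))); [apply cont2_const|].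
  apply (cont2_comp ln _ _ _ (cont2_r2 x y)). now apply continuous_ln.
Qed.

Definition Ccont2 (f : R -> R -> C) (x y : R) : Prop :=
  cont2 (fun x y => Re (f x y)) x y /\ cont2 (fun x y => Im (f x y)) x y.

Lemma Ccont2_mult f g x y : Ccont2 f x y -> Ccont2 g x y -> Ccont2 (fun x y => f x y * g x y)%C x y.
Proof.
  intros [H1 H2] [H3 H4]; split.
  - apply cont2_ext with (fun x y => Re (f x y) * Re (g x y) + - (Im (f x y) * Im (g x y))).
    { intros; unfold Re, Im; simpl; ring. }
    apply cont2_plus; [|apply cont2_opp]; now apply cont2_mult.
  - apply cont2_ext with (fun x y => Re (f x y) * Im (g x y) + Im (f x y) * Re (g x y)).
    { intros; unfold Re, Im; simpl; ring. }
    apply cont2_plus; now apply cont2_mult.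
Qed.

Lemma Ccont2_cj e f x y : Ccont2 f x y -> Ccont2 (fun x y => cj e (f x y)) x y.
Proof.
  destruct e; [auto|]. intros [H1 H2]; split; [exact H1|].
  now apply (cont2_opp (fun x y => Im (f x y))).
Qed.

Lemma Ccont2_unit_at x y : 0 < x ^ 2 + y ^ 2 -> Ccont2 unit_at x y.
Proof.
  intros H.
  assert (Hi : cont2 (fun x y => / sqrt (x ^ 2 + y ^ 2)) x y).
  { apply (cont2_comp Rinv (fun x y => sqrt (x ^ 2 + y ^ 2))).
    - apply (cont2_comp sqrt _ _ _ (cont2_r2 x y)), continuous_sqrt.
    - apply continuous_Rinv. apply Rgt_not_eq. now apply sqrt_lt_R0. }
  split.
  - apply (cont2_mult (fun x _ => x)); [apply cont2_x|exact Hi].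
  - apply (cont2_mult (fun _ y => y)); [apply cont2_y|exact Hi].
Qed.

Lemma Ccont2_ang t x y : 0 < x ^ 2 + y ^ 2 -> Ccont2 (ang t) x y.
Proof.
  intros H; induction t as [n|e t1 IH1 t2 IH2].
  - cbn [ang]. induction n as [|n IH].
    + split; apply cont2_const.
    + apply (Ccont2_mult unit_at (fun x y => unit_at x y ^ n)%C); [now apply Ccont2_unit_at|exact IH].
  - cbn [ang]. apply (Ccont2_mult (ang t1) (fun x y => cj e (ang t2 x y))); [exact IH1|now apply Ccont2_cj].
Qed.

Lemma cont2_fld g t x y : 0 < x ^ 2 + y ^ 2 -> Ccontinuous g -> cont2 (fld g t) x y.
Proof.
  intros H Hg. unfold fld.
  apply (fun H1 H2 => proj1 (Ccont2_mult (fun x y => g (lnr x y)) (ang t) x y H1 H2)).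
  - split.
    + apply (cont2_comp (fun s => Re (g s)) lnr); [now apply cont2_lnr|exact (proj1 (Hg _))].
    + apply (cont2_comp (fun s => Im (g s)) lnr); [now apply cont2_lnr|exact (proj2 (Hg _))].
  - now apply Ccont2_ang.
Qed.

Lemma exterior_open_x x y : exterior x y -> exists r, 0 < r /\ forall z, Rabs (z - x) < r -> exterior z y.
Proof.
  unfold exterior; intros H.
  assert (L : locally x (fun z => 1 < z ^ 2 + y ^ 2)).
  { assert (Hc : continuous (fun z => z ^ 2 + y ^ 2) x)
      by (apply continuous_ex_derive; auto_derive; trivial).
    exact (Hc (fun v => 1 < v) (open_gt 1 (x ^ 2 + y ^ 2) H)). }
  destruct L as [r Hr]. exists r; split; [apply cond_pos|]. intros z Hz; now apply Hr.
Qed.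

Lemma exterior_open_y x y : exterior x y -> exists r, 0 < r /\ forall z, Rabs (z - y) < r -> exterior x z.
Proof.
  unfold exterior; intros H. destruct (exterior_open_x y x) as [r [Hr Hz]].
  - unfold exterior; lra.
  - exists r; split; [assumption|]. intros z H'; specialize (Hz z H'); unfold exterior in Hz; lra.
Qed.

Lemma exterior_locally_2d x y : exterior x y -> locally_2d exterior x y.
Proof.
  intros H. apply locally_2d_locally.
  exact (cont2_r2 x y (fun v => 1 < v) (open_gt 1 (x ^ 2 + y ^ 2) H)).
Qed.

Lemma exterior_pos x y : exterior x y -> 0 < x ^ 2 + y ^ 2.
Proof. unfold exterior; lra. Qed.
Lemma exterior_closed_pos x y : exterior_closed x y -> 0 < x ^ 2 + y ^ 2.
Proof. unfold exterior_closed; lra. Qed.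
Lemma exterior_exterior_closed x y : exterior x y -> exterior_closed x y.
Proof. unfold exterior, exterior_closed; lra. Qed.

Lemma coord_div_le x y : exterior x y ->
  Rabs (x / (x ^ 2 + y ^ 2)) <= 1 /\ Rabs (y / (x ^ 2 + y ^ 2)) <= 1.
Proof.
  intros H; pose proof (exterior_pos _ _ H) as Hp; unfold exterior in H.
  assert (A : forall u v, 1 < u ^ 2 + v ^ 2 -> Rabs (u / (u ^ 2 + v ^ 2)) <= 1).
  { intros u v Huv. unfold Rdiv. rewrite Rabs_mult, (Rabs_pos_eq (/ _)) by (left; apply Rinv_0_lt_compat; lra).
    apply (Rmult_le_reg_r (u ^ 2 + v ^ 2)); [lra|].
    rewrite Rmult_assoc, Rinv_l by lra. rewrite Rmult_1_r, Rmult_1_l.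
    rewrite <- (pow2_abs u) in *. nra. }
  split; [now apply A|]. rewrite Rplus_comm. apply A; lra.
Qed.

(** * Regularity of fields summed over trees *)

Section SeriesFields.

Context (N : tree -> R) (XM : R).
Context (N0 : forall t, 0 <= N t) (HX : forall j, Tsum j N <= XM).

Definition SF (g : tree -> R -> C) (x y : R) : R := Tseries (fun t => fld (g t) t x y).

Definition dom (B : R) (g : tree -> R -> C) : Prop :=
  forall t s, 0 <= s -> Cmod (g t s) <= B * N t.

Lemma dom_fld B g t x y : dom B g -> exterior_closed x y -> Rabs (fld (g t) t x y) <= B * N t.
Proof. intros H Hxy. apply fld_le; [exact Hxy|intros; now apply H]. Qed.

Lemma SF_continuous g B : (forall t, Ccontinuous (g t)) -> dom B g -> continuous_up_to_boundary (SF g).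
Proof.
  intros Hc Hd x y Hxy. unfold SF.
  apply (uniform_limit_continuous N XM N0 HX (fun t z => fld (g t) t (fst z) (snd z))
    (fun z : R * R => exterior_closed (fst z) (snd z)) B (x, y)).
  - intros t. apply (cont2_fld (g t) t x y); [now apply exterior_closed_pos|apply Hc].
  - exact Hxy.
  - intros t z Hz. now apply dom_fld.
Qed.

Lemma SF_cont2 g B x y : (forall t, Ccontinuous (g t)) -> dom B g -> exterior x y -> cont2 (SF g) x y.
Proof.
  intros Hc Hd Hxy P HP.
  pose proof (SF_continuous g B Hc Hd x y (exterior_exterior_closed _ _ Hxy) P HP) as F.
  pose proof (proj1 (locally_2d_locally _ _ _) (exterior_locally_2d x y Hxy)) as L.
  unfold filtermap, within in *.
  generalize (filter_and _ _ F L). apply filter_imp. intros z [H1 H2].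
  now apply H1, exterior_exterior_closed.
Qed.

Lemma comb_le a b c d M m : Rabs a <= 1 -> Rabs b <= 1 -> Rabs c <= M * m -> Rabs d <= M * m ->
  Rabs (a * c + b * d) <= 2 * M * m.
Proof.
  intros. eapply Rle_trans; [apply Rabs_triang|]. rewrite !Rabs_mult.
  pose proof (Rabs_pos a); pose proof (Rabs_pos b); pose proof (Rabs_pos c); pose proof (Rabs_pos d). nra.
Qed.

Lemma is_derive_cont2_x f x y : cont2 f x y -> continuous (fun z => f z y) x.
Proof.
  intros H. apply (continuous_comp_2 (fun z => z) (fun _ => y) f x);
    [apply continuous_id|apply continuous_const|exact H].
Qed.
Lemma is_derive_cont2_y f x y : cont2 f x y -> continuous (fun z => f x z) y.
Proof.
  intros H. apply (continuous_comp_2 (fun _ => x) (fun z => z) f y);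
    [apply continuous_const|apply continuous_id|exact H].
Qed.

Lemma inth_continuous g t : Ccontinuous (g t) -> Ccontinuous (inth g t).
Proof. intros; apply Ccontinuous_mult; [apply Ccontinuous_const|assumption]. Qed.

Lemma cont2_div_r2 f x y : cont2 f x y -> 0 < x ^ 2 + y ^ 2 -> cont2 (fun x y => f x y / (x ^ 2 + y ^ 2)) x y.
Proof.
  intros Hf H. apply cont2_mult; [exact Hf|].
  apply (cont2_comp Rinv (fun x y => x ^ 2 + y ^ 2)); [apply cont2_r2|apply continuous_Rinv; lra].
Qed.

(** The chain rule produces the coefficients [x / r^2] and [- y / r^2], at most 1 in modulus outside
    the disc; hence the domination by [2 * B] near the point. *)
Lemma SF_dx g g' B x y :
  (forall t s, Cderive (g t) s (g' t s)) -> (forall t, Ccontinuous (g' t)) ->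
  dom B g -> dom B g' -> dom B (inth g) -> exterior x y ->
  is_derive (fun z => SF g z y) x
    (x / (x ^ 2 + y ^ 2) * SF g' x y + - y / (x ^ 2 + y ^ 2) * SF (inth g) x y).
Proof.
  intros Hd Hc' D1 D2 D3 Hxy. unfold SF.
  assert (Hc : forall t, Ccontinuous (g t)) by (intros t; eapply Cderive_continuous, Hd).
  assert (B0 : forall t, 0 <= B * N t).
  { intros t; eapply Rle_trans; [apply Cmod_ge_0|apply (D1 t 0 (Rle_refl 0))]. }
  rewrite <- (Tseries_comb N XM N0 HX _ _ B B).
  2: intros t; apply (dom_fld B g' t x y D2); now apply exterior_exterior_closed.
  2: intros t; apply (dom_fld B (inth g) t x y D3); now apply exterior_exterior_closed.
  destruct (exterior_open_x x y Hxy) as [r [Hr Hext]].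
  apply (is_derive_Tseries N XM N0 HX (fun t z => fld (g t) t z y)
    (fun t z => z / (z ^ 2 + y ^ 2) * fld (g' t) t z y + - y / (z ^ 2 + y ^ 2) * fld (inth g t) t z y) (2 * B) x r Hr).
  - intros t z Hz. apply is_derive_fld_x; [now apply exterior_pos, Hext|apply Hd].
  - intros t z Hz. specialize (Hext z Hz).
    pose proof (exterior_exterior_closed _ _ Hext) as Hcl. destruct (coord_div_le _ _ Hext) as [E1 E2].
    split.
    + pose proof (dom_fld B g t z y D1 Hcl). specialize (B0 t). lra.
    + apply comb_le; [exact E1| |now apply dom_fld|now apply dom_fld].
      unfold Rdiv; rewrite Ropp_mult_distr_l_reverse, Rabs_Ropp. exact E2.
  - intros t z Hz. specialize (Hext z Hz). pose proof (exterior_pos _ _ Hext) as Hp.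
    apply (is_derive_cont2_x (fun x y => x / (x ^ 2 + y ^ 2) * fld (g' t) t x y + - y / (x ^ 2 + y ^ 2) * fld (inth g t) t x y)).
    apply cont2_plus; apply cont2_mult.
    + apply (cont2_div_r2 (fun x _ => x)); [apply cont2_x|exact Hp].
    + now apply cont2_fld.
    + apply (cont2_div_r2 (fun _ y => - y)); [apply cont2_opp, cont2_y|exact Hp].
    + apply cont2_fld; [exact Hp|now apply inth_continuous].
Qed.

Lemma SF_dy g g' B x y :
  (forall t s, Cderive (g t) s (g' t s)) -> (forall t, Ccontinuous (g' t)) ->
  dom B g -> dom B g' -> dom B (inth g) -> exterior x y ->
  is_derive (fun z => SF g x z) y
    (y / (x ^ 2 + y ^ 2) * SF g' x y + x / (x ^ 2 + y ^ 2) * SF (inth g) x y).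
Proof.
  intros Hd Hc' D1 D2 D3 Hxy. unfold SF.
  assert (Hc : forall t, Ccontinuous (g t)) by (intros t; eapply Cderive_continuous, Hd).
  assert (B0 : forall t, 0 <= B * N t).
  { intros t; eapply Rle_trans; [apply Cmod_ge_0|apply (D1 t 0 (Rle_refl 0))]. }
  rewrite <- (Tseries_comb N XM N0 HX _ _ B B).
  2: intros t; apply (dom_fld B g' t x y D2); now apply exterior_exterior_closed.
  2: intros t; apply (dom_fld B (inth g) t x y D3); now apply exterior_exterior_closed.
  destruct (exterior_open_y x y Hxy) as [r [Hr Hext]].
  apply (is_derive_Tseries N XM N0 HX (fun t z => fld (g t) t x z)
    (fun t z => z / (x ^ 2 + z ^ 2) * fld (g' t) t x z + x / (x ^ 2 + z ^ 2) * fld (inth g t) t x z) (2 * B) y r Hr).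
  - intros t z Hz. apply is_derive_fld_y; [now apply exterior_pos, Hext|apply Hd].
  - intros t z Hz. specialize (Hext z Hz).
    pose proof (exterior_exterior_closed _ _ Hext) as Hcl. destruct (coord_div_le _ _ Hext) as [E1 E2].
    split.
    + pose proof (dom_fld B g t x z D1 Hcl). specialize (B0 t). lra.
    + apply comb_le; [exact E2|exact E1|now apply dom_fld|now apply dom_fld].
  - intros t z Hz. specialize (Hext z Hz). pose proof (exterior_pos _ _ Hext) as Hp.
    apply (is_derive_cont2_y (fun x y => y / (x ^ 2 + y ^ 2) * fld (g' t) t x y + x / (x ^ 2 + y ^ 2) * fld (inth g t) t x y)).
    apply cont2_plus; apply cont2_mult.
    + apply (cont2_div_r2 (fun _ y => y)); [apply cont2_y|exact Hp].
    + now apply cont2_fld.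
    + apply (cont2_div_r2 (fun x _ => x)); [apply cont2_x|exact Hp].
    + apply cont2_fld; [exact Hp|now apply inth_continuous].
Qed.

End SeriesFields.

(* A variant of [class_C] carrying witnesses for the partial derivatives, which makes
   stability under products a plain induction. *)
Fixpoint Cn (n : nat) (g : R -> R -> R) : Prop :=
  (forall x y, exterior x y -> cont2 g x y) /\
  match n with
  | O => True
  | S m => exists gx gy : R -> R -> R,
      (forall x y, exterior x y ->
         is_derive (fun z => g z y) x (gx x y) /\ is_derive (fun z => g x z) y (gy x y)) /\
      Cn m gx /\ Cn m gy
  end.

Lemma Cn_cont2 n g x y : Cn n g -> exterior x y -> cont2 g x y.
Proof. destruct n; intros [H _]; apply H. Qed.

Lemma Cn_pred n : forall g, Cn (S n) g -> Cn n g.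
Proof.
  induction n as [|n IH]; intros g (H & gx & gy & Hd & Hx & Hy).
  - split; trivial.
  - split; [exact H|]. exists gx, gy. auto.
Qed.

Lemma Cn_const n c : Cn n (fun _ _ => c).
Proof.
  revert c; induction n as [|n IH]; intros c; (split; [intros; apply cont2_const|]); trivial.
  exists (fun _ _ => 0), (fun _ _ => 0). split; [|split; apply IH].
  intros; split; apply is_derive_Rconst.
Qed.

Lemma Cn_x n : Cn n (fun x _ => x).
Proof.
  destruct n as [|n]; (split; [intros; apply cont2_x|]); trivial.
  exists (fun _ _ => 1), (fun _ _ => 0). split; [|split; apply Cn_const].
  intros; split; [apply is_derive_Rid|apply is_derive_Rconst].
Qed.

Lemma Cn_y n : Cn n (fun _ y => y).
Proof.
  destruct n as [|n]; (split; [intros; apply cont2_y|]); trivial.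
  exists (fun _ _ => 0), (fun _ _ => 1). split; [|split; apply Cn_const].
  intros; split; [apply is_derive_Rconst|apply is_derive_Rid].
Qed.

Lemma Cn_plus n : forall f g, Cn n f -> Cn n g -> Cn n (fun x y => f x y + g x y).
Proof.
  induction n as [|n IH]; intros f g [Hf Hf'] [Hg Hg'];
    (split; [intros; apply cont2_plus; auto|]); trivial.
  destruct Hf' as (fx & fy & Df & Hfx & Hfy), Hg' as (gx & gy & Dg & Hgx & Hgy).
  exists (fun x y => fx x y + gx x y), (fun x y => fy x y + gy x y).
  split; [|split; now apply IH].
  intros x y Hxy. destruct (Df x y Hxy), (Dg x y Hxy).
  split; now apply is_derive_Rplus.
Qed.

Lemma Cn_opp n : forall f, Cn n f -> Cn n (fun x y => - f x y).
Proof.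
  induction n as [|n IH]; intros f [Hf Hf'];
    (split; [intros; apply cont2_opp; auto|]); trivial.
  destruct Hf' as (fx & fy & Df & Hfx & Hfy).
  exists (fun x y => - fx x y), (fun x y => - fy x y).
  split; [|split; now apply IH].
  intros x y Hxy. destruct (Df x y Hxy).
  split; now apply is_derive_Ropp.
Qed.

Lemma Cn_mult n : forall f g, Cn n f -> Cn n g -> Cn n (fun x y => f x y * g x y).
Proof.
  induction n as [|n IH]; intros f g Cf Cg.
  - destruct Cf as [Hf _], Cg as [Hg _]. split; [intros; apply cont2_mult; auto|trivial].
  - pose proof (Cn_pred _ _ Cf) as Cf'. pose proof (Cn_pred _ _ Cg) as Cg'.
    destruct Cf as (Hf & fx & fy & Df & Hfx & Hfy), Cg as (Hg & gx & gy & Dg & Hgx & Hgy).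
    split; [intros; apply cont2_mult; auto|].
    exists (fun x y => fx x y * g x y + f x y * gx x y), (fun x y => fy x y * g x y + f x y * gy x y).
    split; [|split; apply Cn_plus; now apply IH].
    intros x y Hxy. destruct (Df x y Hxy), (Dg x y Hxy).
    split; [now apply (is_derive_Rmult (fun z => f z y) (fun z => g z y))|
            now apply (is_derive_Rmult (fun z => f x z) (fun z => g x z))].
Qed.

Definition ir2 (x y : R) : R := / (x ^ 2 + y ^ 2).

Lemma is_derive_ir2 x y : exterior x y ->
  is_derive (fun z => ir2 z y) x (- (2 * x) * (ir2 x y * ir2 x y)) /\
  is_derive (fun z => ir2 x z) y (- (2 * y) * (ir2 x y * ir2 x y)).
Proof.
  intros H; pose proof (exterior_pos _ _ H) as Hp; simpl in Hp; unfold ir2.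
  split; (auto_derive; [simpl; lra|simpl; field; lra]).
Qed.

Lemma Cn_ir2 n : Cn n ir2.
Proof.
  assert (H0 : forall x y, exterior x y -> cont2 ir2 x y).
  { intros x y Hxy. apply (cont2_comp Rinv (fun x y => x ^ 2 + y ^ 2)); [apply cont2_r2|].
    apply continuous_Rinv. pose proof (exterior_pos _ _ Hxy); lra. }
  induction n as [|n IH]; (split; [exact H0|]); trivial.
  exists (fun x y => - (2 * x) * (ir2 x y * ir2 x y)), (fun x y => - (2 * y) * (ir2 x y * ir2 x y)).
  split; [intros; now apply is_derive_ir2|].
  split; apply Cn_mult; try (apply Cn_mult; exact IH);
    apply Cn_opp, (Cn_mult n (fun _ _ => 2)); [apply Cn_const|apply Cn_x|apply Cn_const|apply Cn_y].
Qed.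

(** [ex_diff_n] speaks of [Derive], which agrees with the witnesses on the open exterior, hence near
    each of its points. *)
Lemma Cn_class_C n : forall g, Cn n g -> class_C n g.
Proof.
  induction n as [|n IH]; intros g Hg x y Hxy.
  - split; [|trivial]. apply continuity_2d_pt_filterlim. now apply Hg.
  - destruct Hg as (Hg & gx & gy & Hd & Hgx & Hgy).
    split; [apply continuity_2d_pt_filterlim; now apply Hg|].
    destruct (Hd x y Hxy) as [D1 D2].
    split; [eexists; exact D1|]. split; [eexists; exact D2|].
    pose proof (exterior_locally_2d x y Hxy) as L.
    split.
    + apply ex_diff_n_ext_loc with gx; [|now apply IH].
      revert L; apply locally_2d_impl, locally_2d_forall. intros u v Huv.
      symmetry; apply is_derive_unique, Hd, Huv.
    + apply ex_diff_n_ext_loc with gy; [|now apply IH].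
      revert L; apply locally_2d_impl, locally_2d_forall. intros u v Huv.
      symmetry; apply is_derive_unique, Hd, Huv.
Qed.

(** * Fourier series of smooth periodic functions *)

Definition kap (n : nat) : R := match n with O => / 2 | S _ => 1 end.
Definition FA (f : R -> R) (n : nat) : R := RInt (fun t => f t * cos (INR n * t)) (- PI) PI.
Definition FB (f : R -> R) (n : nat) : R := RInt (fun t => f t * sin (INR n * t)) (- PI) PI.
(** The combination [A - i B] makes [Re (c_n e^(i n theta))] the usual cosine and sine pair; [kap]
    halves the constant term. *)
Definition fcoef (f : R -> R) (n : nat) : C := (kap n / PI * FA f n, - (kap n / PI * FB f n)).

Lemma cont_of_ex_derive (f : R -> R) : (forall t, ex_derive f t) -> cont f.
Proof. intros H s; apply continuous_ex_derive, H. Qed.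

Lemma cont_mult (f g : R -> R) : cont f -> cont g -> cont (fun t => f t * g t).
Proof. intros Hf Hg s; apply continuous_Rmult; auto. Qed.

Lemma cont_cos_n n : cont (fun t => cos (INR n * t)).
Proof. apply cont_of_ex_derive; intros t; auto_derive; trivial. Qed.
Lemma cont_sin_n n : cont (fun t => sin (INR n * t)).
Proof. apply cont_of_ex_derive; intros t; auto_derive; trivial. Qed.

Lemma cos_n_PI n : cos (INR n * - PI) = cos (INR n * PI).
Proof. rewrite Ropp_mult_distr_r_reverse. apply cos_neg. Qed.

Lemma sin_n_PI n : sin (INR n * PI) = 0.
Proof. apply sin_eq_0_1. exists (Z.of_nat n). now rewrite <- INR_IZR_INZ. Qed.

Lemma smooth_periodic_derive f : smooth_periodic f ->
  (forall t, ex_derive f t) /\ smooth_periodic (Derive f).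
Proof.
  intros [H1 H2]. assert (E : forall t, ex_derive f t) by (intros t; apply (H1 1%nat t)).
  split; [exact E|split].
  - intros n t. destruct n as [|n]; [exact I|].
    simpl. apply (ex_derive_ext (Derive_n f (S n))); [|apply (H1 (S (S n)) t)].
    intros s. pose proof (Derive_n_comp f n 1 s) as C. rewrite Nat.add_1_r in C. now rewrite <- C.
  - intros t. symmetry. apply is_derive_unique.
    apply (is_derive_ext (fun s => f (s + 2 * PI))); [intros; apply H2|].
    replace (Derive f (t + 2 * PI)) with (1 * Derive f (t + 2 * PI)) by ring.
    apply (is_derive_comp (V := R_NormedModule) f (fun s => s + 2 * PI) t (Derive f (t + 2 * PI)) 1).
    + now apply Derive_correct.
    + auto_derive; trivial; ring.
Qed.

Lemma periodic_ends (f : R -> R) : (forall t, f (t + 2 * PI) = f t) -> f PI = f (- PI).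
Proof. intros H. rewrite <- (H (- PI)). f_equal; ring. Qed.

Lemma RInt_by'parts (f g g' : R -> R) :
  (forall t, ex_derive f t) -> cont (Derive f) -> (forall t, is_derive g t (g' t)) -> cont g' ->
  f PI * g PI = f (- PI) * g (- PI) ->
  RInt (fun t => Derive f t * g t) (- PI) PI = - RInt (fun t => f t * g' t) (- PI) PI.
Proof.
  intros Hf Cf' Hg Cg' E.
  assert (Cf : cont f) by now apply cont_of_ex_derive.
  assert (Cg : cont g) by (apply cont_of_ex_derive; intros t; eexists; apply Hg).
  assert (X : is_RInt (fun t => Derive f t * g t + f t * g' t) (- PI) PI (f PI * g PI - f (- PI) * g (- PI))).
  { apply (is_RInt_derive (V := R_CompleteNormedModule) (fun t => f t * g t)).
    - intros t _. apply is_derive_Rmult; [now apply Derive_correct|apply Hg].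
    - intros t _. apply continuous_Rplus; now apply cont_mult. }
  apply (is_RInt_unique (V := R_CompleteNormedModule)) in X.
  rewrite E, Rminus_diag in X.
  rewrite (RInt_plus (V := R_CompleteNormedModule)) in X by (apply ex_RInt_cont; now apply cont_mult).
  unfold plus in X; simpl in X. lra.
Qed.

Lemma FA_FB_derive f n : smooth_periodic f ->
  FA (Derive f) n = INR n * FB f n /\ FB (Derive f) n = - INR n * FA f n.
Proof.
  intros Hf. destruct (smooth_periodic_derive f Hf) as [E Hf'].
  destruct (smooth_periodic_derive _ Hf') as [E' _].
  pose proof (periodic_ends f (proj2 Hf)) as P.
  assert (Cf : cont f) by now apply cont_of_ex_derive.
  unfold FA, FB. split.
  - rewrite (RInt_by'parts f (fun t => cos (INR n * t)) (fun t => - INR n * sin (INR n * t))).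
    + rewrite (RInt_ext _ (fun t => scal (- INR n) (f t * sin (INR n * t)))).
      2: { intros; unfold scal; simpl; unfold mult; simpl; ring. }
      rewrite (RInt_scal (V := R_CompleteNormedModule)) by (apply ex_RInt_cont, cont_mult; [assumption|apply cont_sin_n]).
      unfold scal; simpl; unfold mult; simpl; ring.
    + exact E.
    + now apply cont_of_ex_derive.
    + intros t; auto_derive; trivial; ring.
    + apply cont_of_ex_derive; intros t; auto_derive; trivial.
    + now rewrite cos_n_PI, P.
  - rewrite (RInt_by'parts f (fun t => sin (INR n * t)) (fun t => INR n * cos (INR n * t))).
    + rewrite (RInt_ext _ (fun t => scal (INR n) (f t * cos (INR n * t)))).
      2: { intros; unfold scal; simpl; unfold mult; simpl; ring. }
      rewrite (RInt_scal (V := R_CompleteNormedModule)) by (apply ex_RInt_cont, cont_mult; [assumption|apply cont_cos_n]).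
      unfold scal; simpl; unfold mult; simpl; ring.
    + exact E.
    + now apply cont_of_ex_derive.
    + intros t; auto_derive; trivial; ring.
    + apply cont_of_ex_derive; intros t; auto_derive; trivial.
    + rewrite Ropp_mult_distr_r_reverse, sin_neg, sin_n_PI; ring.
Qed.

Lemma RInt_trig_le (f g : R -> R) : cont f -> cont g -> (forall t, Rabs (g t) <= 1) ->
  Rabs (RInt (fun t => f t * g t) (- PI) PI) <= RInt (fun t => Rabs (f t)) (- PI) PI.
Proof.
  intros Cf Cg H. pose proof PI_RGT_0.
  assert (Ca : cont (fun t => Rabs (f t))) by (intros s; apply (continuous_comp f Rabs); [apply Cf|apply continuous_Rabs]).
  eapply Rle_trans; [apply abs_RInt_le; [lra|now apply ex_RInt_cont, cont_mult]|].
  apply RInt_le; [lra| |now apply ex_RInt_cont|].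
  - apply ex_RInt_cont. intros s; apply (continuous_comp (fun t => f t * g t) Rabs); [now apply cont_mult|apply continuous_Rabs].
  - intros t _. rewrite Rabs_mult. specialize (H t). pose proof (Rabs_pos (f t)). nra.
Qed.

(** Each integration by parts moves one derivative onto [f] and gains one factor [n]; periodicity
    cancels the boundary terms. *)
Lemma F_decay k : forall f : R -> R, smooth_periodic f ->
  exists M, forall n, INR n ^ k * Rabs (FA f n) <= M /\ INR n ^ k * Rabs (FB f n) <= M.
Proof.
  induction k as [|k IH]; intros f Hf; destruct (smooth_periodic_derive f Hf) as [E Hf'].
  - exists (RInt (fun t => Rabs (f t)) (- PI) PI). intros n. rewrite !Rmult_1_l.
    pose proof (cont_of_ex_derive f E).
    split; apply RInt_trig_le; auto using cont_cos_n, cont_sin_n; intros t; apply Rabs_le.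
    + apply COS_bound.
    + apply SIN_bound.
  - destruct (IH _ Hf') as [M HM]. exists M. intros n. destruct (HM n) as [H1 H2].
    destruct (FA_FB_derive f n Hf) as [E1 E2].
    rewrite E1, Rabs_mult, (Rabs_pos_eq (INR n)) in H1 by apply pos_INR.
    rewrite E2, Rabs_mult, Rabs_Ropp, (Rabs_pos_eq (INR n)) in H2 by apply pos_INR.
    simpl; split; lra.
Qed.

(** Telescoping, by [1 / (x + 1)^2 <= 1 / x - 1 / (x + 1)]. *)
Lemma sum_inv_sq_le (M : R) (u : nat -> R) (J : nat) : 0 <= M ->
  (forall n, (1 <= n)%nat -> u n <= M / INR n ^ 2) -> sum_f_R0 u J <= u O + 2 * M.
Proof.
  intros HM H.
  destruct J as [|J].
  - simpl. lra.
  - assert (Q : forall J, sum_f_R0 u (S J) <= u O + 2 * M - M / INR (S J)).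
    { clear J. intros J. induction J as [|J IH].
      - simpl sum_f_R0. specialize (H 1%nat (le_n _)). simpl in *. lra.
      - rewrite tech5. specialize (H (S (S J)) ltac:(lia)).
        rewrite (S_INR (S J)) in *. set (x := INR (S J)) in *.
        assert (Hx : 0 < x) by (unfold x; apply lt_0_INR; lia).
        assert (M / (x + 1) ^ 2 <= M / x - M / (x + 1)).
        { replace (M / x - M / (x + 1)) with (M * (/ (x * (x + 1)))) by (field; lra).
          unfold Rdiv. apply Rmult_le_compat_l; [assumption|]. apply Rinv_le_contravar; nra. }
        lra. }
    specialize (Q J). assert (0 <= M / INR (S J)).
    { apply Rmult_le_pos; [assumption|left; apply Rinv_0_lt_compat, lt_0_INR; lia]. }
    lra.
Qed.

Lemma fcoef_summable f : smooth_periodic f ->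
  exists Cf, 1 <= Cf /\ forall J, sum_f_R0 (fun n => Cmod (fcoef f n) * jap (INR n) ^ 3) J <= Cf.
Proof.
  (* [5 = 3 + 2]: three powers for the weight [jap^3], two for summability. *)
  intros Hf. destruct (F_decay 5 f Hf) as [M HM].
  assert (M0 : 0 <= M) by (destruct (HM O) as [H _]; simpl in H; lra).
  set (u := fun n => Cmod (fcoef f n) * jap (INR n) ^ 3).
  assert (Hu : forall n, (1 <= n)%nat -> u n <= 16 * M / INR n ^ 2).
  { intros n Hn. unfold u, fcoef. destruct (HM n) as [H1 H2].
    set (x := INR n) in *. assert (Hx : 1 <= x) by (unfold x; now apply (le_INR 1)).
    destruct n as [|n]; [lia|]. simpl kap. unfold Rdiv; rewrite !Rmult_1_l.
    pose proof PI_RGT_0. pose proof PI2_1. 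
    assert (Hpi : 0 < / PI <= 1).
    { split; [now apply Rinv_0_lt_compat|]. rewrite <- Rinv_1. apply Rinv_le_contravar; lra. }
    eapply Rle_trans with ((Rabs (FA f (S n)) + Rabs (FB f (S n))) * (2 * x) ^ 3).
    - apply Rmult_le_compat; [apply Cmod_ge_0|apply pow_le; pose proof (jap_ge_1 x); lra| |].
      + eapply Rle_trans; [apply Cmod_le_abs|]. unfold Re, Im; simpl.
        rewrite Rabs_Ropp, !Rabs_mult, (Rabs_pos_eq (/ PI)) by lra.
        pose proof (Rabs_pos (FA f (S n))). pose proof (Rabs_pos (FB f (S n))). nra.
      + apply pow_incr. unfold jap. rewrite Rabs_pos_eq by lra. lra.
    - apply (Rmult_le_reg_r (x ^ 2)); [nra|].
      replace (16 * M * / x ^ 2 * x ^ 2) with (16 * M) by (field; lra).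
      replace ((Rabs (FA f (S n)) + Rabs (FB f (S n))) * (2 * x) ^ 3 * x ^ 2) with
        (8 * (x ^ 5 * Rabs (FA f (S n)) + x ^ 5 * Rabs (FB f (S n)))) by ring.
      lra. }
  (* The extra 1 keeps [Cf] away from zero, since [delta0] will be a multiple of [/ Cf]. *)
  exists (1 + (u O + 2 * (16 * M))). split.
  - assert (0 <= u O) by (apply Rmult_le_pos; [apply Cmod_ge_0|apply pow_le; pose proof (jap_ge_1 (INR 0)); lra]). lra.
  - intros J. pose proof (sum_inv_sq_le (16 * M) u J ltac:(lra) Hu). lra.
Qed.

(** * Pointwise convergence of Fourier series through Fejer means *)

Lemma RInt_period (g : R -> R) a b : cont g -> (forall t, g (t + 2 * PI) = g t) ->
  RInt g a (a + 2 * PI) = RInt g b (b + 2 * PI).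
Proof.
  intros Cg Hg.
  assert (E : RInt g (b + 2 * PI) (a + 2 * PI) = RInt g b a).
  { transitivity (RInt (fun y => scal 1 (g (1 * y + 2 * PI))) b a).
    - pose proof (RInt_comp_lin (V := R_CompleteNormedModule) g 1 (2 * PI) b a (ex_RInt_cont _ _ _ Cg)) as X.
      rewrite !Rmult_1_l in X. symmetry; exact X.
    - apply RInt_ext; intros; now rewrite !Rmult_1_l, Hg. }
  pose proof (RInt_Chasles_cont g a b (b + 2 * PI) Cg).
  pose proof (RInt_Chasles_cont g a (b + 2 * PI) (a + 2 * PI) Cg).
  pose proof (RInt_Chasles_cont g b a b Cg) as H1. rewrite RInt_point in H1. unfold zero in H1; simpl in H1.
  lra.
Qed.

Lemma RInt_ext_R (f g : R -> R) a b : (forall t, f t = g t) -> RInt f a b = RInt g a b :> R.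
Proof. intros H; apply RInt_ext; intros; apply H. Qed.

(** Half the Dirichlet kernel; [Fej] sums these without normalisation, so its mass over a period is
    [(J + 1) * PI]. *)
Definition Dir (M : nat) (t : R) : R := sum_f_R0 (fun n => kap n * cos (INR n * t)) M.
Definition Fej (J : nat) (t : R) : R := sum_f_R0 (fun M => Dir M t) J.

Lemma Dir_mult M t : Dir M t * (1 - cos t) = / 2 * (cos (INR M * t) - cos (INR (S M) * t)).
Proof.
  unfold Dir; induction M as [|M IH].
  - simpl. rewrite !Rmult_0_l, cos_0, Rmult_1_l. lra.
  - rewrite tech5, Rmult_plus_distr_r, IH. simpl kap.
    rewrite (S_INR (S M)). set (x := INR (S M)). replace (INR M) with (x - 1) by (unfold x; rewrite S_INR; ring).
    replace ((x - 1) * t) with (x * t - t) by ring. replace ((x + 1) * t) with (x * t + t) by ring.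
    rewrite cos_plus, cos_minus. lra.
Qed.

Lemma Fej_mult J t : Fej J t * (1 - cos t) = / 2 * (1 - cos (INR (S J) * t)).
Proof.
  unfold Fej; induction J as [|J IH].
  - simpl sum_f_R0. rewrite Dir_mult. simpl INR. rewrite Rmult_0_l, cos_0. reflexivity.
  - rewrite tech5, Rmult_plus_distr_r, IH, Dir_mult. ring.
Qed.

(** Where [cos t = 1] the closed form of [Fej_mult] says nothing, but there every cosine of the sum
    equals 1. *)
Lemma Fej_nonneg J t : 0 <= Fej J t.
Proof.
  pose proof (COS_bound t) as [_ [Hc|Hc]].
  - apply Rnot_lt_le; intros Hn. pose proof (Fej_mult J t). pose proof (COS_bound (INR (S J) * t)). nra.
  - assert (Hs : sin t = 0).
    { pose proof (sin2_cos2 t) as E; unfold Rsqr in E. rewrite Hc in E.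
      nra. }
    assert (P : forall n, cos (INR n * t) = 1 /\ sin (INR n * t) = 0).
    { induction n as [|n [IH1 IH2]]; [simpl; rewrite Rmult_0_l, cos_0, sin_0; auto|].
      rewrite S_INR, Rmult_plus_distr_r, Rmult_1_l, cos_plus, sin_plus, IH1, IH2, Hc, Hs. lra. }
    unfold Fej. apply cond_pos_sum; intros M. unfold Dir. apply cond_pos_sum; intros n.
    rewrite (proj1 (P n)). destruct n; simpl; lra.
Qed.

Lemma cont_sum (g : nat -> R -> R) J : (forall n, cont (g n)) -> cont (fun t => sum_f_R0 (fun n => g n t) J).
Proof.
  intros H s; induction J as [|J IH]; simpl; [apply H|].
  apply continuous_Rplus; [exact IH|apply H].
Qed.

Lemma RInt_sum (g : nat -> R -> R) J a b : (forall n, cont (g n)) ->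
  RInt (fun t => sum_f_R0 (fun n => g n t) J) a b = sum_f_R0 (fun n => RInt (g n) a b) J :> R.
Proof.
  intros H; induction J as [|J IH]; simpl; [reflexivity|].
  rewrite <- IH. apply (RInt_plus (V := R_CompleteNormedModule)); apply ex_RInt_cont; [now apply cont_sum|apply H].
Qed.

Lemma RInt_Rscal (g : R -> R) c a b : cont g -> RInt (fun t => c * g t) a b = c * RInt g a b :> R.
Proof. intros H. apply (RInt_scal (V := R_CompleteNormedModule) g a b c); now apply ex_RInt_cont. Qed.

Lemma cont_scal (g : R -> R) c : cont g -> cont (fun t => c * g t).
Proof. intros H s; apply (continuous_Rscal c g), H. Qed.

Lemma cont_Dir M : cont (Dir M).
Proof. apply (cont_sum (fun n t => kap n * cos (INR n * t))). intros n; apply cont_scal, cont_cos_n. Qed.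
Lemma cont_Fej J : cont (Fej J).
Proof. apply (cont_sum Dir). apply cont_Dir. Qed.

Lemma RInt_cos_n n : (1 <= n)%nat -> RInt (fun t => cos (INR n * t)) (- PI) PI = 0 :> R.
Proof.
  intros Hn. assert (Hx : INR n <> 0) by (apply not_0_INR; lia).
  assert (H : is_RInt (fun t => cos (INR n * t)) (- PI) PI (sin (INR n * PI) / INR n - sin (INR n * - PI) / INR n)).
  { apply (is_RInt_derive (V := R_CompleteNormedModule) (fun t => sin (INR n * t) / INR n)).
    - intros; auto_derive; trivial; field; assumption.
    - intros; apply cont_cos_n. }
  apply (is_RInt_unique (V := R_CompleteNormedModule)) in H.
  rewrite Ropp_mult_distr_r_reverse, sin_neg, sin_n_PI in H.
  replace (0 / INR n - - 0 / INR n) with 0 in H by (unfold Rdiv; ring). exact H.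
Qed.

Lemma RInt_Dir M : RInt (Dir M) (- PI) PI = PI :> R.
Proof.
  unfold Dir. rewrite (RInt_sum (fun n t => kap n * cos (INR n * t))) by (intros; apply cont_scal, cont_cos_n).
  induction M as [|M IH].
  - simpl. rewrite RInt_Rscal by apply (cont_cos_n 0).
    rewrite (RInt_ext_R _ (fun _ => 1)) by (intros; now rewrite Rmult_0_l, cos_0).
    rewrite RInt_const. unfold scal; simpl; unfold mult; simpl; lra.
  - rewrite tech5, IH, RInt_Rscal by apply cont_cos_n. rewrite RInt_cos_n by lia. ring.
Qed.

Lemma RInt_Fej J : RInt (Fej J) (- PI) PI = INR (S J) * PI :> R.
Proof.
  unfold Fej. rewrite (RInt_sum Dir) by apply cont_Dir.
  induction J as [|J IH]; [simpl; rewrite RInt_Dir; ring|].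
  rewrite tech5, IH, RInt_Dir, (S_INR (S J)). ring.
Qed.

Definition fpart (f : R -> R) (th : R) (n : nat) : R :=
  Re (fcoef f n * (cos (INR n * th), sin (INR n * th)))%C.

Lemma fpart_integral (f : R -> R) th n : cont f -> (forall t, f (t + 2 * PI) = f t) ->
  fpart f th n = / PI * RInt (fun t => f (th + t) * (kap n * cos (INR n * t))) (- PI) PI.
Proof.
  intros Cf Hf. unfold fpart, fcoef, FA, FB, Re; cbn [fst snd Cmult].
  set (c := cos (INR n * th)); set (s := sin (INR n * th)).
  assert (C1 : cont (fun t => f t * cos (INR n * t))) by (apply cont_mult; [exact Cf|apply cont_cos_n]).
  assert (C2 : cont (fun t => f t * sin (INR n * t))) by (apply cont_mult; [exact Cf|apply cont_sin_n]).
  transitivity (/ PI * RInt (fun t => kap n * c * (f t * cos (INR n * t)) + kap n * s * (f t * sin (INR n * t))) (- PI) PI).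
  { rewrite (RInt_plus (V := R_CompleteNormedModule) (fun t => kap n * c * (f t * cos (INR n * t))) (fun t => kap n * s * (f t * sin (INR n * t)))) by (apply ex_RInt_cont; now apply cont_scal).
    rewrite !RInt_Rscal by assumption. unfold plus, Rdiv; simpl. ring. }
  f_equal.
  set (g := fun t => f t * (kap n * cos (INR n * (t - th)))).
  rewrite (RInt_ext_R _ g).
  2: { intros t. unfold g. replace (INR n * (t - th)) with (INR n * t - INR n * th) by ring.
       rewrite cos_minus. fold c s. ring. }
  assert (Cg : cont g).
  { apply cont_mult; [exact Cf|]. apply cont_scal. apply cont_of_ex_derive; intros t; auto_derive; trivial. }
  assert (Pg : forall t, g (t + 2 * PI) = g t).
  { intros t. unfold g. rewrite Hf. do 2 f_equal.
    replace (INR n * (t + 2 * PI - th)) with (INR n * (t - th) + 2 * INR n * PI) by ring. apply cos_period. }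
  pose proof (RInt_period g (- PI) (- PI + th) Cg Pg) as E.
  replace (- PI + 2 * PI) with PI in E by ring. replace (- PI + th + 2 * PI) with (PI + th) in E by ring.
  rewrite E.
  transitivity (RInt (fun y => scal 1 (g (1 * y + th))) (- PI) PI).
  - pose proof (RInt_comp_lin (V := R_CompleteNormedModule) g 1 th (- PI) PI (ex_RInt_cont _ _ _ Cg)) as X.
    rewrite !Rmult_1_l in X. symmetry; exact X.
  - apply RInt_ext_R; intros y. rewrite !Rmult_1_l, (Rplus_comm y th). unfold g.
    replace (th + y - th) with y by ring. reflexivity.
Qed.

Lemma continuous_bound (f : R -> R) a b : a <= b -> cont f -> exists M, forall t, a <= t <= b -> Rabs (f t) <= M.
Proof.
  intros Hab Cf.
  assert (Ca : forall c, a <= c <= b -> continuity_pt (fun t => Rabs (f t)) c).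
  { intros c _. apply continuity_pt_filterlim, (continuous_comp f Rabs); [apply Cf|apply continuous_Rabs]. }
  destruct (continuity_ab_maj _ a b Hab Ca) as [m [Hm _]]. exists (Rabs (f m)). exact Hm.
Qed.

(** Continuity near the origin, a crude bound elsewhere. The shape is made for the Fejer kernel:
    [1 - cos t] cancels its peak by [Fej_mult], so the convolution integral is never split. *)
Lemma cos_modulus (h : R -> R) eps : cont h -> h 0 = 0 -> 0 < eps ->
  exists c, 0 <= c /\ forall t, - PI <= t <= PI -> Rabs (h t) <= eps + c * (1 - cos t).
Proof.
  intros Ch H0 He. pose proof PI_RGT_0 as Hpi.
  destruct (continuous_bound h (- PI) PI ltac:(lra) Ch) as [M HM].
  assert (L : locally 0 (fun t => Rabs (h t) < eps)).
  { pose proof (Ch 0 _ (locally_ball (h 0) (mkposreal eps He))) as L. unfold filtermap in L. revert L; apply filter_imp.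
    intros t Ht. change (Rabs (h t - h 0) < eps) in Ht. now rewrite H0, Rminus_0_r in Ht. }
  destruct L as [d Hd].
  set (e := Rmin d (PI / 2)).
  assert (He0 : 0 < e) by (unfold e; apply Rmin_glb_lt; [apply cond_pos|lra]).
  assert (Hep : e <= PI / 2) by apply Rmin_r.
  assert (Hed : e <= d) by apply Rmin_l.
  assert (Hc : 0 < 1 - cos e).
  { rewrite <- cos_0. pose proof (cos_decreasing_1 0 e); lra. }
  assert (M0 : 0 <= M) by (eapply Rle_trans; [apply Rabs_pos|apply (HM 0); lra]).
  exists (M / (1 - cos e)). split; [apply Rmult_le_pos; [assumption|left; now apply Rinv_0_lt_compat]|].
  intros t Ht. pose proof (COS_bound t) as [_ Hct].
  assert (Hq : 0 <= M / (1 - cos e)) by (apply Rmult_le_pos; [assumption|left; now apply Rinv_0_lt_compat]).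
  destruct (Rlt_le_dec (Rabs t) e) as [Hs|Hs].
  - assert (Rabs (h t) < eps).
    { apply Hd. change (Rabs (t - 0) < d). rewrite Rminus_0_r. lra. }
    assert (0 <= M / (1 - cos e) * (1 - cos t)) by (apply Rmult_le_pos; lra). lra.
  - assert (Hcc : cos t <= cos e).
    { assert (cos t = cos (Rabs t)) by (unfold Rabs; destruct (Rcase_abs t); [now rewrite cos_neg|reflexivity]).
      rewrite H. assert (Rabs t <= PI) by (now apply Rabs_le).
      destruct Hs as [Hs|<-]; [|lra]. left; apply cos_decreasing_1; lra. }
    specialize (HM t Ht).
    assert (M <= M / (1 - cos e) * (1 - cos t)).
    { replace M with (M / (1 - cos e) * (1 - cos e)) at 1 by (field; lra). apply Rmult_le_compat_l; lra. }
    lra.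
Qed.

Lemma cesaro_fourier (f : R -> R) th : cont f -> (forall t, f (t + 2 * PI) = f t) ->
  is_lim_seq (fun J => sum_f_R0 (fun M => sum_f_R0 (fpart f th) M) J / INR (S J)) (f th).
Proof.
  intros Cf Hf. pose proof PI_RGT_0 as Hpi.
  set (g := fun t => f (th + t)).
  assert (Cg : cont g).
  { intros s. apply (continuous_comp (fun t => th + t) f); [|apply Cf].
    apply continuous_ex_derive; auto_derive; trivial. }
  assert (E : forall J, sum_f_R0 (fun M => sum_f_R0 (fpart f th) M) J = / PI * RInt (fun t => g t * Fej J t) (- PI) PI).
  { intros J. rewrite (RInt_ext_R _ (fun t => sum_f_R0 (fun M => g t * Dir M t) J)).
    2: { intros; unfold Fej. rewrite scal_sum. apply sum_eq; intros; ring. }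
    rewrite (RInt_sum (fun M t => g t * Dir M t)) by (intros; apply cont_mult; [exact Cg|apply cont_Dir]).
    rewrite scal_sum. apply sum_eq; intros M _.
    rewrite (RInt_ext_R _ (fun t => sum_f_R0 (fun n => g t * (kap n * cos (INR n * t))) M)).
    2: { intros; unfold Dir. rewrite scal_sum. apply sum_eq; intros; ring. }
    rewrite (RInt_sum (fun n t => g t * (kap n * cos (INR n * t)))) by (intros; apply cont_mult; [exact Cg|apply cont_scal, cont_cos_n]).
    rewrite Rmult_comm, scal_sum. apply sum_eq; intros n _. rewrite fpart_integral by assumption. unfold g; ring. }
  apply is_lim_seq_spec. intros eps.
  assert (He : 0 < eps / 2) by (pose proof (cond_pos eps); lra).
  destruct (cos_modulus (fun t => g t - f th) (eps / 2)) as [c [Hc Hm]]; [| |exact He|].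
  { intros s. apply (continuous_Rminus g (fun _ => f th)); [apply Cg|apply continuous_const]. }
  { unfold g. rewrite Rplus_0_r. ring. }
  (* Beyond this index the remainder, at most [2 * PI * c / (PI * x)], is below [eps / 2]. *)
  destruct (nfloor_ex (Rmax 0 (2 * c / (eps / 2))) (Rmax_l _ _)) as [J0 [_ HJ0]].
  exists J0. intros J HJ. rewrite E.
  set (x := INR (S J)). assert (Hx : 0 < x) by (unfold x; apply lt_0_INR; lia).
  assert (HxJ : 2 * c / (eps / 2) < x) by (pose proof (Rmax_r 0 (2 * c / (eps / 2))); apply le_INR in HJ; unfold x; rewrite S_INR; lra).
  assert (CF := cont_Fej J).
  assert (CgF : cont (fun t => (g t - f th) * Fej J t)).
  { apply cont_mult; [|exact CF]. intros s. apply (continuous_Rminus g (fun _ => f th)); [apply Cg|apply continuous_const]. }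
  assert (E2 : / PI * RInt (fun t => g t * Fej J t) (- PI) PI / x - f th = / (PI * x) * RInt (fun t => (g t - f th) * Fej J t) (- PI) PI).
  { rewrite (RInt_ext_R (fun t => (g t - f th) * Fej J t) (fun t => minus (g t * Fej J t) (f th * Fej J t))).
    2: { intros; unfold minus, plus, opp; simpl; ring. }
    rewrite (RInt_minus (V := R_CompleteNormedModule)) by (apply ex_RInt_cont; first [now apply cont_mult|now apply cont_scal]).
    rewrite RInt_Rscal, RInt_Fej by exact CF. fold x. unfold minus, plus, opp; simpl. field. lra. }
  rewrite E2, Rabs_mult, Rabs_pos_eq by (left; apply Rinv_0_lt_compat; nra).
  apply (Rmult_lt_reg_l (PI * x)); [nra|]. rewrite <- Rmult_assoc, Rinv_r, Rmult_1_l by nra.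
  eapply Rle_lt_trans; [apply abs_RInt_le; [lra|now apply ex_RInt_cont]|].
  assert (C3 : cont (fun t => c * (/ 2 * (1 - cos (INR (S J) * t))))).
  { apply cont_of_ex_derive; intros t; auto_derive; trivial. }
  apply Rle_lt_trans with (RInt (fun t => plus (eps / 2 * Fej J t) (c * (/ 2 * (1 - cos (INR (S J) * t))))) (- PI) PI).
  - apply RInt_le; [lra| | |].
    + apply ex_RInt_cont. intros s; apply (continuous_comp (fun t => (g t - f th) * Fej J t) Rabs); [apply CgF|apply continuous_Rabs].
    + apply ex_RInt_cont. intros s. apply continuous_Rplus; [now apply cont_scal|apply C3].
    + intros t Ht. rewrite <- Fej_mult. unfold plus; simpl.
      rewrite Rabs_mult, (Rabs_pos_eq (Fej J t)) by apply Fej_nonneg.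
      specialize (Hm t ltac:(lra)). pose proof (Fej_nonneg J t). nra.
  - rewrite (RInt_plus (V := R_CompleteNormedModule)) by (apply ex_RInt_cont; first [now apply cont_scal|exact C3]).
    rewrite RInt_Rscal, RInt_Fej by exact CF. fold x.
    assert (RInt (fun t => c * (/ 2 * (1 - cos (x * t)))) (- PI) PI <= c * (2 * PI)).
    { apply Rle_trans with (RInt (fun _ => c) (- PI) PI).
      - apply RInt_le; [lra|now apply ex_RInt_cont|apply ex_RInt_const|].
        intros t _. pose proof (COS_bound (x * t)). nra.
      - rewrite RInt_const. unfold scal; simpl; unfold mult; simpl. lra. }
    assert (c * 2 < eps / 2 * x).
    { apply (Rmult_lt_reg_r (/ (eps / 2))); [now apply Rinv_0_lt_compat|].
      replace (eps / 2 * x * / (eps / 2)) with x by (field; lra).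
      replace (c * 2 * / (eps / 2)) with (2 * c / (eps / 2)) by (unfold Rdiv; ring). exact HxJ. }
    unfold plus; simpl. replace (eps : R) with (eps / 2 + eps / 2) by lra. nra.
Qed.

Lemma fpart_le f th n : Rabs (fpart f th n) <= Cmod (fcoef f n).
Proof.
  unfold fpart. eapply Rle_trans; [apply re_le_Cmod|]. rewrite Cmod_mult.
  replace (Cmod (cos (INR n * th), sin (INR n * th))) with 1; [lra|].
  unfold Cmod; cbn [fst snd]. rewrite <- sqrt_1 at 1. f_equal.
  pose proof (sin2_cos2 (INR n * th)) as E; unfold Rsqr in E. simpl; lra.
Qed.

(** Absolute summability gives convergence to some limit; the Cesaro means share it, and they tend
    to [f th]. *)
Lemma fourier_series f th : smooth_periodic f ->
  is_lim_seq (fun J => sum_f_R0 (fpart f th) J) (f th).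
Proof.
  intros Hf. destruct (fcoef_summable f Hf) as [Cf [_ HCf]].
  destruct (smooth_periodic_derive f Hf) as [E _].
  assert (S1 : ex_series (fun n => Cmod (fcoef f n))).
  {
    destruct (ex_finite_lim_seq_incr (fun J => sum_f_R0 (fun n => Cmod (fcoef f n)) J) Cf) as [l Hl].
    - intros J; simpl. pose proof (Cmod_ge_0 (fcoef f (S J))). lra.
    - intros J. eapply Rle_trans; [|apply (HCf J)]. apply sum_Rle; intros n _.
      pose proof (Cmod_ge_0 (fcoef f n)). pose proof (jap_ge_1 (INR n)).
      assert (1 <= jap (INR n) ^ 3) by now apply pow_R1_Rle. nra.
    - exists l. apply (is_lim_seq_ext (fun J => sum_f_R0 (fun n => Cmod (fcoef f n)) J) _ l); [|exact Hl].
      intros J; symmetry; apply sum_n_Reals. }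
  assert (S2 : ex_series (fpart f th)).
  { apply (ex_series_le (V := R_CompleteNormedModule) _ (fun n => Cmod (fcoef f n))); [|exact S1].
    intros n; apply fpart_le. }
  destruct S2 as [l Hl].
  assert (Hl' : is_lim_seq (fun J => sum_f_R0 (fpart f th) J) l).
  { apply (is_lim_seq_ext (sum_n (fpart f th)) _ l); [|exact Hl]. intros J; apply sum_n_Reals. }
  assert (El : Finite l = Finite (f th)); [|rewrite <- El; exact Hl'].
  pose proof (cesaro_fourier f th (cont_of_ex_derive f E) (proj2 Hf)) as H1.
  pose proof (Cesaro_1 _ _ (proj1 (is_lim_seq_Reals _ _) Hl')) as H2.
  apply is_lim_seq_Reals, (is_lim_seq_incr_1 _ l) in H2. simpl pred in H2.
  rewrite <- (is_lim_seq_unique _ _ H1). symmetry. apply is_lim_seq_unique, H2.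
Qed.

(** * The solution *)

Definition gps k bd (t : tree) : R -> C := ps (sol k bd t).
Definition gph k bd (t : tree) : R -> C := ph (sol k bd t).
Definition gom k bd (t : tree) : R -> C := om (sol k bd t).
Definition gch k bd (t : tree) : R -> C := ch (sol k bd t).
Definition gqq k bd (t : tree) : R -> C := qq (sol k bd t).
(** [gphs] and [gqs] are the [s]-derivatives of [gph] and [gqq], read off from the mode
    equations. *)
Definition gphs k bd (t : tree) (s : R) : C :=
  (RtoC (fr t ^ 2) * gps k bd t s - e2 (gom k bd t) s)%C.
Definition gqs k bd (t : tree) (s : R) : C :=
  (RtoC (lam k) * gom k bd t s - inth (gom k bd) t s - srcG k bd t s)%C.

(** * Domination of all the fields by the majorant series *)

Section Flow.

Context (k : R) (bd : nat -> C) (XM : R).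
Context (Hk : 4 <= k) (HX : forall j, Tsum j (size k bd) <= XM).

Local Notation N := (size k bd).
Local Notation w := (wt k bd).

(** One constant for all fields. Its size is immaterial: it serves convergence and regularity, while
    the final estimates use the sharper bounds on single modes. *)
Let B := 10 * k * lam k.
Let N0 : forall t, 0 <= N t := fun t => size_nonneg k bd t Hk.
Let good_t := fun t => sol_good k bd t Hk.

Lemma lam_ge : 256 <= lam k.
Proof. unfold lam; nra. Qed.

(** Three powers of [jap] are provided because a velocity of class [C^2] takes three angular
    derivatives of [psi]. *)
Lemma wt_pow_le t : w t <= N t /\ jap (fr t) * w t <= N t /\ jap (fr t) ^ 2 * w t <= N t /\ jap (fr t) ^ 3 * w t = N t.
Proof.
  rewrite (size_wt k bd t). pose proof (wt_nonneg k bd t Hk) as W. pose proof (jap_ge_1 (fr t)) as J.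
  set (j := jap (fr t)) in *. assert (1 <= j ^ 2) by nra. assert (1 <= j ^ 3) by (simpl; nra).
  repeat split; try ring.
  - nra.
  - replace (w t * j ^ 3) with (j * w t * j ^ 2) by ring. assert (0 <= j * w t) by nra. nra.
  - replace (w t * j ^ 3) with (j ^ 2 * w t * j) by ring. assert (0 <= j ^ 2 * w t) by nra. nra.
Qed.

Lemma exp_neg_le_1 a s : 0 <= a -> 0 <= s -> exp (- a * s) <= 1.
Proof. intros. rewrite <- exp_0. apply exp_le_compat. nra. Qed.

Lemma B_ge : 2 <= B /\ 9 * k * lam k <= B /\ 3 * lam k <= B /\ 1 + 4 * k <= B.
Proof. unfold B; pose proof lam_ge; repeat split; nra. Qed.

Lemma Cmod_inth_le (g : tree -> R -> C) t s c :
  Cmod (g t s) <= c -> Cmod (inth g t s) <= jap (fr t) * c.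
Proof.
  intros H. unfold inth. rewrite Cmod_mult, Cmod_Cin.
  apply Rmult_le_compat; [apply Rabs_pos|apply Cmod_ge_0|apply jap_Rabs|exact H].
Qed.

Lemma gps_le t s : 0 <= s -> Cmod (gps k bd t s) <= w t.
Proof.
  intros Hs. eapply Rle_trans; [apply (g_psle (good_t t) s Hs)|].
  pose proof (wt_nonneg k bd t Hk) as W.
  pose proof (exp_neg_le_1 1 s ltac:(lra) Hs) as E. replace (- (1) * s) with (- s) in E by ring.
  assert (2 * w t / k <= w t).
  { apply (Rmult_le_reg_r k); [lra|]. replace (2 * w t / k * k) with (2 * w t) by (field; lra). nra. }
  assert (0 <= 2 * w t / k) by (apply Rmult_le_pos; [lra|left; apply Rinv_0_lt_compat; lra]).
  nra.
Qed.

Lemma gph_le t s : 0 <= s -> Cmod (gph k bd t s) <= 2 * (jap (fr t) * w t).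
Proof. intros Hs. rewrite <- Rmult_assoc. apply (g_phle (good_t t) s Hs). Qed.

Lemma gom_le_exp t s : 0 <= s -> Cmod (gom k bd t s) <= exp (- k * s) * (4 * k * (jap (fr t) * w t)).
Proof.
  intros Hs. eapply Rle_trans; [apply (g_omle (good_t t) s Hs)|].
  right; ring.
Qed.

Lemma jw_nonneg t : 0 <= jap (fr t) * w t.
Proof. pose proof (wt_nonneg k bd t Hk). pose proof (jap_ge_1 (fr t)). nra. Qed.

Lemma ge2om_le t s : 0 <= s -> Cmod (e2 (gom k bd t) s) <= 4 * k * (jap (fr t) * w t).
Proof.
  intros Hs. rewrite Cmod_e2. pose proof (gom_le_exp t s Hs) as H. pose proof (jw_nonneg t).
  apply Rle_trans with (exp (2 * s) * (exp (- k * s) * (4 * k * (jap (fr t) * w t)))).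
  - apply Rmult_le_compat_l; [left; apply exp_pos|exact H].
  - rewrite <- Rmult_assoc, <- exp_plus. replace (2 * s + - k * s) with (- (k - 2) * s) by ring.
    pose proof (exp_neg_le_1 (k - 2) s ltac:(lra) Hs). assert (0 <= 4 * k * (jap (fr t) * w t)) by nra. nra.
Qed.

Lemma gom_le t s : 0 <= s -> Cmod (gom k bd t s) <= 4 * k * (jap (fr t) * w t).
Proof.
  intros Hs. eapply Rle_trans; [apply (gom_le_exp t s Hs)|]. pose proof (jw_nonneg t).
  pose proof (exp_neg_le_1 k s ltac:(lra) Hs). assert (0 <= 4 * k * (jap (fr t) * w t)) by nra. nra.
Qed.

Lemma N_Node e t1 t2 : N t1 * N t2 = lam k / 432 * N (Node e t1 t2).
Proof. cbn [size]. pose proof lam_ge. field. lra. Qed.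

Lemma srcA_le t s : 0 <= s -> Cmod (srcA k bd t s) <= lam k * N t.
Proof.
  intros Hs. pose proof lam_ge as Hl. pose proof (N0 t) as Nt.
  destruct t as [n|e t1 t2]; cbn [srcA].
  - rewrite Cmod_0. nra.
  - eapply Rle_trans; [apply (nodeA_le _ _ _ _ _ _ _ _ e Hk (good_t t1) s Hs)|].
    pose proof (gom_le t2 s Hs) as H. pose proof (jw_nonneg t1) as J1.
    destruct (wt_pow_le t1) as (_ & H1 & _). destruct (wt_pow_le t2) as (_ & H2 & _).
    pose proof (N0 t1). pose proof (N0 t2). pose proof (jw_nonneg t2) as J2.
    assert (Q : 0 <= jap (fr t1) * w t1 / k) by (apply Rmult_le_pos; [assumption|left; apply Rinv_0_lt_compat; lra]).
    apply Rle_trans with (jap (fr t1) * w t1 / k * (4 * k * (jap (fr t2) * w t2))).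
    + apply Rmult_le_compat_l; [exact Q|exact H].
    + replace (jap (fr t1) * w t1 / k * (4 * k * (jap (fr t2) * w t2))) with (4 * ((jap (fr t1) * w t1) * (jap (fr t2) * w t2))) by (field; lra).
      assert ((jap (fr t1) * w t1) * (jap (fr t2) * w t2) <= N t1 * N t2) by (apply Rmult_le_compat; assumption).
      rewrite (N_Node e) in *. nra.
Qed.

Lemma srcG_le t s : 0 <= s -> Cmod (srcG k bd t s) <= k * lam k * N t.
Proof.
  intros Hs. pose proof lam_ge as Hl. pose proof (N0 t) as Nt.
  assert (Hkl : 0 <= k * lam k) by nra.
  destruct t as [n|e t1 t2]; cbn [srcG].
  - rewrite Cmod_0. now apply Rmult_le_pos.
  - eapply Rle_trans; [apply (nodeG_le _ _ _ _ _ _ _ _ e (good_t t1) s Hs)|].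
    pose proof (gom_le t2 s Hs) as H. pose proof (jw_nonneg t1) as J1.
    destruct (wt_pow_le t1) as (_ & H1 & _). destruct (wt_pow_le t2) as (_ & H2 & _).
    pose proof (N0 t1). pose proof (N0 t2). pose proof (jw_nonneg t2) as J2.
    apply Rle_trans with (jap (fr t1) * w t1 * (4 * k * (jap (fr t2) * w t2))).
    + apply Rmult_le_compat_l; [exact J1|exact H].
    + replace (jap (fr t1) * w t1 * (4 * k * (jap (fr t2) * w t2))) with (4 * k * ((jap (fr t1) * w t1) * (jap (fr t2) * w t2))) by ring.
      assert ((jap (fr t1) * w t1) * (jap (fr t2) * w t2) <= N t1 * N t2) by (apply Rmult_le_compat; assumption).
      rewrite (N_Node e) in *. assert (0 <= k * (lam k * N (Node e t1 t2))) by (apply Rmult_le_pos; nra). nra.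
Qed.

Lemma L1_srcG t : L1_le 0 (fun s => Cmod (srcG k bd t s)) (lam k * N t).
Proof.
  pose proof lam_ge as Hl. pose proof (N0 t) as Nt.
  destruct t as [n|e t1 t2]; cbn [srcG].
  - apply L1_le_weaken with 0; [nra|apply L1_le_0].
  - apply L1_le_weaken with (jap (fr t1) * w t1 * w t2).
    + destruct (wt_pow_le t1) as (_ & H1 & _). destruct (wt_pow_le t2) as (H2 & _).
      pose proof (jw_nonneg t1). pose proof (wt_nonneg k bd t2 Hk).
      assert (jap (fr t1) * w t1 * w t2 <= N t1 * N t2) by (apply Rmult_le_compat; assumption).
      rewrite (N_Node e) in *. nra.
    + exact (L1_nodeG _ _ _ _ _ _ _ _ _ _ _ _ _ e Hk (good_t t1) (good_t t2)).
Qed.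

Lemma gch_le t s : 0 <= s -> Cmod (gch k bd t s) <= 2 * lam k * N t.
Proof.
  intros Hs. pose proof lam_ge as Hl. pose proof (N0 t) as Nt.
  destruct (g_chle (good_t t) s Hs) as [H|H].
  - eapply Rle_trans; [exact H|]. destruct (wt_pow_le t) as (_ & _ & H2 & _).
    pose proof (exp_neg_le_1 k s ltac:(lra) Hs). pose proof (exp_pos (- k * s)).
    assert (0 <= jap (fr t) ^ 2 * w t) by (apply Rmult_le_pos; [apply pow2_ge_0|now apply wt_nonneg]).
    replace (2 * lam k * jap (fr t) ^ 2 * w t) with (2 * lam k * (jap (fr t) ^ 2 * w t)) by ring.
    assert (0 <= 2 * lam k * (jap (fr t) ^ 2 * w t)) by nra. nra.
  - unfold gch. rewrite H. pose proof (srcA_le t s Hs). nra.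
Qed.

(** For [n <> 0] the angular equation controls [|n|] times the pressure; for [n = 0] it degenerates,
    and the integral in [s] is estimated instead. *)
Lemma gqq_le t s : 0 <= s -> Cmod (gqq k bd t s) <= 3 * lam k * N t.
Proof.
  intros Hs. pose proof lam_ge as Hl. pose proof (N0 t) as Nt.
  destruct (Z.eq_dec (idx t) 0) as [E|E].
  - assert (Ef : fr t = 0) by (unfold fr; now rewrite E).
    eapply Rle_trans; [apply (g_q0 (good_t t) _ Ef (L1_srcG t) s Hs)|].
    destruct (wt_pow_le t) as (H1 & _). nra.
  - assert (Hn : 1 <= Rabs (fr t)) by (unfold fr; rewrite <- abs_IZR; apply IZR_le; lia).
    pose proof (f_equal Cmod (g_qth (good_t t) s)) as H.
    rewrite Cmod_mult, Cmod_Cin in H. fold (gqq k bd t s) in H.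
    assert (Cmod (ch (sol k bd t) s - srcA k bd t s) <= 3 * lam k * N t).
    { eapply Rle_trans; [apply Cmod_triangle|]. rewrite Cmod_opp.
      pose proof (gch_le t s Hs) as E1. unfold gch in E1. pose proof (srcA_le t s Hs). nra. }
    fold (gqq k bd t) in H. change (qq (sol k bd t) s) with (gqq k bd t s) in H.
    pose proof (Cmod_ge_0 (gqq k bd t s)). nra.
Qed.

Lemma dom_weaken c c' g : c <= c' -> dom N c g -> dom N c' g.
Proof. intros H D t s Hs. specialize (D t s Hs). pose proof (N0 t). nra. Qed.

Ltac domB c := apply (dom_weaken c); [pose proof B_ge; lra|]; intros t s Hs;
  destruct (wt_pow_le t) as (W0 & W1 & W2 & W3); pose proof (wt_nonneg k bd t Hk) as WP;
  pose proof (jap_ge_1 (fr t)) as JP; pose proof (N0 t) as NP; pose proof lam_ge as LP.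

Lemma dom_inth_ps : dom N B (inth (gps k bd)).
Proof. domB 1. pose proof (Cmod_inth_le (gps k bd) t s _ (gps_le t s Hs)). lra. Qed.

Lemma dom_inth2_ps : dom N B (inth (inth (gps k bd))).
Proof.
  domB 1. pose proof (Cmod_inth_le (inth (gps k bd)) t s _ (Cmod_inth_le (gps k bd) t s _ (gps_le t s Hs))). nra.
Qed.

Lemma dom_inth3_ps : dom N B (inth (inth (inth (gps k bd)))).
Proof.
  domB 1. pose proof (Cmod_inth_le (inth (inth (gps k bd))) t s _ (Cmod_inth_le (inth (gps k bd)) t s _ (Cmod_inth_le (gps k bd) t s _ (gps_le t s Hs)))). nra.
Qed.

Lemma dom_ph : dom N B (gph k bd).
Proof. domB 2. pose proof (gph_le t s Hs). lra. Qed.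

Lemma dom_inth_ph : dom N B (inth (gph k bd)).
Proof. domB 2. pose proof (Cmod_inth_le (gph k bd) t s _ (gph_le t s Hs)). nra. Qed.

Lemma dom_inth2_ph : dom N B (inth (inth (gph k bd))).
Proof.
  domB 2. pose proof (Cmod_inth_le (inth (gph k bd)) t s _ (Cmod_inth_le (gph k bd) t s _ (gph_le t s Hs))). nra.
Qed.

Lemma gphs_le t s : 0 <= s -> Cmod (gphs k bd t s) <= jap (fr t) ^ 2 * w t + 4 * k * (jap (fr t) * w t).
Proof.
  intros Hs. unfold gphs. eapply Rle_trans; [apply Cmod_triangle|]. rewrite Cmod_opp.
  apply Rplus_le_compat; [|now apply ge2om_le].
  rewrite Cmod_mult, Cmod_R. apply Rmult_le_compat; [apply Rabs_pos|apply Cmod_ge_0| |now apply gps_le].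
  rewrite <- RPow_abs. apply pow_incr. split; [apply Rabs_pos|apply jap_Rabs].
Qed.

Lemma dom_phs : dom N B (gphs k bd).
Proof.
  domB (1 + 4 * k). pose proof (gphs_le t s Hs). nra.
Qed.

Lemma dom_inth_phs : dom N B (inth (gphs k bd)).
Proof.
  domB (1 + 4 * k). pose proof (Cmod_inth_le (gphs k bd) t s _ (gphs_le t s Hs)). nra.
Qed.

Lemma dom_om : dom N B (gom k bd).
Proof. domB (4 * k). pose proof (gom_le t s Hs). nra. Qed.

Lemma dom_inth_om : dom N B (inth (gom k bd)).
Proof. domB (4 * k). pose proof (Cmod_inth_le (gom k bd) t s _ (gom_le t s Hs)). nra. Qed.

Lemma dom_ch : dom N B (gch k bd).
Proof. domB (3 * lam k). pose proof (gch_le t s Hs). nra. Qed.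

Lemma dom_srcA : dom N B (srcA k bd).
Proof. domB (3 * lam k). pose proof (srcA_le t s Hs). nra. Qed.

Lemma dom_srcG : dom N B (srcG k bd).
Proof. domB (9 * k * lam k). pose proof (srcG_le t s Hs). assert (0 <= k * lam k * N t) by (apply Rmult_le_pos; nra). nra. Qed.

Lemma dom_qq : dom N B (gqq k bd).
Proof. domB (3 * lam k). exact (gqq_le t s Hs). Qed.

Lemma inth_qq t s : inth (gqq k bd) t s = (gch k bd t s - srcA k bd t s)%C.
Proof. apply (g_qth (good_t t) s). Qed.

Lemma dom_inth_qq : dom N B (inth (gqq k bd)).
Proof.
  domB (3 * lam k). rewrite inth_qq. eapply Rle_trans; [apply Cmod_triangle|]. rewrite Cmod_opp.
  pose proof (gch_le t s Hs). pose proof (srcA_le t s Hs). lra.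
Qed.

Lemma dom_qs : dom N B (gqs k bd).
Proof.
  domB (9 * k * lam k). unfold gqs.
  eapply Rle_trans; [apply Cmod_triangle|]. rewrite Cmod_opp.
  pose proof (Cmod_triangle (RtoC (lam k) * gom k bd t s) (- inth (gom k bd) t s)) as T.
  rewrite Cmod_opp, Cmod_mult, Cmod_R, Rabs_pos_eq in T by lra.
  pose proof (gom_le t s Hs) as E1. pose proof (Cmod_inth_le (gom k bd) t s _ E1) as E2.
  pose proof (srcG_le t s Hs) as E3.
  assert (E1' : Cmod (gom k bd t s) <= 4 * k * N t) by nra.
  assert (E2' : Cmod (inth (gom k bd) t s) <= 4 * k * N t) by nra.
  assert (E4 : lam k * Cmod (gom k bd t s) <= lam k * (4 * k * N t)) by (apply Rmult_le_compat_l; lra).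
  assert (0 <= k * N t) by nra.
  unfold Cminus in *. nra.
Qed.

Lemma Cder_inth g g' t s : Cderive (g t) s (g' t s) -> Cderive (inth g t) s (inth g' t s).
Proof. intros; now apply Cderive_scal. Qed.

Lemma Cder_inth_ps t s : Cderive (inth (gps k bd) t) s (inth (gph k bd) t s).
Proof. exact (Cderive_inps _ _ _ _ _ _ _ s (good_t t)). Qed.
Lemma Cder_ph t s : Cderive (gph k bd t) s (gphs k bd t s).
Proof. exact (g_ph (good_t t) s). Qed.
Lemma Cder_om t s : Cderive (gom k bd t) s (gch k bd t s).
Proof. exact (g_om (good_t t) s). Qed.
Lemma Cder_qq t s : Cderive (gqq k bd t) s (gqs k bd t s).
Proof. exact (g_q (good_t t) s). Qed.

Lemma cont_ps t : Ccontinuous (gps k bd t).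
Proof. apply (good_continuous _ _ _ _ _ _ _ (good_t t)). Qed.
Lemma cont_ph t : Ccontinuous (gph k bd t).
Proof. apply (good_continuous _ _ _ _ _ _ _ (good_t t)). Qed.
Lemma cont_om t : Ccontinuous (gom k bd t).
Proof. apply (good_continuous _ _ _ _ _ _ _ (good_t t)). Qed.
Lemma cont_ch t : Ccontinuous (gch k bd t).
Proof. apply (good_continuous _ _ _ _ _ _ _ (good_t t)). Qed.
Lemma cont_phs t : Ccontinuous (gphs k bd t).
Proof.
  apply Ccontinuous_minus; [|apply Ccontinuous_e2, cont_om].
  apply Ccontinuous_mult; [apply Ccontinuous_const|apply cont_ps].
Qed.
Lemma cont_srcG t : Ccontinuous (srcG k bd t).
Proof.
  destruct t as [n|e t1 t2]; [apply Ccontinuous_const|].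
  exact (nodeG_continuous _ _ _ _ _ _ _ _ _ _ _ _ _ e (good_t t1) (good_t t2)).
Qed.
Lemma cont_qs t : Ccontinuous (gqs k bd t).
Proof.
  apply Ccontinuous_minus; [|apply cont_srcG]. apply Ccontinuous_minus; [|apply inth_continuous, cont_om].
  apply Ccontinuous_mult; [apply Ccontinuous_const|apply cont_om].
Qed.

End Flow.

Ltac Cn_tac :=
  lazymatch goal with
  | |- Cn ?n (fun x y => @?f x y + @?g x y) => apply (Cn_plus n f g); Cn_tac
  | |- Cn ?n (fun x y => @?f x y - @?g x y) => apply (Cn_plus n f (fun x y => - g x y)); Cn_tac
  | |- Cn ?n (fun x y => @?f x y * @?g x y) => apply (Cn_mult n f g); Cn_tac
  | |- Cn ?n (fun x y => - @?f x y) => apply (Cn_opp n f); Cn_tac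
  | |- Cn _ (fun x y => ir2 x y) => apply Cn_ir2
  | |- Cn _ (fun x _ => x) => apply Cn_x
  | |- Cn _ (fun _ y => y) => apply Cn_y
  | |- Cn _ (fun _ _ => _) => first [assumption | apply Cn_const]
  | |- _ => assumption
  end.

Lemma is_derive_eq (f : R -> R) (x l l' : R) : is_derive f x l -> l = l' -> is_derive f x l'.
Proof. now intros H <-. Qed.

Ltac derive_tac :=
  lazymatch goal with
  | |- is_derive (fun z => @?f z + @?g z) _ _ => apply (is_derive_Rplus f g); derive_tac
  | |- is_derive (fun z => @?f z - @?g z) _ _ => apply (is_derive_Rminus f g); derive_tac
  | |- is_derive (fun z => - @?f z) _ _ => apply (is_derive_Ropp f); derive_tac
  | |- is_derive (fun z => @?f z * @?g z) _ _ => apply (is_derive_Rmult f g); derive_tac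
  | |- is_derive (fun z => z) _ _ => apply is_derive_Rid
  | |- is_derive (fun _ => ?c) _ _ => apply is_derive_Rconst
  | |- _ => eassumption
  end.

(** * From gradients in logarithmic polar coordinates to the Navier-Stokes system *)

Section Potentials.

(* [U], [V] stand for the two components of the gradient of the stream function
   perturbation in the coordinates [ln r], [theta]; [W] is the vorticity and [Q] the
   Bernoulli pressure. *)
Context (L : R) (U V W Q M1 M2 Ws Wt : R -> R -> R).

Definition grad_x (Gs Gt : R -> R -> R) (x y : R) : R := x * ir2 x y * Gs x y + - y * ir2 x y * Gt x y.
Definition grad_y (Gs Gt : R -> R -> R) (x y : R) : R := y * ir2 x y * Gs x y + x * ir2 x y * Gt x y.

Definition log_polar_gradient (G Gs Gt : R -> R -> R) : Prop :=
  forall x y, exterior x y ->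
    is_derive (fun z => G z y) x (grad_x Gs Gt x y) /\ is_derive (fun z => G x z) y (grad_y Gs Gt x y).

(** [psi_ss], as given by the Poisson equation. *)
Definition Vs (x y : R) : R := - M2 x y + - ((x * x + y * y) * W x y).
(** [Qs] and [Qt] express the momentum equation in these coordinates. Their compatibility is the
    vorticity equation, which is therefore contained in the existence of [Q]. *)
Definition Qs (x y : R) : R := L * W x y - Wt x y - V x y * W x y.
Definition Qt (x y : R) : R := Ws x y - U x y * W x y.

Context (CM1 : Cn 1 M1) (CM2 : Cn 1 M2) (CW : Cn 1 W) (CWs : Cn 0 Ws) (CWt : Cn 0 Wt)
  (CU : Cn 0 U) (CV : Cn 0 V) (CQ : Cn 0 Q)
  (HU : log_polar_gradient U M1 M2) (HV : log_polar_gradient V Vs M1)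
  (HW : log_polar_gradient W Ws Wt) (HQ : log_polar_gradient Q Qs Qt).

Definition u1 (x y : R) : R := (x * U x y + - (y * (L + - V x y))) * ir2 x y.
Definition u2 (x y : R) : R := (y * U x y + x * (L + - V x y)) * ir2 x y.
Definition prs (x y : R) : R := Q x y + - (/ 2 * (u1 x y * u1 x y + u2 x y * u2 x y)).

(** Only the [x]-derivatives are named: the others are [u1_y = u2_x - W] and [u2_y = - u1_x], which
    express vorticity and incompressibility. The Laplacian is then found without expanding second
    derivatives. *)
Definition u1x (x y : R) : R :=
  (U x y + x * grad_x M1 M2 x y + y * grad_x Vs M1 x y) * ir2 x y +
  - (2 * x * (u1 x y * ir2 x y)).
Definition u2x (x y : R) : R :=
  (y * grad_x M1 M2 x y + (L + - V x y) + - (x * grad_x Vs M1 x y)) * ir2 x y +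
  - (2 * x * (u2 x y * ir2 x y)).

Lemma Cn_grad n Gs Gt : Cn n Gs -> Cn n Gt -> Cn n (grad_x Gs Gt) /\ Cn n (grad_y Gs Gt).
Proof. intros H1 H2; split; unfold grad_x, grad_y; Cn_tac. Qed.

Lemma Cn_S_gradient n G Gs Gt : Cn n G -> log_polar_gradient G Gs Gt -> Cn n Gs -> Cn n Gt -> Cn (S n) G.
Proof.
  intros HG H H1 H2. destruct (Cn_grad n Gs Gt H1 H2).
  split; [intros; now apply (Cn_cont2 n)|]. exists (grad_x Gs Gt), (grad_y Gs Gt). auto.
Qed.

Lemma Cn_Vs : Cn 1 Vs.
Proof. unfold Vs; Cn_tac. Qed.

Lemma Cn_U : Cn 2 U.
Proof. apply (Cn_S_gradient 1 U M1 M2); try assumption. apply (Cn_S_gradient 0 U M1 M2); try assumption; now apply Cn_pred. Qed.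
Lemma Cn_V : Cn 2 V.
Proof.
  apply (Cn_S_gradient 1 V Vs M1); try assumption; [|apply Cn_Vs].
  apply (Cn_S_gradient 0 V Vs M1); try assumption; apply Cn_pred; [apply Cn_Vs|exact CM1].
Qed.


Lemma Cn_u1 : Cn 2 u1.
Proof. pose proof Cn_U. pose proof Cn_V. unfold u1; Cn_tac. Qed.
Lemma Cn_u2 : Cn 2 u2.
Proof. pose proof Cn_U. pose proof Cn_V. unfold u2; Cn_tac. Qed.


Lemma is_derive_u1 x y : exterior x y ->
  is_derive (fun z => u1 z y) x (u1x x y) /\ is_derive (fun z => u1 x z) y (u2x x y - W x y).
Proof.
  intros H. destruct (HU x y H) as [Ux Uy], (HV x y H) as [Vx Vy], (is_derive_ir2 x y H) as [Ix Iy].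
  pose proof (exterior_pos _ _ H) as Hp.
  split; unfold u1; eapply is_derive_eq; [derive_tac| |derive_tac|].
  - unfold u1x, u1. ring.
  - unfold u2x, u2, grad_x, grad_y, Vs, ir2. field; simpl in *; lra.
Qed.

Lemma is_derive_u2 x y : exterior x y ->
  is_derive (fun z => u2 z y) x (u2x x y) /\ is_derive (fun z => u2 x z) y (- u1x x y).
Proof.
  intros H. destruct (HU x y H) as [Ux Uy], (HV x y H) as [Vx Vy], (is_derive_ir2 x y H) as [Ix Iy].
  pose proof (exterior_pos _ _ H) as Hp.
  split; unfold u2; eapply is_derive_eq; [derive_tac| |derive_tac|].
  - unfold u2x, u2. ring.
  - unfold u1x, u1, grad_x, grad_y, Vs, ir2. field; simpl in *; lra.
Qed.

Lemma Cn_u1x : Cn 1 u1x.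
Proof.
  pose proof (Cn_pred _ _ Cn_U). pose proof (Cn_pred _ _ Cn_V). pose proof (Cn_pred _ _ Cn_u1).
  destruct (Cn_grad 1 M1 M2 CM1 CM2) as [G1 _], (Cn_grad 1 Vs M1 Cn_Vs CM1) as [G2 _].
  unfold u1x; Cn_tac.
Qed.

Lemma Cn_u2x : Cn 1 u2x.
Proof.
  pose proof (Cn_pred _ _ Cn_U). pose proof (Cn_pred _ _ Cn_V). pose proof (Cn_pred _ _ Cn_u2).
  destruct (Cn_grad 1 M1 M2 CM1 CM2) as [G1 _], (Cn_grad 1 Vs M1 Cn_Vs CM1) as [G2 _].
  unfold u2x; Cn_tac.
Qed.

Lemma Cn_Qs : Cn 0 Qs.
Proof. pose proof (Cn_pred _ _ CW). unfold Qs; Cn_tac. Qed.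
Lemma Cn_Qt : Cn 0 Qt.
Proof. pose proof (Cn_pred _ _ CW). unfold Qt; Cn_tac. Qed.

Lemma Cn_prs : Cn 1 prs.
Proof.
  pose proof (Cn_pred _ _ Cn_u1). pose proof (Cn_pred _ _ Cn_u2).
  pose proof (Cn_S_gradient 0 Q Qs Qt CQ HQ Cn_Qs Cn_Qt). unfold prs; Cn_tac.
Qed.

(** Lamb form of the momentum equation: the gradient of [Q] is [W] times the velocity turned by a
    right angle, plus the Laplacian of the velocity. *)
Lemma Q_gradient x y : exterior x y ->
  is_derive (fun z => Q z y) x (u2 x y * W x y - grad_y Ws Wt x y) /\
  is_derive (fun z => Q x z) y (grad_x Ws Wt x y - u1 x y * W x y).
Proof.
  intros H. destruct (HQ x y H) as [H1 H2]. split.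
  - replace (_ - _) with (grad_x Qs Qt x y); [exact H1|]. unfold grad_x, grad_y, Qs, Qt, u2; ring.
  - replace (_ - _) with (grad_y Qs Qt x y); [exact H2|]. unfold grad_x, grad_y, Qs, Qt, u1; ring.
Qed.

Lemma Derive_exterior_x (f g : R -> R -> R) x y : exterior x y ->
  (forall x y, exterior x y -> f x y = g x y) -> Derive (fun z => f z y) x = Derive (fun z => g z y) x.
Proof.
  intros H E. apply Derive_ext_loc. destruct (exterior_open_x x y H) as [r [Hr Hz]].
  exists (mkposreal r Hr). intros z Bz. now apply E, Hz.
Qed.
Lemma Derive_exterior_y (f g : R -> R -> R) x y : exterior x y ->
  (forall x y, exterior x y -> f x y = g x y) -> Derive (fun z => f x z) y = Derive (fun z => g x z) y.
Proof.
  intros H E. apply Derive_ext_loc. destruct (exterior_open_y x y H) as [r [Hr Hz]].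
  exists (mkposreal r Hr). intros z Bz. now apply E, Hz.
Qed.

Lemma Schwarz_exterior (f fx fy fxy fyx : R -> R -> R) :
  (forall x y, exterior x y -> is_derive (fun z => f z y) x (fx x y) /\ is_derive (fun z => f x z) y (fy x y)) ->
  (forall x y, exterior x y -> is_derive (fun z => fx x z) y (fxy x y)) ->
  (forall x y, exterior x y -> is_derive (fun z => fy z y) x (fyx x y)) ->
  Cn 0 fxy -> Cn 0 fyx -> forall x y, exterior x y -> fxy x y = fyx x y.
Proof.
  intros Hf Hxy Hyx C1 C2 x y H.
  assert (E1 : forall u v, exterior u v -> Derive (fun z => f z v) u = fx u v) by (intros; apply is_derive_unique, Hf; assumption).
  assert (E2 : forall u v, exterior u v -> Derive (fun z => f u z) v = fy u v) by (intros; apply is_derive_unique, Hf; assumption).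
  assert (D1 : forall u v, exterior u v -> is_derive (fun z => Derive (fun t => f t z) u) v (fxy u v)).
  { intros u v Huv. apply is_derive_ext_loc with (fun z => fx u z); [|now apply Hxy].
    destruct (exterior_open_y u v Huv) as [r [Hr Hz]].
    exists (mkposreal r Hr). intros z Bz. symmetry; now apply E1, Hz. }
  assert (D2 : forall u v, exterior u v -> is_derive (fun z => Derive (fun t => f z t) v) u (fyx u v)).
  { intros u v Huv. apply is_derive_ext_loc with (fun z => fy z v); [|now apply Hyx].
    destruct (exterior_open_x u v Huv) as [r [Hr Hz]].
    exists (mkposreal r Hr). intros z Bz. symmetry; now apply E2, Hz. }
  rewrite <- (is_derive_unique _ _ _ (D1 x y H)), <- (is_derive_unique _ _ _ (D2 x y H)).
  symmetry. apply Schwarz.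
  - generalize (exterior_locally_2d x y H). apply locally_2d_impl, locally_2d_forall. intros u v Huv.
    destruct (Hf u v Huv) as [A1 A2]. repeat split; eexists; [exact A1|exact A2|now apply D2|now apply D1].
  - apply continuity_2d_pt_ext_loc with fyx; [|apply continuity_2d_pt_filterlim; now apply C2].
    generalize (exterior_locally_2d x y H). apply locally_2d_impl, locally_2d_forall. intros u v Huv.
    symmetry; now apply is_derive_unique, D2.
  - apply continuity_2d_pt_ext_loc with fxy; [|apply continuity_2d_pt_filterlim; now apply C1].
    generalize (exterior_locally_2d x y H). apply locally_2d_impl, locally_2d_forall. intros u v Huv.
    symmetry; now apply is_derive_unique, D1.
Qed.

Lemma navier_stokes_of_potentials : navier_stokes_exterior u1 u2 prs.
Proof.
  split; [apply Cn_class_C, Cn_u1|]. split; [apply Cn_class_C, Cn_u2|]. split; [apply Cn_class_C, Cn_prs|].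
  destruct Cn_u1x as (_ & ax & ay & Da & Cax & Cay), Cn_u2x as (_ & bx & by' & Db & Cbx & Cby).
  destruct (Cn_grad 0 Ws Wt CWs CWt) as [CWx CWy].
  (* Symmetry of the mixed derivatives of [u1] and [u2] turns the curl and divergence relations into
     [Delta u = (- W_y, W_x)]. *)
  assert (S1 : forall x y, exterior x y -> ay x y = bx x y - grad_x Ws Wt x y).
  { apply (Schwarz_exterior u1 u1x (fun x y => u2x x y - W x y)); try assumption.
    - exact is_derive_u1.
    - intros x y H; now apply Da.
    - intros x y H. apply (is_derive_Rminus (fun z => u2x z y)); [now apply Db|now apply HW].
    - apply (Cn_plus 0 bx); [assumption|now apply Cn_opp]. }
  assert (S2 : forall x y, exterior x y -> by' x y = - ax x y).
  { apply (Schwarz_exterior u2 u2x (fun x y => - u1x x y)); try assumption.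
    - exact is_derive_u2.
    - intros x y H; now apply Db.
    - intros x y H. apply (is_derive_Ropp (fun z => u1x z y)); now apply Da.
    - now apply Cn_opp. }
  split; intros x y H; destruct (is_derive_u1 x y H) as [X1 Y1], (is_derive_u2 x y H) as [X2 Y2].
  - assert (P : dx prs x y = u2 x y * W x y - grad_y Ws Wt x y - (u1 x y * u1x x y + u2 x y * u2x x y) /\
               dy prs x y = grad_x Ws Wt x y - u1 x y * W x y - (u1 x y * (u2x x y - W x y) + u2 x y * (- u1x x y))).
    { destruct (Q_gradient x y H) as [Q1 Q2].
      split; apply is_derive_unique.
      - eapply (is_derive_eq (fun z => prs z y)); [unfold prs; derive_tac|field].
      - eapply (is_derive_eq (fun z => prs x z)); [unfold prs; derive_tac|field]. }
    destruct P as [-> ->].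
    change (dx u1 x y) with (Derive (fun z => u1 z y) x). change (dy u1 x y) with (Derive (fun z => u1 x z) y).
    change (dx u2 x y) with (Derive (fun z => u2 z y) x). change (dy u2 x y) with (Derive (fun z => u2 x z) y).
    assert (Z1 : Derive (fun z => u1 z y) x = u1x x y) by now apply is_derive_unique.
    assert (Z2 : Derive (fun z => u2 z y) x = u2x x y) by now apply is_derive_unique.
    assert (Z3 : Derive (fun z => u1 x z) y = u2x x y - W x y) by now apply is_derive_unique.
    assert (Z4 : Derive (fun z => u2 x z) y = - u1x x y) by now apply is_derive_unique.
    rewrite Z1, Z2, Z3, Z4.
    assert (L1 : laplacian u1 x y = - grad_y Ws Wt x y).
    { unfold laplacian.
      change (partial_derive 2 0 u1 x y) with (Derive (fun t => Derive (fun z => u1 z y) t) x).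
      change (partial_derive 0 2 u1 x y) with (Derive (fun t => Derive (fun z => u1 x z) t) y).
      assert (T1 : Derive (fun t => Derive (fun z => u1 z y) t) x = ax x y).
      { transitivity (Derive (fun z => u1x z y) x).
        - apply (Derive_exterior_x (fun u v => Derive (fun z => u1 z v) u)); [exact H|].
          intros; now apply is_derive_unique, is_derive_u1.
        - now apply is_derive_unique, Da. }
      assert (T2 : Derive (fun t => Derive (fun z => u1 x z) t) y = by' x y - grad_y Ws Wt x y).
      { transitivity (Derive (fun z => u2x x z - W x z) y).
        - apply (Derive_exterior_y (fun u v => Derive (fun z => u1 u z) v) (fun x y => u2x x y - W x y)); [exact H|].
          intros; now apply is_derive_unique, is_derive_u1.
        - apply is_derive_unique. apply is_derive_Rminus; [now apply Db|now apply HW]. }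
      rewrite T1, T2, (S2 x y H). ring. }
    assert (L2 : laplacian u2 x y = grad_x Ws Wt x y).
    { unfold laplacian.
      change (partial_derive 2 0 u2 x y) with (Derive (fun t => Derive (fun z => u2 z y) t) x).
      change (partial_derive 0 2 u2 x y) with (Derive (fun t => Derive (fun z => u2 x z) t) y).
      assert (T1 : Derive (fun t => Derive (fun z => u2 z y) t) x = bx x y).
      { transitivity (Derive (fun z => u2x z y) x).
        - apply (Derive_exterior_x (fun u v => Derive (fun z => u2 z v) u)); [exact H|].
          intros; now apply is_derive_unique, is_derive_u2.
        - now apply is_derive_unique, Db. }
      assert (T2 : Derive (fun t => Derive (fun z => u2 x z) t) y = - ay x y).
      { transitivity (Derive (fun z => - u1x x z) y).
        - apply (Derive_exterior_y (fun u v => Derive (fun z => u2 u z) v) (fun x y => - u1x x y)); [exact H|].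
          intros; now apply is_derive_unique, is_derive_u2.
        - apply is_derive_unique. apply is_derive_Ropp. now apply Da. }
      rewrite T1, T2, (S1 x y H). ring. }
    rewrite L1, L2. split; ring.
  - change (Derive (fun z => u1 z y) x + Derive (fun z => u2 x z) y = 0).
    replace (Derive (fun z => u1 z y) x) with (u1x x y) by (symmetry; now apply is_derive_unique).
    replace (Derive (fun z => u2 x z) y) with (- u1x x y) by (symmetry; now apply is_derive_unique). ring.
Qed.

End Potentials.

Lemma Rabs_m1 : Rabs (-1) = 1.
Proof. rewrite Rabs_left; lra. Qed.

Lemma ang_polar t r th : 0 < r -> ang t (r * cos th) (r * sin th) = (cos (fr t * th), sin (fr t * th)).
Proof.
  intros Hr.
  assert (E : sqrt ((r * cos th) ^ 2 + (r * sin th) ^ 2) = r).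
  { replace ((r * cos th) ^ 2 + (r * sin th) ^ 2) with (r ^ 2 * (Rsqr (sin th) + Rsqr (cos th))) by (unfold Rsqr; ring).
    rewrite sin2_cos2, Rmult_1_r. apply sqrt_pow2; lra. }
  induction t as [n|e t1 IH1 t2 IH2]; cbn [ang].
  - unfold fr; simpl idx. rewrite <- INR_IZR_INZ.
    assert (E1 : unit_at (r * cos th) (r * sin th) = (cos th, sin th)).
    { unfold unit_at. rewrite E. f_equal; field; lra. }
    rewrite E1. induction n as [|n IH].
    + simpl. rewrite Rmult_0_l, cos_0, sin_0. reflexivity.
    + cbn [Cpow]. rewrite IH, S_INR, Rmult_plus_distr_r, Rmult_1_l, cos_plus, sin_plus.
      apply C_ext; simpl; ring.
  - rewrite IH1, IH2, fr_Node. destruct e; simpl cj.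
    + rewrite Rmult_plus_distr_r, cos_plus, sin_plus. apply C_ext; simpl; ring.
    + rewrite Rmult_minus_distr_r, cos_minus, sin_minus. apply C_ext; simpl; ring.
Qed.

Lemma lnr_polar r th : 0 < r -> lnr (r * cos th) (r * sin th) = ln r.
Proof.
  intros Hr. unfold lnr.
  replace ((r * cos th) ^ 2 + (r * sin th) ^ 2) with (r ^ 2 * (Rsqr (sin th) + Rsqr (cos th))) by (unfold Rsqr; ring).
  rewrite sin2_cos2, Rmult_1_r, ln_pow by assumption. simpl INR. lra.
Qed.

Lemma exp_2_lnr x y : 0 < x ^ 2 + y ^ 2 -> exp (2 * lnr x y) = x * x + y * y.
Proof.
  intros H. unfold lnr. replace (2 * (/ 2 * ln (x ^ 2 + y ^ 2))) with (ln (x ^ 2 + y ^ 2)) by field.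
  rewrite exp_ln by assumption. ring.
Qed.

Lemma polar_exterior_closed r th : 1 <= r -> exterior_closed (r * cos th) (r * sin th).
Proof.
  intros Hr. unfold exterior_closed.
  replace ((r * cos th) ^ 2 + (r * sin th) ^ 2) with (r ^ 2 * (Rsqr (sin th) + Rsqr (cos th))) by (unfold Rsqr; ring).
  rewrite sin2_cos2. nra.
Qed.

(** * The flow summed over trees and its bounds *)

Section Assembly.

Context (k : R) (bd : nat -> C) (XM : R).
Context (Hk : 4 <= k) (HX : forall j, Tsum j (size k bd) <= XM).

Local Notation N := (size k bd).
Let B := 10 * k * lam k.
Let N0 : forall t, 0 <= N t := fun t => size_nonneg k bd t Hk.

Definition fU := SF (inth (gps k bd)).
Definition fV := SF (gph k bd).
Definition fW := SF (gom k bd).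
Definition fQ := SF (gqq k bd).
Definition fM1 := SF (inth (gph k bd)).
Definition fM2 := SF (inth (inth (gps k bd))).
Definition fWs := SF (gch k bd).
Definition fWt := SF (inth (gom k bd)).

Lemma Cn_0_SF g : (forall t, Ccontinuous (g t)) -> dom N B g -> Cn 0 (SF g).
Proof. intros Hc Hd; split; [|trivial]. intros x y H. exact (SF_cont2 N XM N0 HX g B x y Hc Hd H). Qed.

Lemma SF_gradient g g' :
  (forall t s, Cderive (g t) s (g' t s)) -> (forall t, Ccontinuous (g' t)) ->
  dom N B g -> dom N B g' -> dom N B (inth g) -> log_polar_gradient (SF g) (SF g') (SF (inth g)).
Proof.
  intros Hd Hc D1 D2 D3 x y H. split.
  - exact (SF_dx N XM N0 HX g g' B x y Hd Hc D1 D2 D3 H).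
  - exact (SF_dy N XM N0 HX g g' B x y Hd Hc D1 D2 D3 H).
Qed.

Lemma gradient_ext G Gs Gs' Gt Gt' : (forall x y, exterior x y -> Gs x y = Gs' x y) ->
  (forall x y, exterior x y -> Gt x y = Gt' x y) -> log_polar_gradient G Gs Gt -> log_polar_gradient G Gs' Gt'.
Proof.
  intros E1 E2 H x y Hxy. destruct (H x y Hxy) as [H1 H2].
  unfold grad_x, grad_y in *. now rewrite <- (E1 x y Hxy), <- (E2 x y Hxy).
Qed.

Lemma SF_phs x y : exterior x y -> SF (gphs k bd) x y = Vs fW fM2 x y.
Proof.
  intros H. pose proof (exterior_pos _ _ H) as Hp. pose proof (exterior_exterior_closed _ _ H) as Hc.
  unfold SF. rewrite (Tseries_ext _ (fun t => -1 * fld (inth (inth (gps k bd)) t) t x y + - (x * x + y * y) * fld (gom k bd t) t x y)).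
  - rewrite (Tseries_comb N XM N0 HX _ _ B B).
    + unfold Vs, fW, fM2, SF. ring.
    + intros t. apply (dom_fld N B _ t x y); [now apply dom_inth2_ps|exact Hc].
    + intros t. apply (dom_fld N B _ t x y); [now apply dom_om|exact Hc].
  - intros t. unfold fld, gphs, inth, e2. rewrite exp_2_lnr by exact Hp.
    unfold Re; cbn -[gps gom ang lnr fr pow]. ring.
Qed.

(** The two booleans add [Re (a * b)] and [Re (a * conj b)], which with the factor [/ 2] is
    [Re a * Re b]: summed over trees, the node sources become the product of the summed fields. *)
Lemma SF_srcG x y : exterior_closed x y -> SF (srcG k bd) x y = fV x y * fW x y.
Proof.
  intros Hc. unfold SF, fV, fW. apply (Tseries_Node N XM N0 HX _ _ _ B B).
  - intros t. apply (dom_fld N B (gph k bd) t x y); [now apply dom_ph|exact Hc].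
  - intros t. apply (dom_fld N B (gom k bd) t x y); [now apply dom_om|exact Hc].
  - intros n. unfold fld; simpl srcG. unfold Re; simpl; ring.
  - intros t1 t2. unfold fld; cbn [srcG ang]. unfold nodeG; cbn [cj].
    change (ph (sol k bd t1)) with (gph k bd t1). change (om (sol k bd t2)) with (gom k bd t2).
    unfold Re; cbn -[gph gom ang lnr]. field.
Qed.

Lemma SF_srcA x y : exterior_closed x y -> SF (srcA k bd) x y = fU x y * fW x y.
Proof.
  intros Hc. unfold SF, fU, fW. apply (Tseries_Node N XM N0 HX _ _ _ B B).
  - intros t. apply (dom_fld N B (inth (gps k bd)) t x y); [now apply dom_inth_ps|exact Hc].
  - intros t. apply (dom_fld N B (gom k bd) t x y); [now apply dom_om|exact Hc].
  - intros n. unfold fld; simpl srcA. unfold Re; simpl; ring.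
  - intros t1 t2. unfold fld; cbn [srcA ang]. unfold nodeA, inth; cbn [cj].
    change (ps (sol k bd t1)) with (gps k bd t1). change (om (sol k bd t2)) with (gom k bd t2).
    unfold Re; cbn -[gps gom ang lnr fr]. field.
Qed.

Lemma SF_qs x y : exterior_closed x y -> SF (gqs k bd) x y = Qs (lam k) fV fW fWt x y.
Proof.
  intros Hc.
  assert (B1 : forall t, Rabs (fld (gom k bd t) t x y) <= B * N t) by (intros t; apply (dom_fld N B (gom k bd) t x y); [now apply dom_om|exact Hc]).
  assert (B2 : forall t, Rabs (fld (inth (gom k bd) t) t x y) <= B * N t) by (intros t; apply (dom_fld N B (inth (gom k bd)) t x y); [now apply dom_inth_om|exact Hc]).
  assert (B3 : forall t, Rabs (fld (srcG k bd t) t x y) <= B * N t) by (intros t; apply (dom_fld N B (srcG k bd) t x y); [now apply dom_srcG|exact Hc]).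
  unfold Qs. rewrite <- SF_srcG by exact Hc. unfold fW, fWt, SF.
  rewrite (Tseries_ext _ (fun t => 1 * (lam k * fld (gom k bd t) t x y + -1 * fld (inth (gom k bd) t) t x y) + -1 * fld (srcG k bd t) t x y)).
  - rewrite (Tseries_comb N XM N0 HX _ _ (lam k * B + B) B).
    + rewrite (Tseries_comb N XM N0 HX _ _ B B) by assumption. ring.
    + intros t. eapply Rle_trans; [apply Rabs_triang|]. rewrite !Rabs_mult, Rabs_m1.
      assert (0 <= lam k) by (unfold lam; nra). rewrite (Rabs_pos_eq (lam k)) by assumption.
      specialize (B1 t); specialize (B2 t). nra.
    + exact B3.
  - intros t. unfold fld, gqs. unfold Re; cbn -[gom inth srcG ang lnr lam]. ring.
Qed.

Lemma SF_inth_qq x y : exterior_closed x y -> SF (inth (gqq k bd)) x y = Qt fU fW fWs x y.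
Proof.
  intros Hc. unfold Qt. rewrite <- SF_srcA by exact Hc. unfold fWs, SF.
  rewrite (Tseries_ext _ (fun t => 1 * fld (gch k bd t) t x y + -1 * fld (srcA k bd t) t x y)).
  - rewrite (Tseries_comb N XM N0 HX _ _ B B); [ring| |].
    + intros t. apply (dom_fld N B (gch k bd) t x y); [now apply dom_ch|exact Hc].
    + intros t. apply (dom_fld N B (srcA k bd) t x y); [now apply dom_srcA|exact Hc].
  - intros t. unfold fld. rewrite inth_qq by exact Hk. unfold Re; cbn -[gch srcA ang lnr]. ring.
Qed.

Lemma flow_navier_stokes :
  navier_stokes_exterior (u1 (lam k) fU fV) (u2 (lam k) fU fV) (prs (lam k) fU fV fQ).
Proof.
  (* The first derivatives of [psi_t] and [psi_s] are combinations of [fM1], [fM2] and [fW]; these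
     have to be [C^1] for the velocity to be [C^2]. *)
  assert (CM1 : Cn 1 fM1).
  { apply (Cn_S_gradient 0 _ (SF (inth (gphs k bd))) (SF (inth (inth (gph k bd))))).
    - apply Cn_0_SF; [intros; now apply inth_continuous, cont_ph|now apply dom_inth_ph].
    - apply SF_gradient; [intros; now apply Cder_inth, Cder_ph|intros; now apply inth_continuous, cont_phs| | |].
      + now apply dom_inth_ph. + now apply dom_inth_phs. + now apply dom_inth2_ph.
    - apply Cn_0_SF; [intros; now apply inth_continuous, cont_phs|now apply dom_inth_phs].
    - apply Cn_0_SF; [intros; now apply inth_continuous, inth_continuous, cont_ph|now apply dom_inth2_ph]. }
  assert (CM2 : Cn 1 fM2).
  { apply (Cn_S_gradient 0 _ (SF (inth (inth (gph k bd)))) (SF (inth (inth (inth (gps k bd)))))).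
    - apply Cn_0_SF; [intros; now apply inth_continuous, inth_continuous, cont_ps|now apply dom_inth2_ps].
    - apply SF_gradient; [intros; now apply Cder_inth, Cder_inth_ps|intros; now apply inth_continuous, inth_continuous, cont_ph| | |].
      + now apply dom_inth2_ps. + now apply dom_inth2_ph. + now apply dom_inth3_ps.
    - apply Cn_0_SF; [intros; now apply inth_continuous, inth_continuous, cont_ph|now apply dom_inth2_ph].
    - apply Cn_0_SF; [intros; now apply inth_continuous, inth_continuous, inth_continuous, cont_ps|now apply dom_inth3_ps]. }
  assert (CWs : Cn 0 fWs) by (apply Cn_0_SF; [intros; now apply cont_ch|now apply dom_ch]).
  assert (CWt : Cn 0 fWt) by (apply Cn_0_SF; [intros; now apply inth_continuous, cont_om|now apply dom_inth_om]).
  assert (HW : log_polar_gradient fW fWs fWt).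
  { apply SF_gradient; [intros; now apply Cder_om|intros; now apply cont_ch| | |].
    - now apply dom_om. - now apply dom_ch. - now apply dom_inth_om. }
  assert (CW : Cn 1 fW).
  { apply (Cn_S_gradient 0 _ fWs fWt); try assumption.
    apply Cn_0_SF; [intros; now apply cont_om|now apply dom_om]. }
  apply (navier_stokes_of_potentials (lam k) fU fV fW fQ fM1 fM2 fWs fWt); try assumption.
  - apply Cn_0_SF; [intros; now apply inth_continuous, cont_ps|now apply dom_inth_ps].
  - apply Cn_0_SF; [intros; now apply cont_ph|now apply dom_ph].
  - apply Cn_0_SF; [intros t; apply (Cderive_continuous _ _ (Cder_qq k bd Hk t))|now apply dom_qq].
  - apply SF_gradient; [intros; now apply Cder_inth_ps|intros; now apply inth_continuous, cont_ph| | |].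
    + now apply dom_inth_ps. + now apply dom_inth_ph. + now apply dom_inth2_ps.
  - apply (gradient_ext _ (SF (gphs k bd)) _ fM1 _ SF_phs (fun _ _ _ => eq_refl)).
    apply SF_gradient; [intros; now apply Cder_ph|intros; now apply cont_phs| | |].
    + now apply dom_ph. + now apply dom_phs. + now apply dom_inth_ph.
  - apply (gradient_ext _ (SF (gqs k bd)) _ (SF (inth (gqq k bd))) _).
    + intros; now apply SF_qs, exterior_exterior_closed.
    + intros; now apply SF_inth_qq, exterior_exterior_closed.
    + apply SF_gradient; [intros; now apply Cder_qq|intros; now apply cont_qs| | |].
      * now apply dom_qq. * now apply dom_qs. * now apply dom_inth_qq.
Qed.

Lemma continuous_up_to_boundary_plus f g :
  continuous_up_to_boundary f -> continuous_up_to_boundary g -> continuous_up_to_boundary (fun x y => f x y + g x y).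
Proof.
  intros Hf Hg x y H. eapply filterlim_comp_2; [apply Hf, H|apply Hg, H|].
  apply (filterlim_plus (V := R_NormedModule)).
Qed.

Lemma continuous_up_to_boundary_mult f g :
  continuous_up_to_boundary f -> continuous_up_to_boundary g -> continuous_up_to_boundary (fun x y => f x y * g x y).
Proof.
  intros Hf Hg x y H. eapply filterlim_comp_2; [apply Hf, H|apply Hg, H|].
  apply (filterlim_mult (K := R_AbsRing)).
Qed.

Lemma continuous_up_to_boundary_cont2 f :
  (forall x y, exterior_closed x y -> cont2 f x y) -> continuous_up_to_boundary f.
Proof.
  intros Hf x y H. apply (filterlim_filter_le_1 (F := locally (x, y))); [apply filter_le_within|now apply Hf].
Qed.

Lemma flow_continuous_up_to_boundary :
  continuous_up_to_boundary (u1 (lam k) fU fV) /\ continuous_up_to_boundary (u2 (lam k) fU fV).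
Proof.
  assert (CU : continuous_up_to_boundary fU).
  { apply (SF_continuous N XM N0 HX _ B); [intros; now apply inth_continuous, cont_ps|now apply dom_inth_ps]. }
  assert (CV : continuous_up_to_boundary fV).
  { apply (SF_continuous N XM N0 HX _ B); [intros; now apply cont_ph|now apply dom_ph]. }
  assert (CLV : continuous_up_to_boundary (fun x y => lam k + - fV x y)).
  { intros x y H P HP.
    pose proof (continuous_up_to_boundary_plus (fun _ _ => lam k) (fun x y => -1 * fV x y)) as X.
    assert (Y : continuous_up_to_boundary (fun x y => lam k + -1 * fV x y)).
    { apply X; [apply continuous_up_to_boundary_cont2; intros; apply cont2_const|].
      apply continuous_up_to_boundary_mult; [apply continuous_up_to_boundary_cont2; intros; apply cont2_const|exact CV]. }
    replace (lam k + - fV x y) with (lam k + -1 * fV x y) in HP by ring.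
    specialize (Y x y H P HP). unfold filtermap in *. revert Y; apply filter_imp.
    intros z Hz. replace (lam k + - fV (fst z) (snd z)) with (lam k + -1 * fV (fst z) (snd z)) by ring. exact Hz. }
  assert (CI : continuous_up_to_boundary ir2).
  { apply continuous_up_to_boundary_cont2. intros x y H. pose proof (exterior_closed_pos _ _ H).
    apply (cont2_comp Rinv (fun x y => x ^ 2 + y ^ 2)); [apply cont2_r2|apply continuous_Rinv; lra]. }
  assert (Cx : continuous_up_to_boundary (fun x _ => x)) by (apply continuous_up_to_boundary_cont2; intros; apply cont2_x).
  assert (Cy : continuous_up_to_boundary (fun _ y => y)) by (apply continuous_up_to_boundary_cont2; intros; apply cont2_y).
  assert (Cny : continuous_up_to_boundary (fun _ y => - y)) by (apply continuous_up_to_boundary_cont2; intros; apply cont2_opp, cont2_y).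
  split.
  - pose proof (continuous_up_to_boundary_mult _ _ (continuous_up_to_boundary_plus _ _ (continuous_up_to_boundary_mult _ _ Cx CU) (continuous_up_to_boundary_mult _ _ Cny CLV)) CI) as X.
    intros x y H P HP. specialize (X x y H P).
    unfold u1 in *. rewrite Ropp_mult_distr_l in HP. specialize (X HP).
    unfold filtermap in *. revert X; apply filter_imp. intros z Hz. now rewrite Ropp_mult_distr_l.
  - exact (continuous_up_to_boundary_mult _ _ (continuous_up_to_boundary_plus _ _ (continuous_up_to_boundary_mult _ _ Cy CU) (continuous_up_to_boundary_mult _ _ Cx CLV)) CI).
Qed.

Lemma flow_polar r th : 1 <= r ->
  radial (u1 (lam k) fU fV) (u2 (lam k) fU fV) r th = fU (r * cos th) (r * sin th) * / r /\
  azimuthal (u1 (lam k) fU fV) (u2 (lam k) fU fV) r th = (lam k - fV (r * cos th) (r * sin th)) * / r.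
Proof.
  intros Hr. unfold radial, azimuthal, u1, u2.
  set (u := fU _ _). set (v := fV _ _).
  assert (E : ir2 (r * cos th) (r * sin th) = / r * / r).
  { unfold ir2. replace ((r * cos th) ^ 2 + (r * sin th) ^ 2) with (r ^ 2 * (Rsqr (sin th) + Rsqr (cos th))) by (unfold Rsqr; ring).
    rewrite sin2_cos2. field; lra. }
  rewrite E. pose proof (sin2_cos2 th) as T. unfold Rsqr in T.
  set (c := cos th) in *. set (s := sin th) in *.
  split.
  - transitivity (u * / r * (r * / r) * (s * s + c * c)); [ring|]. rewrite T. field; lra.
  - transitivity ((lam k - v) * / r * (r * / r) * (s * s + c * c)); [ring|]. rewrite T. field; lra.
Qed.

(** Limit of [psi_s] at infinity, to which only trees of frequency [0] contribute; [lam k - Vinf]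
    will be the corrected constant [lambda']. *)
Definition Vinf : R := Tseries (fun t => Re (phinf (sol k bd t))).

Lemma Rinv_exp_ln r : 0 < r -> exp (- ln r) = / r.
Proof. intros. now rewrite exp_Ropp, exp_ln. Qed.

(** The bound on [psi] is used with both its decay and its [1 / k], instead of the cruder [gps_le];
    one power of [jap] pays for the angular derivative. The polar form of the velocity supplies the
    second [1 / r]. *)
Lemma fU_le r th : 1 <= r -> Rabs (fU (r * cos th) (r * sin th)) <= 2 / k * XM * / r.
Proof.
  intros Hr. pose proof (polar_exterior_closed r th Hr) as Hc.
  assert (Hir : 0 < / r) by (apply Rinv_0_lt_compat; lra).
  assert (Hs : 0 <= ln r) by (rewrite <- ln_1; apply ln_le; lra).
  assert (H2k : 0 < 2 / k) by (apply Rdiv_lt_0_compat; lra).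
  replace (2 / k * XM * / r) with ((2 / k * / r) * XM) by ring.
  unfold fU, SF. apply (Tseries_abs_le N XM N0 HX _ B).
  - intros t. apply (dom_fld N B _ t); [now apply dom_inth_ps|exact Hc].
  - intros t. unfold fld. rewrite lnr_polar by lra.
    eapply Rle_trans; [apply re_le_Cmod|]. rewrite Cmod_mult, Cmod_ang, Rmult_1_r by now apply exterior_closed_pos.
    eapply Rle_trans.
    + apply Cmod_inth_le. exact (g_psle (sol_good k bd t Hk) (ln r) Hs).
    + rewrite Rinv_exp_ln by lra. destruct (wt_pow_le k bd Hk t) as (_ & W1 & _).
      replace (jap (fr t) * (/ r * (2 * wt k bd t / k))) with (2 / k * / r * (jap (fr t) * wt k bd t)) by (field; lra).
      apply Rmult_le_compat_l; [nra|exact W1].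
  - nra.
Qed.

Lemma phinf_ang t r th : 0 < r ->
  Re (phinf (sol k bd t) * ang t (r * cos th) (r * sin th))%C = Re (phinf (sol k bd t)).
Proof.
  intros Hr. destruct (Req_dec (fr t) 0) as [E|E].
  - rewrite ang_polar, E, Rmult_0_l, cos_0, sin_0 by exact Hr. unfold Re; simpl; ring.
  - rewrite (g_phinf0 (sol_good k bd t Hk) E). unfold Re; simpl; ring.
Qed.

Lemma phinf_le t : Rabs (Re (phinf (sol k bd t))) <= 1 * N t.
Proof.
  eapply Rle_trans; [apply re_le_Cmod|]. eapply Rle_trans; [apply (g_phinf (sol_good k bd t Hk))|].
  destruct (wt_pow_le k bd Hk t) as (W0 & _). lra.
Qed.

Lemma Vinf_le : Rabs Vinf <= XM.
Proof.
  replace XM with (1 * XM) by ring. apply (Tseries_abs_le N XM N0 HX _ 1); [exact phinf_le|exact phinf_le|lra].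
Qed.

Lemma fV_Vinf_le r th : 1 <= r -> Rabs (fV (r * cos th) (r * sin th) - Vinf) <= 2 * XM * / r.
Proof.
  intros Hr. pose proof (polar_exterior_closed r th Hr) as Hc.
  assert (Hir : 0 < / r) by (apply Rinv_0_lt_compat; lra).
  assert (Hs : 0 <= ln r) by (rewrite <- ln_1; apply ln_le; lra).
  assert (D1 : forall t, Rabs (fld (gph k bd t) t (r * cos th) (r * sin th)) <= B * N t).
  { intros t. apply (dom_fld N B _ t); [now apply dom_ph|exact Hc]. }
  assert (E : fV (r * cos th) (r * sin th) - Vinf =
    Tseries (fun t => 1 * fld (gph k bd t) t (r * cos th) (r * sin th) + -1 * Re (phinf (sol k bd t)))).
  { rewrite (Tseries_comb N XM N0 HX _ _ B 1 _ _ D1 phinf_le). unfold fV, SF, Vinf. ring. }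
  rewrite E. replace (2 * XM * / r) with ((2 * / r) * XM) by ring.
  apply (Tseries_abs_le N XM N0 HX _ (B + 1)).
  - intros t. eapply Rle_trans; [apply Rabs_triang|]. rewrite !Rabs_mult, Rabs_m1, Rabs_R1.
    pose proof (D1 t); pose proof (phinf_le t). lra.
  - intros t. rewrite <- (phinf_ang t r th) by lra. unfold fld. rewrite lnr_polar by lra.
    replace (1 * Re (gph k bd t (ln r) * ang t (r * cos th) (r * sin th))%C + -1 * Re (phinf (sol k bd t) * ang t (r * cos th) (r * sin th))%C)
      with (Re ((gph k bd t (ln r) - phinf (sol k bd t)) * ang t (r * cos th) (r * sin th))%C) by (unfold Re; simpl; ring).
    eapply Rle_trans; [apply re_le_Cmod|]. rewrite Cmod_mult, Cmod_ang, Rmult_1_r by now apply exterior_closed_pos.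
    eapply Rle_trans; [exact (g_phdec (sol_good k bd t Hk) (ln r) Hs)|].
    rewrite Rinv_exp_ln by lra. destruct (wt_pow_le k bd Hk t) as (_ & W1 & _).
    replace (/ r * (2 * jap (fr t) * wt k bd t)) with (2 * / r * (jap (fr t) * wt k bd t)) by ring.
    apply Rmult_le_compat_l; [lra|exact W1].
  - lra.
Qed.

Lemma fU_boundary th : fU (1 * cos th) (1 * sin th) = 0.
Proof.
  unfold fU, SF. rewrite (Tseries_ext _ (fun _ => 0)).
  - unfold Tseries. rewrite (Lim_seq_ext _ (fun _ => 0)) by (intros; apply Tsum_zero). now rewrite Lim_seq_const.
  - intros t. unfold fld. rewrite lnr_polar, ln_1 by lra. unfold inth, gps.
    rewrite (g_ps0 (sol_good k bd t Hk)). unfold Re; simpl; ring.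
Qed.

(** At [s = 0] nodes contribute nothing, and the leaves in the sum of depth [J + 1] are those
    labelled [0] to [J]: exactly a Fourier partial sum. *)
Lemma fV_boundary th (l : R) :
  is_lim_seq (fun J => sum_f_R0 (fun n => Re (bd n * (cos (INR n * th), sin (INR n * th)))%C) J) l ->
  fV (1 * cos th) (1 * sin th) = l.
Proof.
  intros H. unfold fV, SF. apply Tseries_unique, is_lim_seq_incr_1.
  eapply is_lim_seq_ext; [|exact H]. intros J. simpl Tsum.
  assert (E : forall t, fld (gph k bd t) t (1 * cos th) (1 * sin th) = Re (bdry bd t * (cos (fr t * th), sin (fr t * th)))%C).
  { intros t. unfold fld. rewrite lnr_polar, ln_1, ang_polar by lra. unfold gph.
    now rewrite (g_ph0 (sol_good k bd t Hk)). }
  rewrite (Tsum_ext J _ (fun _ => 0)).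
  - rewrite Tsum_zero, Rplus_0_r. apply sum_eq; intros n _. rewrite E. unfold fr; simpl bdry; simpl idx.
    now rewrite <- INR_IZR_INZ.
  - intros t1. rewrite (Tsum_ext J _ (fun _ => 0)); [apply Tsum_zero|].
    intros t2. rewrite !E. unfold Re; simpl; ring.
Qed.

End Assembly.

(** Induction on the depth for [X <= s + (864 / lam) X^2], where [864 = 2 * 432] counts the two
    booleans. The bound [2 s] is preserved when [864 * (2 s)^2 <= lam * s], that is
    [3456 * s <= lam]. *)
Lemma Tsum_size_le k bd s : 4 <= k ->
  (forall J, sum_f_R0 (fun n => size k bd (Leaf n)) J <= s) -> 3456 * s <= lam k ->
  forall j, Tsum j (size k bd) <= 2 * s.
Proof.
  intros Hk Hs Hsm.
  assert (s0 : 0 <= s) by (eapply Rle_trans; [|apply (Hs O)]; apply (size_nonneg k bd (Leaf 0) Hk)).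
  assert (Hl : 0 < lam k) by (unfold lam; nra).
  induction j as [|j IH]; [simpl; lra|].
  change (Tsum (S j) (size k bd)) with (sum_f_R0 (fun n => size k bd (Leaf n)) j +
    Tsum j (fun t1 => Tsum j (fun t2 => size k bd (Node true t1 t2) + size k bd (Node false t1 t2)))).
  rewrite (Tsum_ext j _ (fun t1 => Tsum j (fun t2 => (864 / lam k * size k bd t1) * size k bd t2))).
  2: { intros; apply Tsum_ext; intros; cbn [size]; field; lra. }
  rewrite Tsum_prod, Tsum_scal.
  specialize (Hs j). pose proof (Tsum_nonneg j (size k bd) (fun t => size_nonneg k bd t Hk)) as X0.
  set (X := Tsum j (size k bd)) in *.
  assert (864 / lam k * X * X <= s); [|lra].
  apply (Rmult_le_reg_r (lam k)); [exact Hl|].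
  replace (864 / lam k * X * X * lam k) with (864 * (X * X)) by (field; lra).
  assert (X * X <= (2 * s) * (2 * s)) by (apply Rmult_le_compat; assumption). nra.
Qed.

Lemma u_norm k bd x y : 0 < x ^ 2 + y ^ 2 ->
  u1 (lam k) (fU k bd) (fV k bd) x y ^ 2 + u2 (lam k) (fU k bd) (fV k bd) x y ^ 2 =
  (fU k bd x y ^ 2 + (lam k - fV k bd x y) ^ 2) / (x ^ 2 + y ^ 2).
Proof. intros H. unfold u1, u2, ir2. field. simpl in *; lra. Qed.

Lemma polar_coordinates x y : 0 < x ^ 2 + y ^ 2 ->
  exists th, x = sqrt (x ^ 2 + y ^ 2) * cos th /\ y = sqrt (x ^ 2 + y ^ 2) * sin th.
Proof.
  intros H. set (r := sqrt (x ^ 2 + y ^ 2)).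
  assert (Hr : 0 < r) by now apply sqrt_lt_R0.
  assert (E : r ^ 2 = x ^ 2 + y ^ 2) by (apply pow2_sqrt; lra).
  assert (Hb : -1 <= x / r <= 1).
  { assert (Hx : - r <= x <= r).
    { split; nra. }
    split; apply (Rmult_le_reg_r r); try assumption; replace (x / r * r) with x by (field; lra); lra. }
  assert (Hs : sqrt (1 - (x / r)²) = Rabs (y / r)).
  { rewrite <- sqrt_Rsqr_abs. f_equal. unfold Rsqr.
    apply (Rmult_eq_reg_r (r * r)); [|nra]. replace ((1 - x / r * (x / r)) * (r * r)) with (r ^ 2 - x ^ 2) by (field; lra).
    rewrite E. field; lra. }
  destruct (Rle_lt_dec 0 y) as [Hy|Hy].
  - exists (acos (x / r)). rewrite cos_acos, sin_acos, Hs by assumption.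
    rewrite Rabs_pos_eq by (apply Rmult_le_pos; [assumption|left; now apply Rinv_0_lt_compat]).
    split; field; lra.
  - exists (- acos (x / r)). rewrite cos_neg, sin_neg, cos_acos, sin_acos, Hs by assumption.
    rewrite Rabs_left.
    + split; field; lra.
    + unfold Rdiv. pose proof (Rinv_0_lt_compat _ Hr). nra.
Qed.

Lemma flow_vanishes k bd XM : 4 <= k -> (forall j, Tsum j (size k bd) <= XM) ->
  vanishes_at_infinity (u1 (lam k) (fU k bd) (fV k bd)) (u2 (lam k) (fU k bd) (fV k bd)).
Proof.
  intros Hk HX eps Heps.
  assert (X0 : 0 <= XM) by (eapply Rle_trans; [|apply (HX O)]; simpl; lra).
  assert (Hl : 0 <= lam k) by (unfold lam; nra).
  (* Bounds [|psi_t| + |lambda - psi_s|], so that the speed is at most [K / r]. *)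
  set (K := XM + (lam k + 3 * XM)).
  exists (Rmax 1 (K / eps)). intros x y Hxy.
  set (r := sqrt (x ^ 2 + y ^ 2)) in *.
  assert (Hr1 : 1 < r) by (eapply Rle_lt_trans; [apply Rmax_l|exact Hxy]).
  assert (HrK : K / eps < r) by (eapply Rle_lt_trans; [apply Rmax_r|exact Hxy]).
  assert (Hp : 0 < x ^ 2 + y ^ 2).
  { destruct (Rle_lt_dec (x ^ 2 + y ^ 2) 0) as [H|H]; [|exact H]. unfold r in Hr1. rewrite sqrt_neg_0 in Hr1 by exact H. lra. }
  assert (Er : r ^ 2 = x ^ 2 + y ^ 2) by (apply pow2_sqrt; lra).
  destruct (polar_coordinates x y Hp) as [th [Ex Ey]]. fold r in Ex, Ey.
  rewrite u_norm, <- Er by exact Hp.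
  pose proof (fU_le k bd XM Hk HX r th ltac:(lra)) as EU. rewrite <- Ex, <- Ey in EU.
  pose proof (fV_Vinf_le k bd XM Hk HX r th ltac:(lra)) as EV. rewrite <- Ex, <- Ey in EV.
  pose proof (Vinf_le k bd XM Hk HX) as EVi.
  set (u := fU k bd x y) in *. set (v := fV k bd x y) in *.
  assert (Hir : 0 < / r <= 1) by (split; [apply Rinv_0_lt_compat; lra|rewrite <- Rinv_1; apply Rinv_le_contravar; lra]).
  assert (Hk2 : 0 < 2 / k <= 1).
  { split; [apply Rdiv_lt_0_compat; lra|]. apply (Rmult_le_reg_r k); [lra|]. replace (2 / k * k) with 2 by (field; lra). lra. }
  assert (EU' : Rabs u <= XM).
  { eapply Rle_trans; [exact EU|]. assert (2 / k * XM <= XM) by nra. assert (0 <= 2 / k * XM) by nra. nra. }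
  assert (EV' : Rabs (lam k - v) <= lam k + 3 * XM).
  { replace (lam k - v) with (lam k + (- (v - Vinf k bd) + - Vinf k bd)) by ring.
    eapply Rle_trans; [apply Rabs_triang|]. rewrite (Rabs_pos_eq (lam k)) by assumption.
    apply Rplus_le_compat_l. eapply Rle_trans; [apply Rabs_triang|]. rewrite !Rabs_Ropp.
    assert (2 * XM * / r <= 2 * XM) by nra. lra. }
  apply Rle_lt_trans with (K / r).
  - rewrite <- (sqrt_pow2 (K / r)).
    + apply sqrt_le_1_alt. replace ((K / r) ^ 2) with (K ^ 2 / r ^ 2) by (field; lra).
      apply Rmult_le_compat_r; [left; apply Rinv_0_lt_compat; nra|].
      rewrite <- (pow2_abs u), <- (pow2_abs (lam k - v)). unfold K.
      pose proof (Rabs_pos u). pose proof (Rabs_pos (lam k - v)). nra.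
    + unfold K. apply Rmult_le_pos; lra.
  - apply (Rmult_lt_reg_r r); [lra|]. replace (K / r * r) with K by (field; lra).
    apply (Rmult_lt_reg_r (/ eps)); [now apply Rinv_0_lt_compat|].
    replace (eps * r * / eps) with r by (field; lra). exact HrK.
Qed.

Theorem theorem1p3 (f : R -> R) (hf : smooth_periodic f) :
  exists lambda0 delta0 C c : R,
    0 < lambda0 /\ 0 < delta0 /\ 0 < C /\ 1 <= c /\
    forall lambda delta : R,
      lambda0 <= lambda -> 0 < delta -> delta <= delta0 ->
      exists (u1 u2 p : R -> R -> R) (lambda' : R),
        navier_stokes_exterior u1 u2 p /\
        boundary_conditions u1 u2
          (fun theta : R => lambda + lambda * delta * f theta) /\
        vanishes_at_infinity u1 u2 /\
        (/ c * lambda <= lambda' /\ lambda' <= c * lambda) /\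
        forall r theta : R, 1 <= r ->
          Rabs (azimuthal u1 u2 r theta - lambda' * / r)
            <= C * lambda * delta * / r ^ 2 /\
          Rabs (radial u1 u2 r theta)
            <= C * sqrt lambda * delta * / r ^ 2.
Proof.
  destruct (fcoef_summable f hf) as [Cf [HC1 HCf]].
  (* [256] gives [k >= 4]; [20000] exceeds [3456 * 5 = 17280], the smallness condition of the
     majorant for [s = 5 lambda delta Cf]; [80] comes from the radial bound; [2] is generous, since
     the limit at infinity moves by at most [2 s <= lambda / 2000]. *)
  exists 256, (/ (20000 * Cf)), (80 * Cf), 2.
  split; [lra|]. split; [apply Rinv_0_lt_compat; lra|]. split; [lra|]. split; [lra|].
  intros lambda delta Hl Hd Hd0.
  assert (Hdc : delta * Cf <= / 20000).
  { apply (Rmult_le_reg_r (/ Cf)); [apply Rinv_0_lt_compat; lra|].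
    replace (delta * Cf * / Cf) with delta by (field; lra).
    rewrite <- Rinv_mult. exact Hd0. }
  set (k := sqrt lambda / 4).
  assert (Hsq : 16 <= sqrt lambda).
  { replace 16 with (sqrt (16 ^ 2)) by (apply sqrt_pow2; lra). apply sqrt_le_1_alt. lra. }
  assert (Hk : 4 <= k) by (unfold k; lra).
  assert (Elam : lam k = lambda).
  { unfold lam, k. replace (16 * (sqrt lambda / 4) ^ 2) with (sqrt lambda ^ 2) by field. apply pow2_sqrt; lra. }
  (* The tangential velocity on the circle is [lambda - psi_s], whence the minus sign. *)
  set (bd := fun n => (RtoC (- (lambda * delta)) * fcoef f n)%C).
  set (s := 5 * lambda * delta * Cf).
  assert (Hld : 0 < lambda * delta) by nra.
  assert (HX : forall j, Tsum j (size k bd) <= 2 * s).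
  { apply Tsum_size_le; [exact Hk| |rewrite Elam; unfold s; nra].
    intros J. apply Rle_trans with (5 * (lambda * delta) * sum_f_R0 (fun n => Cmod (fcoef f n) * jap (INR n) ^ 3) J).
    - right. rewrite scal_sum. apply sum_eq; intros n _. cbn [size]. unfold bd.
      rewrite Cmod_mult, Cmod_R, Rabs_Ropp, Rabs_pos_eq by lra. ring.
    - unfold s. replace (5 * lambda * delta * Cf) with (5 * (lambda * delta) * Cf) by ring.
      apply Rmult_le_compat_l; [lra|apply HCf]. }
  exists (u1 (lam k) (fU k bd) (fV k bd)), (u2 (lam k) (fU k bd) (fV k bd)),
    (prs (lam k) (fU k bd) (fV k bd) (fQ k bd)), (lambda - Vinf k bd).
  split; [now apply flow_navier_stokes with (2 * s)|].
  assert (HV : forall th, fV k bd (1 * cos th) (1 * sin th) = - (lambda * delta * f th)).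
  { intros th. apply fV_boundary; [exact Hk|].
    pose proof (is_lim_seq_scal_l _ (- (lambda * delta)) _ (fourier_series f th hf)) as H.
    simpl Rbar_mult in H. replace (- (lambda * delta * f th)) with (- (lambda * delta) * f th) by ring.
    eapply is_lim_seq_ext; [|exact H]. intros J; simpl. rewrite scal_sum. apply sum_eq; intros n _.
    unfold bd, fpart. unfold Re; simpl; ring. }
  destruct (flow_continuous_up_to_boundary k bd (2 * s) Hk HX) as [C1 C2].
  split; [|split; [|split]].
  - split; [exact C1|split; [exact C2|]]. intros th.
    destruct (flow_polar k bd 1 th (Rle_refl 1)) as [-> ->].
    rewrite HV, (fU_boundary k bd Hk), Elam. split; field.
  - now apply flow_vanishes with (2 * s).
  - pose proof (Vinf_le k bd (2 * s) Hk HX) as H. apply Rabs_le_between in H.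
    assert (2 * s <= lambda / 2).
    { unfold s. assert (lambda * (delta * Cf) <= lambda * / 20000) by (apply Rmult_le_compat_l; lra). lra. }
    lra.
  - intros r th Hr. destruct (flow_polar k bd r th Hr) as [-> ->].
    assert (Hir : 0 < / r) by (apply Rinv_0_lt_compat; lra).
    assert (Hr2 : / r ^ 2 = / r * / r) by (field; lra).
    split.
    + rewrite Elam. replace ((lambda - fV k bd (r * cos th) (r * sin th)) * / r - (lambda - Vinf k bd) * / r)
        with (- (fV k bd (r * cos th) (r * sin th) - Vinf k bd) * / r) by ring.
      rewrite Rabs_mult, Rabs_Ropp, (Rabs_pos_eq (/ r)) by lra.
      pose proof (fV_Vinf_le k bd (2 * s) Hk HX r th Hr) as H.
      rewrite Hr2, <- Rmult_assoc. apply Rmult_le_compat_r; [lra|].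
      eapply Rle_trans; [exact H|]. apply Rmult_le_compat_r; [lra|]. unfold s. nra.
    + rewrite Rabs_mult, (Rabs_pos_eq (/ r)) by lra.
      pose proof (fU_le k bd (2 * s) Hk HX r th Hr) as H.
      rewrite Hr2, <- Rmult_assoc. apply Rmult_le_compat_r; [lra|].
      eapply Rle_trans; [exact H|]. apply Rmult_le_compat_r; [lra|].
      (* [(2 / k) * 2 s = 20 lambda delta Cf / k] and [lambda / k = 16 k = 4 sqrt lambda]: equality
         holds with the constant 80. *)
      right. unfold s. rewrite <- Elam at 1. unfold lam.
      replace (sqrt lambda) with (4 * k) by (unfold k; field). field. lra.
Qed.
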